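(* Let $A_0,A_1$ be Hurwitz matrices in $\mathcal{M}_d(\mathbb{R})$, let $b_0\neq b_1$ be vectors of $\mathbb{R}^d$, let $\lambda_0,\lambda_1>0$, and let $(Y_n)_{n\ge 0}$ be the Markov chain $Y_n=X_{T_{2n}}$ on $\mathbb{R}^d$ defined in the context. (1) Suppose that no deterministic control makes the associated deterministic system explode (as defined in the context). Then there exists an invariant probability measure $\mu$ for $(Y_n)$, and the support of $\mu$ is bounded. (2) Suppose that $\chi<0$ and that the following three conditions hold. (a) There is an odd integer $k\ge1$ such that for every $x\in\mathbb{S}_{d-1}$ there exist $t_0,t_1,\dots,t_k>0$ with $$\|e^{t_kA_{i_k}}\cdots e^{t_1A_{i_1}}e^{t_0A_{i_0}}x\|>\|x\|,$$ where $i_j=0$ for $j$ even and $i_j=1$ for $j$ odd. Fix such a $k$, let $B=e^{\tau_kA_{i_k}}\cdots e^{\tau_1A_{i_1}}e^{\tau_0A_{i_0}}$, where $\tau_0,\dots,\tau_k$ are independent and $\tau_j$ is exponentially distributed with parameter $\lambda_{i_j}$, and let $B_0,B_1,B_2,\dots$ be i.i.d. random matrices with the law of $B$. (b) For all $x\in\mathbb{S}_{d-1}$ and every nonempty open set $U\subset\mathbb{S}_{d-1}$, $$\max_{n\ge0}\ \mathbb{P}\left(\frac{B_n\cdots B_0x}{\|B_n\cdots B_0x\|}\in U\right)>0 .$$ (c) There exist $\Gamma_0\in GL_d(\mathbb{R})$, $n_0\in\mathbb{N}$ and $c,\gamma_0>0$ such that $$\mathbb{P}(B_{n_0}\cdots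 B_0\in\cdot\,)\ \ge\ \gamma_0\,\mathbf{1}_{B_c(\Gamma_0)}\,\lambda .$$ Then there exists a unique invariant probability measure $\mu$ for $(Y_n)$, and it has a heavy tail: there exists $p_1>0$ such that $$\mathbb{E}_\mu[\|Y\|^p]<+\infty\ \text{ for all } 0\le p<p_1,\qquad \mathbb{E}_\mu[\|Y\|^p]=+\infty\ \text{ for all } p>p_1,$$ where under $\mathbb{E}_\mu$ the variable $Y$ has law $\mu$.
   Context: A matrix is Hurwitz if all its eigenvalues have negative real part. Let $(I_t)_{t\ge0}$ be the Markov chain on $\{0,1\}$ jumping from state $i$ to state $1-i$ at rate $\lambda_i$, with $I_0=0$, and let $(X_t)_{t\ge0}$ be the continuous $\mathbb{R}^d$-valued process solving $$\dot X_t=A_{I_t}(X_t-b_{I_t}),\qquad X_0=x_0 .$$ Let $T_0=0<T_1<T_2<\cdots$, where $T_1,T_2,\dots$ are the successive jump times of $(I_t)$. The interjump times are independent and exponentially distributed with parameters $\lambda_0$ and $\lambda_1$ alternately. Set $Y_n=X_{T_{2n}}$, which is a Markov chain on $\mathbb{R}^d$. The associated deterministic system is $\dot x_t=A_{v_t}(x_t-b_{v_t})$, $x_0\in\mathbb{R}^d$, where the deterministic control $v:\mathbb{R}_+\to\{0,1\}$ is piecewise constant (finitely many switches on bounded intervals). A control makes the system explode if for some initial condition the trajectory $(x_t)_{t\ge0}$ is unbounded. The Lyapunov exponent $\chi$ is that of the centered system: $\chi=\lim_{t\to+\infty}\frac1t\log\|Z_t\|$ almost surely, where $\dot Z_t=A_{I_t}Z_t$,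 $Z_0\ne0$. $\mathbb{S}_{d-1}$ is the unit sphere of $\mathbb{R}^d$, $B_c(\Gamma_0)$ is the ball of radius $c$ centered at $\Gamma_0$ in $\mathcal{M}_d(\mathbb{R})\cong\mathbb{R}^{d^2}$, $\lambda$ is the Lebesgue measure on $\mathbb{R}^{d^2}$, and the inequality in (c) is an inequality between measures on $\mathcal{M}_d(\mathbb{R})$. *)

(* Defs.v *)
From HB Require Import structures.
From mathcomp Require Export all_boot all_order all_algebra.
From mathcomp Require Export all_classical all_reals all_analysis.
From mathcomp Require Import complex.

Set Implicit Arguments.
Unset Strict Implicit.
Unset Printing Implicit Defensive.

Import Order.TTheory GRing.Theory Num.Theory.
Import numFieldNormedType.Exports.

Local Open Scope classical_set_scope.
Local Open Scope ring_scope.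

(* States of the switching process: [false] is 0 and [true] is 1, so a function
   on [bool] is a pair such as (A_0, A_1) and [odd n] is the state after n jumps
   from state 0. *)

Section LinearAlgebra.
Context {R : realType}.

(* Euclidean norm on R^(m * n); the library norm `|_| on matrices is the sup
   norm, which defines the same topology but not the same unit sphere. *)
Definition enorm m n (M : 'M[R]_(m, n)) : R :=
  Num.sqrt (\sum_i \sum_j M i j ^+ 2).

Definition sphere {d} : set 'cV[R]_d := [set x | enorm x = 1].

Definition expmx d (M : 'M[R]_d) : 'M[R]_d :=
  limn (series (fun n => (n`!%:R)^-1 *: M ^+ n)).

(* All complex eigenvalues have negative real part. *)
Definition hurwitz d (M : 'M[R]_d) : Prop :=
  forall z : complex R,
    eigenvalue (map_mx (real_complex R) M) z -> complex.Re z < 0.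

(* M n *m ... *m M 1 *m M 0 *)
Fixpoint lprod d (M : nat -> 'M[R]_d) (n : nat) : 'M[R]_d :=
  if n is n'.+1 then M n *m lprod M n' else M 0%N.

(* e^(t_k A_(i_k)) ... e^(t_1 A_1) e^(t_0 A_0), with i_j the parity of j *)
Definition switchprod d (A : bool -> 'M[R]_d) (k : nat) (t : nat -> R) :=
  lprod (fun j => expmx (t j *: A (odd j))) k.

End LinearAlgebra.

Section SwitchedSystem.
Context {R : realType} {d : nat}.
Implicit Types (A : bool -> 'M[R]_d) (b : bool -> 'cV[R]_d) (v : R -> bool).

(* Only the values of v and x on [0, +oo[ matter.  The differential equation is
   imposed at every time t > 0 around which v is constant, i.e. away from the
   switching times, where the trajectory is merely continuous. *)
Definition trajectory A b v (x0 : 'cV[R]_d) (x : R -> 'cV[R]_d) : Prop :=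
  [/\ x 0 = x0,
      {within `[0, +oo[, continuous x} &
      forall t : R, 0 < t -> (\forall s \near t, v s = v t) ->
        is_derive t 1 x (A (v t) *m (x t - b (v t)))].

(* On each [0, S], v can only change at the points of some finite list. *)
Definition control v : Prop :=
  forall S : R, exists s : seq R, forall t u : R,
    0 <= t -> t <= u -> u <= S ->
    (forall r, r \in s -> ~~ (t <= r <= u)) -> v t = v u.

Definition explodes A b v : Prop :=
  exists x0 x, trajectory A b v x0 x /\ ~ bounded_set (x @` `[0, +oo[).

End SwitchedSystem.

Section Laws.
Context {R : realType}.

(* R^(m * n) with its Borel sigma-algebra *)
Definition borelM (R : realType) m n :=
  g_sigma_algebraType (@open 'M[R]_(m, n)).

Definition independent (dO : measure_display) (Omega : measurableType dO)
    (P : probability Omega R) (dE : measure_display) (E : measurableType dE)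
    (I : eqType) (X : I -> Omega -> E) : Prop :=
  forall (s : seq I) (U : I -> set E), uniq s ->
    (forall i, measurable (U i)) ->
    P (\bigcap_(i in [set` s]) (X i @^-1` U i)) =
    (\prod_(i <- s) P (X i @^-1` U i))%E.

Definition has_law (dO : measure_display) (Omega : measurableType dO)
    (P : probability Omega R) (dE : measure_display) (E : measurableType dE)
    (X : Omega -> E) (m : set E -> \bar R) : Prop :=
  measurable_fun setT X /\
  forall U, measurable U -> P (X @^-1` U) = m U.

Definition msupport d (mu : probability (borelM R d 1) R) : set 'cV[R]_d :=
  [set x | forall U : set 'cV[R]_d, open U -> U x -> (0 < mu U)%E].

(* This determines the measure uniquely. *)
Definition is_lebesgue m n (L : {measure set (borelM R m n) -> \bar R}) : Prop :=
  forall a b : 'M[R]_(m, n), (forall i j, a i j <= b i j) ->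
    L [set M : 'M[R]_(m, n) | forall i j, a i j <= M i j <= b i j] =
    (\prod_i \prod_j (b i j - a i j))%:E.

End Laws.

Section RandomSwitching.
Context {R : realType} {d : nat}.
Context {dO : measure_display} {Omega : measurableType dO}.
Variable P : probability Omega R.
Implicit Types (A : bool -> 'M[R]_d) (b : bool -> 'cV[R]_d).
Implicit Types (lam : bool -> R) (T : nat -> Omega -> R) (I : R -> Omega -> bool).

Definition interjump T (n : nat) (w : Omega) : R := T n.+1 w - T n w.

(* I is the Markov chain on {0, 1} with rates lam and I_0 = 0, and T n is its
   n-th jump time (T 0 = 0). *)
Record switching lam T I : Prop := Switching {
  jump0 : forall w, T 0%N w = 0;
  jump_lt : forall n w, T n w < T n.+1 w;
  jump_cvg : forall w, T n w @[n --> \oo] --> +oo;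
  interjump_law : forall n,
    has_law P (interjump T n) (exponential_prob (lam (odd n)));
  interjump_indep : independent P (interjump T);
  state_jump : forall n w t, T n w <= t < T n.+1 w -> I t w = odd n }.

(* X x0 is the process started from x0. *)
Definition switched_process A b I (X : 'cV[R]_d -> R -> Omega -> 'cV[R]_d) :=
  forall x0 w, trajectory A b (fun t => I t w) x0 (fun t => X x0 t w).

Definition Ychain T (X : 'cV[R]_d -> R -> Omega -> 'cV[R]_d)
    (x0 : 'cV[R]_d) (n : nat) (w : Omega) : 'cV[R]_d :=
  X x0 (T n.*2 w) w.

(* mu K = mu, where K(x, U) = P(Y_1 \in U) for the chain started from Y_0 = x *)
Definition invariant (Y : 'cV[R]_d -> nat -> Omega -> 'cV[R]_d)
    (mu : probability (borelM R d 1) R) : Prop :=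
  forall U : set (borelM R d 1), measurable U ->
    (\int[mu]_x P (Y x 1%N @^-1` U) = mu U)%E.

Definition lyapunov_exponent A I (chi : R) : Prop :=
  forall z0 : 'cV[R]_d, z0 != 0 ->
    {ae P, forall w, forall z : R -> 'cV[R]_d,
      trajectory A (fun=> 0) (fun t => I t w) z0 z ->
      t^-1 * ln (enorm (z t)) @[t --> +oo] --> chi}.

Definition expanding_products A (k : nat) : Prop :=
  forall x : 'cV[R]_d, sphere x ->
    exists t : nat -> R, (forall j, (j <= k)%N -> 0 < t j) /\
      enorm x < enorm (switchprod A k t *m x).

(* tau 0, ..., tau k are independent exponential times; later terms of tau are
   irrelevant. *)
Definition exponential_times lam (k : nat) (tau : nat -> Omega -> R) : Prop :=
  independent P (fun j : 'I_k.+1 => tau j) /\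
  forall j, (j <= k)%N -> has_law P (tau j) (exponential_prob (lam (odd j))).

(* B is a sequence of i.i.d. copies of
   e^(tau_k A_(i_k)) ... e^(tau_1 A_1) e^(tau_0 A_0). *)
Definition iid_switchprod A (k : nat) (tau : nat -> Omega -> R)
    (B : nat -> Omega -> borelM R d d) : Prop :=
  independent P B /\
  forall n, has_law P (B n)
    (fun U => P ((fun w => switchprod A k (tau^~ w)) @^-1` U)).

Definition directions_charged (B : nat -> Omega -> 'M[R]_d) : Prop :=
  forall (x : 'cV[R]_d) (V : set 'cV[R]_d), sphere x ->
    open V -> V `&` sphere !=set0 ->
    (0 < ereal_sup (range (fun n : nat =>
      P [set w | let y := lprod (B^~ w) n *m x in
                 (V `&` sphere) ((enorm y)^-1 *: y)])))%E.

Definition density_component (B : nat -> Omega -> 'M[R]_d) : Prop :=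
  exists2 L : {measure set (borelM R d d) -> \bar R}, is_lebesgue L &
  exists (G0 : 'M[R]_d) (n0 : nat) (c g0 : R),
    [/\ G0 \in unitmx, 0 < c, 0 < g0 &
      forall U : set (borelM R d d), measurable U ->
        (g0%:E * L (U `&` [set M : 'M[R]_d | (enorm (M - G0) < c)%R])
         <= P ((fun w => lprod (B^~ w) n0) @^-1` U))%E].

End RandomSwitching.

(* Main.v *)
From HB Require Import structures.
Require Import Defs.
From mathcomp Require Import complex measurable_realfun.
From mathcomp Require Import ring lra zify.

(* One step of the chain is [x |-> f_e x], where the block [e] is the pair of two
   successive interjump times and [f_e] is affine with linear part [M_e].

   Running i.i.d. blocks backwards, [f_(e_1) o ... o f_(e_n)] converges almost
   surely, to a limit independent of the initial state, as soon as
   [E |M_(e_1) ... M_(e_n)|^p < 1] for some [n] and some [p] in ]0, 1]: by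
   submultiplicativity these moments are then summable.  The law of the limit is
   the unique invariant probability measure and has a finite [p]-th moment.

   If no control explodes, the words [f_(e_1) o ... o f_(e_n)] are bounded
   uniformly in [n] and in the durations (otherwise ever larger words could be
   concatenated into an exploding control), which gives the contraction with
   [p = 1] and a bounded support.  If [chi < 0], the products contract
   exponentially in probability, which gives the contraction with [p = 1 / n].

   The expanding products yield, by compactness of the sphere, an exponent [p]
   and a number of blocks over which [E |M x|^p >= 2 |x|^p] for every [x].  If an
   invariant [nu] had a finite [p]-th moment, then comparing the chains started
   at [x] and at [f_e x], both of law [nu], would give
   [2^j E |f_e x - x|^p <= K] for all [j], so that [f_e x = x] almost surely,
   which [b_0 != b_1] forbids.  Hence [p_1] is the supremum of the exponents with
   a finite moment. *)

Import Order.TTheory GRing.Theory Num.Theory.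
Import numFieldNormedType.Exports.
Local Open Scope classical_set_scope.
Local Open Scope ring_scope.

Set Implicit Arguments.
Unset Strict Implicit.
Unset Printing Implicit Defensive.

(** * Matrix norms and the matrix exponential *)

(** A word grows at its right end, where the new block acts first, so consecutive backward iterates
    differ by a long matrix product applied to a bounded vector: they form a convergent series,
    whereas the forward chain in general converges only in law. Trajectories, however, multiply the
    blocks in the opposite order. Since the blocks are i.i.d., reversing finitely many of them
    preserves the law, and this links the two orders. Everything is therefore transported to the law
    of the sequence of durations, where independence becomes a measure-preserving concatenation of
    sequences.

    The contraction uses exponents at most 1 because x^p is then subadditive, so that the p-th power
    of the whole series is dominated by the series of p-th powers. When chi < 0 the obstacle is that
    almost sure decay of a logarithm says nothing about expectations, which rare paths could
    dominate. On those paths only a deterministic bound of order C^n is available; the power 1 / n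
    turns it into a constant, which a vanishing probability beats. *)

Section Nrm1.
Context {R : realType}.

(** The working norm: submultiplicative without a constant for all shapes, and additive over
    columns. Bounding it by [enorm] or by the sup norm costs a dimension factor, which explains the
    powers of [d] below. *)
Definition nrm1 m n (M : 'M[R]_(m, n)) : R := \sum_i \sum_j `|M i j|.

Lemma nrm1_ge0 m n (M : 'M[R]_(m, n)) : 0 <= nrm1 M.
Proof. by apply: sumr_ge0 => i _; apply: sumr_ge0 => j _. Qed.

Lemma normr_le_nrm1 m n (M : 'M[R]_(m, n)) i j : `|M i j| <= nrm1 M.
Proof.
rewrite /nrm1 (bigD1 i)//= (bigD1 j)//= -addrA lerDl.
by rewrite addr_ge0 ?sumr_ge0// => k _; rewrite sumr_ge0.
Qed.

Lemma nrm1_0 m n : nrm1 (0 : 'M[R]_(m, n)) = 0.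
Proof. by rewrite /nrm1 big1// => i _; rewrite big1// => j _; rewrite mxE normr0. Qed.

Lemma nrm1_eq0 m n (M : 'M[R]_(m, n)) : nrm1 M = 0 -> M = 0.
Proof.
move=> M0; apply/matrixP => i j; rewrite mxE; apply/eqP.
by rewrite -normr_le0 -M0 normr_le_nrm1.
Qed.

Lemma nrm1N m n (M : 'M[R]_(m, n)) : nrm1 (- M) = nrm1 M.
Proof. by apply: eq_bigr => i _; apply: eq_bigr => j _; rewrite mxE normrN. Qed.

Lemma nrm1D m n (M N : 'M[R]_(m, n)) : nrm1 (M + N) <= nrm1 M + nrm1 N.
Proof.
rewrite /nrm1 -big_split; apply: ler_sum => i _; rewrite -big_split.
by apply: ler_sum => j _; rewrite mxE ler_normD.
Qed.

Lemma nrm1B m n (M N : 'M[R]_(m, n)) : nrm1 (M - N) <= nrm1 M + nrm1 N.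
Proof. by rewrite (le_trans (nrm1D _ _))// nrm1N. Qed.

Lemma nrm1M m n p (M : 'M[R]_(m, n)) (N : 'M[R]_(n, p)) :
  nrm1 (M *m N) <= nrm1 M * nrm1 N.
Proof.
have le1 i j : `|(M *m N) i j| <= \sum_k `|M i k| * `|N k j|.
  rewrite mxE (le_trans (ler_norm_sum _ _ _))//.
  by apply: ler_sum => k _; rewrite normrM.
rewrite {1}/nrm1 (le_trans (ler_sum _ (fun i _ => ler_sum _ (fun j _ => le1 i j))))//.
rewrite mulr_suml; apply: ler_sum => i _.
rewrite exchange_big/= mulr_suml; apply: ler_sum => k _.
rewrite -mulr_sumr ler_wpM2l// /nrm1 [leRHS](bigD1 k)//= lerDl.
by rewrite sumr_ge0 // => l _; rewrite sumr_ge0.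
Qed.

Lemma nrm1_le m n c (M : 'M[R]_(m, n)) :
  (forall i j, `|M i j| <= c) -> nrm1 M <= m%:R * n%:R * c.
Proof.
move=> Mc; rewrite /nrm1 (le_trans (ler_sum _ (fun i _ => ler_sum _ (fun j _ => Mc i j))))//.
by rewrite !sumr_const !card_ord -mulrA [in leRHS]mulr_natl mulr_natl.
Qed.

Lemma nrm1_le_norm m n (M : 'M[R]_(m, n)) : nrm1 M <= m%:R * n%:R * `|M|.
Proof.
by apply: nrm1_le => i j; rewrite [leRHS]/Num.norm/= mx_normrE (le_bigmax _ _ (i, j)).
Qed.

Lemma norm_le_nrm1 m n (M : 'M[R]_(m, n)) : `|M| <= nrm1 M.
Proof.
rewrite [leLHS]/Num.norm/= mx_normrE; apply/bigmax_leP.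
by split=> [|[i j] _]; [exact: nrm1_ge0|exact: normr_le_nrm1].
Qed.

Lemma nrm1_trig m n (M N : 'M[R]_(m, n)) : nrm1 M <= nrm1 N + nrm1 (M - N).
Proof. by rewrite -{1}(subrK N M) addrC nrm1D. Qed.

(** Hypotheses on trajectories concern vectors; this passes from the images of the basis vectors to
    the matrix itself. *)
Lemma nrm1_col m n (M : 'M[R]_(m, n)) :
  nrm1 M = \sum_j nrm1 (M *m delta_mx j (0 : 'I_1)).
Proof.
rewrite /nrm1 exchange_big; apply: eq_bigr => j _; apply: eq_bigr => i _.
by rewrite big_ord1 -colE mxE.
Qed.

Lemma enorm_ge0 m n (M : 'M[R]_(m, n)) : 0 <= enorm M.
Proof. exact: sqrtr_ge0. Qed.

Lemma enormZ m n a (M : 'M[R]_(m, n)) : enorm (a *: M) = `|a| * enorm M.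
Proof.
rewrite /enorm -sqrtr_sqr -sqrtrM ?sqr_ge0// mulr_sumr; congr Num.sqrt.
apply: eq_bigr => i _; rewrite mulr_sumr; apply: eq_bigr => j _.
by rewrite mxE exprMn.
Qed.

Lemma normr_le_enorm m n (M : 'M[R]_(m, n)) i j : `|M i j| <= enorm M.
Proof.
rewrite -sqrtr_sqr ler_wsqrtr// (bigD1 i)//= (bigD1 j)//= -addrA lerDl.
rewrite addr_ge0 ?sumr_ge0// => k _; first exact: sqr_ge0.
by rewrite sumr_ge0 // => l _; rewrite sqr_ge0.
Qed.

Lemma enorm_le_nrm1 m n (M : 'M[R]_(m, n)) : enorm M <= nrm1 M.
Proof.
rewrite -[leRHS]ger0_norm ?nrm1_ge0// -sqrtr_sqr ler_wsqrtr//.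
rewrite expr2 {2}/nrm1 mulr_sumr ler_sum// => i _; rewrite mulr_sumr ler_sum// => j _.
by rewrite -real_normK ?num_real// expr2 ler_wpM2r// normr_le_nrm1.
Qed.

Lemma nrm1_le_enorm m n (M : 'M[R]_(m, n)) : nrm1 M <= m%:R * n%:R * enorm M.
Proof. by apply: nrm1_le => i j; exact: normr_le_enorm. Qed.

Lemma enorm_eq0 m n (M : 'M[R]_(m, n)) : enorm M = 0 -> M = 0.
Proof.
move=> M0; apply: nrm1_eq0; apply/eqP; rewrite eq_le nrm1_ge0 andbT.
by rewrite (le_trans (nrm1_le_enorm _))// M0 mulr0.
Qed.

Lemma enorm_gt0 m n (M : 'M[R]_(m, n)) : M != 0 -> 0 < enorm M.
Proof.
by rewrite lt0r enorm_ge0 andbT; apply: contra => /eqP/enorm_eq0 ->.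
Qed.

End Nrm1.

Section MatrixCvg.
Context {R : realType}.

Lemma cvg_mxP (T : Type) (F : set_system T) (FF : Filter F) m n
    (f : T -> 'M[R]_(m, n)) (M : 'M[R]_(m, n)) :
  f @ F --> M <-> forall i j, f t i j @[t --> F] --> M i j.
Proof.
split=> [fM i j|fM].
  exact: (cvg_comp f (fun N : 'M[R]_(m, n) => N i j) fM (@coord_continuous _ _ _ i j M)).
move=> A [P MP PA]; rewrite nbhs_simpl/=.
have : \forall t \near F, forall ij : 'I_m * 'I_n, P ij.1 ij.2 (f t ij.1 ij.2).
  by apply: filter_forall => -[i j]; exact: fM.
by apply: filterS => t ft; apply: PA => i j; exact: (ft (i, j)).
Qed.

Lemma is_derive_cvgP (V W : normedModType R) (f : V -> W) x v df :
  is_derive x v f df <-> h^-1 *: (f (h *: v + x) - f x) @[h --> 0^'] --> df.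
Proof.
split=> [[dfx <-]|cdf]; first exact: dfx.
by split; [apply: cvgP cdf|apply: cvg_lim cdf].
Qed.

Lemma is_derive_mxP m n (f : R -> 'M[R]_(m, n)) (t : R) (df : 'M[R]_(m, n)) :
  is_derive t 1 f df <-> forall i j, is_derive t 1 (fun s => f s i j) (df i j).
Proof.
rewrite is_derive_cvgP cvg_mxP; split=> H i j.
  apply/is_derive_cvgP; have := H i j.
  by apply: cvg_trans; apply: near_eq_cvg; near=> h; rewrite !mxE.
have /is_derive_cvgP := H i j.
by apply: cvg_trans; apply: near_eq_cvg; near=> h; rewrite !mxE.
Unshelve. all: by end_near. Qed.

End MatrixCvg.

Section MatrixCalculus.
Context {R : realType}.

Lemma is_derive_eq_fun (V W : normedModType R) (f g : V -> W) x v df dg :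
  is_derive x v f df -> f = g -> df = dg -> is_derive x v g dg.
Proof. by move=> ? <- <-. Qed.

Lemma cvg_sumr (T I : Type) (F : set_system T) (FF : Filter F) (r : seq I)
    (f : I -> T -> R) (a : I -> R) :
  (forall i, f i t @[t --> F] --> a i) ->
  \sum_(i <- r) f i t @[t --> F] --> \sum_(i <- r) a i.
Proof. by move=> fa; apply: cvg_big => //; exact: add_continuous. Qed.

Lemma is_derive_mulmx m n p (M : R -> 'M[R]_(m, n)) (N : R -> 'M[R]_(n, p))
    (t : R) dM dN :
  is_derive t 1 M dM -> is_derive t 1 N dN ->
  is_derive t 1 (fun s => M s *m N s) (dM *m N t + M t *m dN).
Proof.
move=> /is_derive_mxP dM' /is_derive_mxP dN'; apply/is_derive_mxP => i j.
have dk k := is_deriveM (dM' i k) (dN' k j).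
apply: is_derive_eq_fun (is_derive_sum dk) _ _.
  by apply/funext => s; rewrite fct_sumE mxE.
rewrite !mxE -big_split/=; apply: eq_bigr => k _.
by rewrite addrC; congr (_ + _); rewrite mulrC.
Qed.

Lemma is_derive_mx_cst m n (M : 'M[R]_(m, n)) (t : R) :
  is_derive t 1 (fun=> M) 0.
Proof. exact: is_derive_cst. Qed.

Lemma is_derive_mxB m n (M N : R -> 'M[R]_(m, n)) (t : R) dM dN :
  is_derive t 1 M dM -> is_derive t 1 N dN ->
  is_derive t 1 (fun s => M s - N s) (dM - dN).
Proof. exact: is_deriveB. Qed.

Lemma is_derive_continuous (W : normedModType R) (f : R -> W) (t : R) df :
  is_derive t 1 f df -> {for t, continuous f}.
Proof. by move=> [df1 _]; apply: differentiable_continuous; exact/derivable1_diffP. Qed.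

Lemma is_derive_affine_comp m n (f : R -> 'M[R]_(m, n)) (a c t : R) df :
  is_derive (c * t + a) 1 f df -> is_derive t 1 (fun s => f (c * s + a)) (c *: df).
Proof.
move=> /is_derive_mxP H; apply/is_derive_mxP => i j; rewrite mxE.
have Hg : is_derive t 1 (fun s : R => c * s + a) c.
  apply: is_derive_eq_fun (is_deriveD (is_deriveZ c (is_derive_id t 1)) (is_derive_cst a t 1)) _ _.
    by apply/funext.
  by rewrite addr0 scaler1.
have := @is_derive1_comp _ (fun s => f s i j) (fun s : R => c * s + a) t _ _ (H i j) Hg.
by rewrite mulrC.
Qed.

End MatrixCalculus.

Section ExpMatrix.
Context {R : realType} {d : nat}.
Implicit Types (A : 'M[R]_d) (t : R).

(** Power series coefficients of an entry of [A ^+ k *m expmx (t *: A)]. Carrying the shift [k]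
    makes the family closed under termwise differentiation ([diffs_coef]). *)
Let coef A i j k n : R := (A ^+ (n + k)) i j / n`!%:R.

Lemma nrm1_exp A n i j : `|(A ^+ n) i j| <= nrm1 A ^+ n.
Proof.
elim: n i j => [|n IHn] i j; first by rewrite !expr0 mxE; case: eqP; rewrite ?normr1 ?normr0.
rewrite !exprS -mulmxE mxE (le_trans (ler_norm_sum _ _ _))//.
rewrite (@le_trans _ _ (\sum_k `|A i k| * nrm1 A ^+ n))//.
  by apply: ler_sum => k _; rewrite normrM ler_wpM2l.
rewrite -mulr_suml ler_wpM2r ?exprn_ge0 ?nrm1_ge0// [leRHS](bigD1 i)//= lerDl.
by rewrite sumr_ge0 // => l _; rewrite sumr_ge0.
Qed.

Let expmZ A t n : (t *: A) ^+ n = t ^+ n *: A ^+ n.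
Proof.
elim: n => [|n IHn]; first by rewrite !expr0 scale1r.
by rewrite !exprS IHn -!mulmxE -scalemxAl -scalemxAr scalerA.
Qed.

Let cvg_coef A i j k t : cvgn (pseries (coef A i j k) t).
Proof.
apply: normed_cvg; pose v n := nrm1 A ^+ k * exp_coeff (nrm1 A * `|t|) n.
apply: (@series_le_cvg _ _ v) => [n|n|n|].
- exact: normr_ge0.
- by rewrite mulr_ge0 ?exprn_ge0 ?nrm1_ge0//= divr_ge0// exprn_ge0// mulr_ge0// nrm1_ge0.
- rewrite /coef /v /exp_coeff/= !normrM normfV normrX (ger0_norm (ler0n _ _)).
  rewrite exprMn mulrAC [leRHS]mulrA ler_wpM2r ?invr_ge0// mulrA ler_wpM2r ?exprn_ge0//.
  by rewrite -exprD addnC nrm1_exp.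
by apply: is_cvg_seriesZ; exact: is_cvg_series_exp_coeff.
Qed.

Let diffs_coef A i j k : pseries_diffs (coef A i j k) = coef A i j k.+1.
Proof.
apply/funext => n; rewrite /pseries_diffs /coef factS natrM invfM addSnnS.
by rewrite mulrCA; congr (_ * _); rewrite mulrA mulfV ?pnatr_eq0// mul1r.
Qed.

Let cvg_expmx A t : expmx (t *: A) = \matrix_(i, j) limn (pseries (coef A i j 0) t).
Proof.
apply/cvg_lim => //; apply/cvg_mxP => i j; rewrite mxE.
have -> : (fun n => series (fun n => (n`!%:R)^-1 *: (t *: A) ^+ n) n i j) =
          pseries (coef A i j 0) t; last exact: cvg_coef.
apply/funext => n; rewrite /pseries /series/= summxE; apply: eq_bigr => k _.
by rewrite expmZ !mxE /coef addn0; ring.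
Qed.

Let lim_coef A i j k t : limn (pseries (coef A i j k) t) = (A ^+ k *m expmx (t *: A)) i j.
Proof.
apply: cvg_lim => //; rewrite cvg_expmx mxE.
have -> : pseries (coef A i j k) t =
    (fun n => \sum_l (A ^+ k) i l * pseries (coef A l j 0) t n).
  apply/funext => n; rewrite /pseries /series/=.
  under [RHS]eq_bigr do rewrite mulr_sumr.
  rewrite exchange_big/=; apply: eq_bigr => m _.
  rewrite /coef addnC exprD -mulmxE mxE !mulr_suml; apply: eq_bigr => l _.
  by rewrite addn0 !mulrA.
apply: cvg_sumr => l; rewrite mxE; apply: cvgMl_tmp; exact: cvg_coef.
Qed.

Lemma is_derive_expmx A t :
  is_derive t 1 (fun s => expmx (s *: A)) (A *m expmx (t *: A)).
Proof.
apply/is_derive_mxP => i j; rewrite -[in A *m _](expr1 A) -lim_coef -diffs_coef.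
have -> : (fun s => expmx (s *: A) i j) = (fun s => limn (pseries (coef A i j 0) s)).
  by apply/funext => s; rewrite cvg_expmx mxE.
(* Termwise differentiation asks for convergence of the series and of its first two formal
   derivatives at a point beyond the norm of [t]. *)
apply: (@pseries_snd_diffs _ _ (`|t| + 1)).
- exact: cvg_coef.
- by rewrite diffs_coef; exact: cvg_coef.
- by rewrite !diffs_coef; exact: cvg_coef.
- by rewrite (@ger0_norm _ (`|t| + 1)) ?addr_ge0// ltrDl.
Qed.

Lemma expmxC A t : A *m expmx (t *: A) = expmx (t *: A) *m A.
Proof.
apply/matrixP => i j; rewrite -[in A *m _](expr1 A) -lim_coef.
apply: cvg_lim => //; rewrite cvg_expmx mxE.
have -> : pseries (coef A i j 1) t =
    (fun n => \sum_l pseries (coef A i l 0) t n * A l j).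
  apply/funext => n; rewrite /pseries /series/=.
  under [RHS]eq_bigr do rewrite mulr_suml.
  rewrite exchange_big/=; apply: eq_bigr => m _.
  rewrite /coef exprD expr1 -mulmxE mxE !mulr_suml; apply: eq_bigr => l _.
  by rewrite addn0 -!mulrA; congr (_ * _); rewrite mulrC -mulrA.
apply: cvg_sumr => l; rewrite mxE; apply: cvgMr_tmp; exact: cvg_coef.
Qed.

Lemma expmx0 A : expmx (0 *: A) = 1%:M.
Proof.
rewrite cvg_expmx; apply/matrixP => i j; rewrite !mxE; apply: cvg_lim => //.
apply: (@cvg_near_cst _ _ _ _ _ _ _).
exists 1%N => // n /= n0; rewrite /pseries /series/=.
rewrite big_ltn//= /coef expr0 mulr1 addn0 fact0 divr1 mxE big_nat big1 ?addr0 // => k /andP[k0 _].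
by rewrite expr0n -[k == 0%N]negbK -lt0n k0 mulr0.
Qed.

Lemma is_derive_expmxN A (a t : R) :
  is_derive t 1 (fun s => expmx ((a - s) *: A)) (- (A *m expmx ((a - t) *: A))).
Proof.
have := @is_derive_affine_comp R d d (fun s => expmx (s *: A)) a (-1) t _ (is_derive_expmx A _).
by rewrite scaleN1r; congr is_derive; rewrite ?mulN1r ?(addrC (-_)) //; apply/funext => s; rewrite mulN1r addrC.
Qed.

Lemma is_derive0_eq m n (f : R -> 'M[R]_(m, n)) a b :
  (forall t : R, is_derive t 1 f 0) -> f a = f b.
Proof.
move=> f0; apply/matrixP => i j; apply: (@is_derive_0_is_cst _ (fun s => f s i j)) => t.
by have /is_derive_mxP/(_ i j) := f0 t; rewrite mxE.
Qed.

(** The product is constant in [s]: its derivative vanishes because [A] commutes with its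
    exponential. Invertibility of all words of blocks rests on this. *)
Lemma expmxNV A t : expmx (- t *: A) *m expmx (t *: A) = 1%:M.
Proof.
pose f s := expmx ((0 - s) *: A) *m expmx (s *: A).
have <- : f 0 = 1%:M by rewrite /f subr0 expmx0 mulmx1.
rewrite -[- t]sub0r; apply: (@is_derive0_eq _ _ f) => s.
have := is_derive_mulmx (is_derive_expmxN A 0 s) (is_derive_expmx A s).
by rewrite mulNmx expmxC mulmxA addNr.
Qed.

Lemma expmxVN A t : expmx (t *: A) *m expmx (- t *: A) = 1%:M.
Proof. by rewrite -{1}[t]opprK expmxNV. Qed.

Lemma expmx_unit A t : expmx (t *: A) \in unitmx.
Proof. by have /mulmx1_unit[] := expmxVN A t. Qed.

Lemma continuous_expmx A i j : continuous (fun s : R => expmx (s *: A) i j).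
Proof.
move=> t; have /is_derive_mxP/(_ i j) := is_derive_expmx A t.
by apply: (is_derive_continuous).
Qed.

End ExpMatrix.

(** * Exponential decay for Hurwitz matrices *)

Section Decay.
Context {R : realType}.

Lemma is_derive_sumr n (f : 'I_n -> R -> R) (df : 'I_n -> R) (t : R) :
  (forall i, is_derive t 1 (f i) (df i)) ->
  is_derive t 1 (fun s => \sum_i f i s) (\sum_i df i).
Proof.
move=> fd; apply: is_derive_eq_fun (is_derive_sum fd) _ _ => //.
by apply/funext => s; rewrite fct_sumE.
Qed.

Lemma le0_derive_noninc (f df : R -> R) :
  (forall t : R, is_derive t 1 f (df t)) -> (forall t, 0 <= t -> df t <= 0) ->
  forall t, 0 <= t -> f t <= f 0.
Proof.
move=> fd df0 t; rewrite le_eqVlt => /predU1P[<-//|t0].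
have [|c] := @MVT R f df 0 t t0 (fun x _ => fd x).
  by apply: continuous_subspaceT => x; exact: is_derive_continuous (fd x).
rewrite in_itv/= subr0 -subr_le0 => /andP[c0 _] ->.
by rewrite mulr_le0_ge0 ?(ltW t0)// df0// ltW.
Qed.

(* The substitution [h t = exp (c t) g t - K / (c - e) exp ((c - e) t)] turns the
   hypothesis into [h' <= 0]. *)
Lemma exp_decay (g dg : R -> R) (c K e : R) : 0 < c -> 0 < e -> 0 <= K ->
  (forall t : R, is_derive t 1 g (dg t)) ->
  (forall t, 0 <= t -> dg t <= - c * g t + K * expR (- e * t)) ->
  exists K' e', [/\ 0 <= K', 0 < e' & forall t, 0 <= t -> g t <= K' * expR (- e' * t)].
Proof.
(* The cap [c / 2] keeps [c - e'] positive, also in the resonant case [e = c], where the sharp bound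
   would carry a factor [t]. *)
move=> c0 e0 K0 gd gle; pose e' := Num.min e (c / 2).
have e'0 : 0 < e' by rewrite lt_min e0/= divr_gt0.
have ce' : 0 < c - e'.
  have : e' <= c / 2 by rewrite ge_min lexx orbT.
  lra.
pose k := K / (c - e'); have k0 : 0 <= k by rewrite divr_ge0// ltW.
exists (`|g 0| + k), e'; split=> // [|t t0]; first by rewrite addr_ge0.
pose E (a : R) (s : R) := expR (a * s).
have Ed a (s : R) : is_derive s 1 (E a) (a * E a s).
  have := is_derive1_comp (is_derive_expR (a * s)) (is_deriveZ a (is_derive_id s (1 : R))).
  by rewrite scaler1 mulrC.
pose h s := E c s * g s - k * E (c - e') s.
pose dh s := E c s * dg s + g s * (c * E c s) - k * ((c - e') * E (c - e') s).
have hd (s : R) : is_derive s 1 h (dh s).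
  exact: is_deriveB (is_deriveM (Ed c s) (gd s)) (is_deriveZ k (Ed (c - e') s)).
have := @le0_derive_noninc h dh hd.
have dh0 s : 0 <= s -> dh s <= 0.
  move=> s0; have kK : k * (c - e') = K by rewrite /k divfK ?gt_eqF.
  rewrite /dh; have -> : E c s * dg s + g s * (c * E c s) - k * ((c - e') * E (c - e') s)
      = E c s * (dg s + c * g s - K * expR (- (e' * s))).
    have -> : E (c - e') s = E c s * expR (- (e' * s)) by rewrite /E mulrBl expRD.
    by rewrite -kK; ring.
  rewrite pmulr_rle0 ?expR_gt0//.
  have := gle s s0; have : K * expR (- e * s) <= K * expR (- (e' * s)).
    by rewrite ler_wpM2l// ler_expR mulNr lerN2 ler_wpM2r// ge_min lexx.
  lra.
move=> /(_ dh0 t t0); rewrite /h /E !mulr0 expR0 !mul1r mulr1.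
rewrite mulrBl expRD => hle.
have E0 : 0 < expR (c * t) by exact: expR_gt0.
have : expR (c * t) * g t <= (`|g 0| + k * expR (c * t) * expR (- (e' * t))).
  have := ler_norm (g 0); lra.
rewrite -ler_pdivlMl// => /le_trans; apply.
rewrite mulNr [leRHS]mulrDl mulrDr; apply: lerD; last first.
  by rewrite [k * _ * _]mulrAC [_ * expR (c * t)]mulrC mulrA mulVf ?mul1r ?gt_eqF.
rewrite mulrC ler_wpM2l// -expRN ler_expR lerN2 ler_wpM2r//.
lra.
Qed.

End Decay.

Section Hurwitz.
Context {R : realType} {d : nat}.
Variable A : 'M[R]_d.

Let E (t : R) := expmx (t *: A).
(** The squared Euclidean norm of [(P + i N) e^(tA)]; keeping real and imaginary parts apart lets
    all the calculus take place over [R]. *)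
Let q (P N : 'M[R]_d) (t : R) :=
  \sum_i \sum_j ((P *m E t) i j ^+ 2 + (N *m E t) i j ^+ 2).

Definition exp_bounded (P N : 'M[R]_d) := exists K e : R,
  [/\ 0 <= K, 0 < e & forall t, 0 <= t -> q P N t <= K * expR (- e * t)].

(* If [M = P + i N] and [z = x + i y], then [M (A - z)] has real and imaginary
   parts [P'] and [N'], and [|M e^(tA)|^2] satisfies
   [q' <= x q + |M (A - z) e^(tA)|^2 / |x|]. *)
Lemma exp_bounded_step (P N P' N' : 'M[R]_d) (x y : R) : x < 0 ->
  P *m A = P' + x *: P - y *: N -> N *m A = N' + x *: N + y *: P ->
  exp_bounded P' N' -> exp_bounded P N.
Proof.
move=> x0 PA NA [K [e [K0 e0 qK]]].
pose u (M : 'M[R]_d) i j t := (M *m E t) i j.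
have ud M i j (t : R) : is_derive t 1 (u M i j) (u (M *m A) i j t).
  have := is_derive_mulmx (is_derive_mx_cst M t) (is_derive_expmx A t).
  by rewrite mul0mx add0r => /is_derive_mxP/(_ i j); rewrite mulmxA.
pose dq t := \sum_i \sum_j (2 * (u P i j t * u (P *m A) i j t)
                          + 2 * (u N i j t * u (N *m A) i j t)).
have qd (t : R) : is_derive t 1 (q P N) (dq t).
  apply: is_derive_sumr => i; apply: is_derive_sumr => j.
  apply: is_derive_eq_fun (is_deriveD (is_deriveM (ud P i j t) (ud P i j t))
    (is_deriveM (ud N i j t) (ud N i j t))) _ _.
    by apply/funext => s; rewrite /u !expr2.
  by rewrite !mulr_natl !mulr2n.
have x'0 : 0 < - x by rewrite oppr_gt0.
apply: (@exp_decay R _ dq (- x) (K / - x) e) => //.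
  by rewrite divr_ge0// ltW.
move=> t t0; apply: (@le_trans _ _ (x * q P N t + q P' N' t / - x)); last first.
  by rewrite opprK lerD2l mulrAC ler_wpM2r ?invr_ge0 ?(ltW x'0)// qK.
rewrite /dq /q mulr_sumr mulr_suml -big_split/=; apply: ler_sum => i _.
rewrite mulr_sumr mulr_suml -big_split/=; apply: ler_sum => j _.
rewrite -/(u P i j t) -/(u N i j t) -/(u P' i j t) -/(u N' i j t).
have -> : u (P *m A) i j t = u P' i j t + x * u P i j t - y * u N i j t.
  by rewrite /u PA !mulmxDl mulNmx -!scalemxAl !mxE.
have -> : u (N *m A) i j t = u N' i j t + x * u N i j t + y * u P i j t.
  by rewrite /u NA !mulmxDl -!scalemxAl !mxE.
(* Young's inequality with weight [- x]: it spends half of the dissipation [2 x q], while the terms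
   in [y] cancel between the real and the imaginary part. *)
have sq (a b : R) : 2 * (a * b) <= - x * a ^+ 2 + b ^+ 2 / - x.
  have : 0 <= (- x * a - b) ^+ 2 / - x by rewrite divr_ge0 ?sqr_ge0// ltW.
  have -> : (- x * a - b) ^+ 2 / - x = - x * a ^+ 2 + b ^+ 2 / - x - 2 * (a * b).
    by field; rewrite lt_eqF.
  by rewrite subr_ge0.
have := sq (u P i j t) (u P' i j t); have := sq (u N i j t) (u N' i j t).
rewrite mulrDl; lra.
Qed.

End Hurwitz.

Section HurwitzDecay.
Context {R : realType}.

Let ReM m n (M : 'M[complex R]_(m, n)) : 'M[R]_(m, n) := map_mx (@complex.Re R) M.
Let ImM m n (M : 'M[complex R]_(m, n)) : 'M[R]_(m, n) := map_mx (@complex.Im R) M.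

Let Re_sum (I : Type) (s : seq I) (f : I -> complex R) :
  complex.Re (\sum_(i <- s) f i) = \sum_(i <- s) complex.Re (f i).
Proof. by apply: (big_morph _ _ (erefl (complex.Re 0))) => -[? ?] [? ?]. Qed.

Let Im_sum (I : Type) (s : seq I) (f : I -> complex R) :
  complex.Im (\sum_(i <- s) f i) = \sum_(i <- s) complex.Im (f i).
Proof. by apply: (big_morph _ _ (erefl (complex.Im 0))) => -[? ?] [? ?]. Qed.

Let Re_subM (u v w : complex R) : complex.Re (u - v * w) =
  complex.Re u - (complex.Re v * complex.Re w - complex.Im v * complex.Im w).
Proof. by case: u v w => [? ?] [? ?] [? ?]. Qed.

Let Im_subM (u v w : complex R) : complex.Im (u - v * w) =
  complex.Im u - (complex.Re v * complex.Im w + complex.Im v * complex.Re w).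
Proof. by case: u v w => [? ?] [? ?] [? ?]. Qed.

(** By Cayley-Hamilton the product of all factors [A - z] is zero and so decays trivially;
    [exp_bounded_step] then strips one factor at a time until the identity remains. This replaces
    the Jordan form. *)
Lemma hurwitz_exp_bounded d (A : 'M[R]_d) : hurwitz A -> exp_bounded A 1%:M 0.
Proof.
case: d A => [A _|d A hA].
  exists 0, 1; split=> // t _.
  by rewrite big_ord0 mul0r.
pose AC := map_mx (real_complex R) A.
have [rs rsE] := closed_field_poly_normal (char_poly AC).
rewrite (monicP (char_poly_monic AC)) scale1r in rsE.
have rs0 z : z \in rs -> complex.Re z < 0.
  move=> zrs; apply: hA; rewrite eigenvalue_root_char -/AC rsE root_prod_XsubC.
  exact: zrs.
have prod0 : \prod_(z <- rs) (AC - z%:M) = 0.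
  rewrite -(Cayley_Hamilton AC) rsE rmorph_prod; apply: eq_bigr => z _.
  by rewrite rmorphB/= horner_mx_X horner_mx_C.
suff : forall s M, (forall z, z \in s -> complex.Re z < 0) ->
    exp_bounded A (ReM (M *m \prod_(z <- s) (AC - z%:M)))
                  (ImM (M *m \prod_(z <- s) (AC - z%:M))) ->
    exp_bounded A (ReM M) (ImM M).
  move=> /(_ rs 1%:M rs0).
  have -> : ReM (1%:M : 'M[complex R]_d.+1) = 1%:M by apply/matrixP => i j; rewrite !mxE; case: eqP.
  have -> : ImM (1%:M : 'M[complex R]_d.+1) = 0 by apply/matrixP => i j; rewrite !mxE; case: eqP.
  apply; rewrite prod0 mulmx0.
  have -> : ReM (0 : 'M[complex R]_d.+1) = 0 by apply/matrixP => i j; rewrite !mxE.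
  have -> : ImM (0 : 'M[complex R]_d.+1) = 0 by apply/matrixP => i j; rewrite !mxE.
  exists 0, 1; split=> // t _; rewrite mul0r big1// => i _; rewrite big1// => j _.
  by rewrite mul0mx mxE expr0n addr0.
elim=> [|z s IHs] M sneg; first by rewrite big_nil mulmx1.
rewrite big_cons -mulmxE mulmxA => /IHs H.
have {}H := H (fun w ws => sneg w (mem_behead (s := z :: s) ws)).
apply: (exp_bounded_step (y := complex.Im z)) H; first exact: (sneg z (mem_head _ _)).
  apply/matrixP => i j; rewrite !mxE Re_sum.
  have -> : \sum_k (ReM M) i k * A k j = \sum_k complex.Re (M i k * AC k j).
    apply: eq_bigr => k _; rewrite !mxE; case: (M i k) => a b /=.
    by rewrite mulr0 subr0.
  rewrite -!Re_sum.
  have -> : \sum_k M i k * (AC - z%:M) k j = \sum_k M i k * AC k j - M i j * z.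
    have -> : M i j * z = (M *m z%:M) i j by rewrite mul_mx_scalar mxE mulrC.
    by rewrite mxE -sumrB; apply: eq_bigr => k _; rewrite !mxE mulrBr.
  by rewrite Re_subM; ring.
apply/matrixP => i j; rewrite !mxE Im_sum.
have -> : \sum_k (ImM M) i k * A k j = \sum_k complex.Im (M i k * AC k j).
  apply: eq_bigr => k _; rewrite !mxE; case: (M i k) => a b /=.
  by rewrite mulr0 add0r.
rewrite -!Im_sum.
have -> : \sum_k M i k * (AC - z%:M) k j = \sum_k M i k * AC k j - M i j * z.
  have -> : M i j * z = (M *m z%:M) i j by rewrite mul_mx_scalar mxE mulrC.
  by rewrite mxE -sumrB; apply: eq_bigr => k _; rewrite !mxE mulrBr.
by rewrite Im_subM; ring.
Qed.

Lemma hurwitz_decay d (A : 'M[R]_d) : hurwitz A ->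
  exists K e : R, [/\ 0 <= K, 0 < e &
    forall t, 0 <= t -> nrm1 (expmx (t *: A)) <= K * expR (- e * t)].
Proof.
move=> /hurwitz_exp_bounded[K [e [K0 e0 qK]]].
exists (d%:R * d%:R * Num.sqrt K), (e / 2).
split; rewrite ?divr_gt0// ?mulr_ge0 ?sqrtr_ge0// => t t0.
rewrite -[leRHS]mulrA; apply: nrm1_le => i j.
have -> : expR (- (e / 2) * t) = Num.sqrt (expR (- e * t)).
  have -> : - e * t = 2%:R * (- (e / 2) * t) by field.
  by rewrite expRM_natl sqrtr_sqr ger0_norm// expR_ge0.
rewrite -sqrtrM// -sqrtr_sqr ler_wsqrtr// (le_trans _ (qK t t0))//.
rewrite (bigD1 i)//= (bigD1 j)//= mul1mx -!addrA lerDl !addr_ge0 ?sqr_ge0 ?sumr_ge0// => k _.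
  by rewrite addr_ge0 ?sqr_ge0.
by apply: sumr_ge0 => l _; rewrite addr_ge0 ?sqr_ge0.
Qed.

End HurwitzDecay.

(** * Switched trajectories and words of blocks *)

Section Flow.
Context {R : realType} {d : nat}.
Variables (A : bool -> 'M[R]_d) (b : bool -> 'cV[R]_d).

Definition flow (i : bool) (t : R) (x : 'cV[R]_d) : 'cV[R]_d :=
  expmx (t *: A i) *m (x - b i) + b i.

Lemma flow0 i x : flow i 0 x = x.
Proof. by rewrite /flow expmx0 mul1mx subrK. Qed.

Lemma flowB i t x y : flow i t x - flow i t y = expmx (t *: A i) *m (x - y).
Proof.
rewrite /flow opprD addrACA subrr addr0 -mulmxBr; congr (_ *m _).
by rewrite opprB addrA subrK.
Qed.

Lemma is_derive_flow i (a : R) x (t : R) :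
  is_derive t 1 (fun s => flow i (s - a) x) (A i *m (flow i (t - a) x - b i)).
Proof.
have He : is_derive t 1 (fun s : R => expmx ((s - a) *: A i)) (A i *m expmx ((t - a) *: A i)).
  have := @is_derive_affine_comp R d d (fun s => expmx (s *: A i)) (- a) 1 t _ (is_derive_expmx (A i) _).
  by rewrite scale1r mul1r; under eq_fun do rewrite mul1r.
have := is_deriveD (is_derive_mulmx He (is_derive_mx_cst (x - b i) t)) (is_derive_mx_cst (b i) t).
by rewrite mulmx0 !addr0 /flow addrK mulmxA.
Qed.

(** Uniqueness without Gronwall: the state pulled back by [expmx ((a - s) *: A i)] has zero
    derivative inside the interval, and continuity extends its constancy to the end points, where no
    equation is imposed. *)
Lemma trajectory_flow (v : R -> bool) x0 x i a c : trajectory A b v x0 x ->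
  0 <= a -> a < c -> (forall s, a <= s < c -> v s = i) -> x c = flow i (c - a) (x a).
Proof.
move=> [_ xc xd] a0 ac vi.
pose f (s : R) := expmx ((a - s) *: A i) *m (x s - b i).
have fd (s : R) : s \in `]a, c[ -> is_derive s 1 f 0.
  rewrite in_itv/= => /andP[as_ sc].
  have vs : v s = i by apply: vi; rewrite ltW.
  have := xd s (le_lt_trans a0 as_).
  rewrite vs => xd'.
  have {xd'} : is_derive s 1 x (A i *m (x s - b i)).
    apply: xd'; near=> r; apply: vi.
    apply/andP; split; last by near: r; exact: lt_nbhsl.
    by apply: ltW; near: r; exact: lt_nbhsr.
  move=> xd'.
  have := is_derive_mulmx (is_derive_expmxN (A i) a s)
    (is_derive_mxB xd' (is_derive_mx_cst (b i) s)).
  by rewrite subr0 mulNmx expmxC mulmxA addNr.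
have fac : f c = f a.
  apply/matrixP => k l; have [| |s _] := @MVT R (fun s => f s k l) (fun=> 0) a c ac; last first.
  - by rewrite mul0r => /eqP; rewrite subr_eq0 => /eqP.
  - move=> s; have xs : {within `[a, c], continuous x}.
      apply: continuous_subspaceW xc => r /=; rewrite !in_itv/= andbT => /andP[ar _].
      exact: le_trans ar.
    have /cvg_mxP xs' := xs s.
    pose g j (r : R) := expmx ((a - r) *: A i) k j * (x r j l - b i j l).
    have -> : (fun r => f r k l) = (fun r => \sum_j g j r).
      by apply/funext => r; rewrite /f mxE; apply: eq_bigr => j _; rewrite !mxE.
    apply: (@cvg_sumr R _ _ (nbhs s) _ _ g) => j; apply: (@cvgM R _ (nbhs s)).
      have H : continuous (fun r : R => expmx ((a - r) *: A i) k j).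
        move=> r; have /is_derive_mxP/(_ k j) := is_derive_expmxN (A i) a r.
        by apply: is_derive_continuous.
      by have := @continuous_subspaceT _ _ `[a, c] _ H => /(_ s).
    by apply: (@cvgB R _ _ (nbhs s)); [exact: xs'|exact: cvg_cst].
  - by move=> s sac; have /is_derive_mxP/(_ k l) := fd s sac; rewrite mxE.
rewrite /flow; move: fac; rewrite /f subrr expmx0 mul1mx => <-.
by rewrite -(opprB c a) mulmxA expmxVN mul1mx subrK.
Unshelve. all: by end_near. Qed.

End Flow.

(** * Controls with prescribed switching times *)

Section JumpTimes.
Context {R : realType} {d : nat}.
Variables (A : bool -> 'M[R]_d) (b : bool -> 'cV[R]_d).
Variable T : nat -> R.
Hypotheses (T0 : T 0%N = 0) (T_lt : forall n, T n < T n.+1)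
  (T_unbounded : forall c, exists n, c < T n).

Let T_le m n : (m <= n)%N -> T m <= T n.
Proof.
have /nondecreasing_seqP Tnd k : T k <= T k.+1 by exact/ltW.
exact: Tnd.
Qed.

Lemma jump_index_subproof t : exists n, t < T n.+1.
Proof. by have [n tn] := T_unbounded t; exists n; exact: lt_trans (T_lt n). Qed.

Definition jump_index t := ex_minn (jump_index_subproof t).

Lemma jump_index_lt t : t < T (jump_index t).+1.
Proof. by rewrite /jump_index; case: ex_minnP. Qed.

Lemma jump_index_le t n : t < T n.+1 -> (jump_index t <= n)%N.
Proof. by rewrite /jump_index; case: ex_minnP => m _; exact. Qed.

Lemma jump_index_ge t n : T n <= t -> (n <= jump_index t)%N.
Proof.
move=> nt; rewrite leqNgt; apply/negP => /T_le jn.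
by have := lt_le_trans (jump_index_lt t) (le_trans jn nt); rewrite ltxx.
Qed.

Lemma jump_index_eq t n : T n <= t < T n.+1 -> jump_index t = n.
Proof.
by move=> /andP[nt tn]; apply/eqP; rewrite eqn_leq jump_index_le// jump_index_ge.
Qed.

Lemma le_jump_index t : 0 <= t -> T (jump_index t) <= t.
Proof.
move=> t0; case E : (jump_index t) => [|n]; first by rewrite T0.
by rewrite leNgt; apply/negP => /jump_index_le; rewrite E ltnn.
Qed.

Definition alternating t := odd (jump_index t).

Lemma alternating_control : control alternating.
Proof.
move=> S; have [m Sm] := T_unbounded S.
exists [seq T k | k <- iota 0 m] => t u t0 tu uS Tin.
congr odd; apply/esym/jump_index_eq; rewrite (le_trans (le_jump_index t0))//=.
rewrite ltNge; apply/negP => Tu.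
set n := (jump_index t).+1 in Tu.
have nm : (n < m)%N.
  rewrite ltnNge; apply/negP => /T_le mn.
  by have := lt_le_trans Sm (le_trans mn (le_trans Tu uS)); rewrite ltxx.
have /Tin : T n \in [seq T k | k <- iota 0 m] by apply: map_f; rewrite mem_iota.
by rewrite Tu (ltW (jump_index_lt t)).
Qed.

Fixpoint jump_state (x0 : 'cV[R]_d) n :=
  if n is n'.+1 then flow A b (odd n') (T n'.+1 - T n') (jump_state x0 n') else x0.

Definition alternating_path x0 t :=
  flow A b (alternating t) (t - T (jump_index t)) (jump_state x0 (jump_index t)).

Let phi x0 n t := flow A b (odd n) (t - T n) (jump_state x0 n).

Let phi_cvg x0 n t : phi x0 n s @[s --> t] --> phi x0 n t.
Proof. exact: is_derive_continuous (is_derive_flow _ _ _ _ _ _). Qed.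

(* At a switching time the state changes, so the differential equation is not
   imposed there, but the two branches have the same limit. *)
Lemma alternating_trajectory x0 : trajectory A b alternating x0 (alternating_path x0).
Proof.
have inside t : jump_index t = 0%N \/ T (jump_index t) < t ->
    \forall s \near t, jump_index s = jump_index t.
  move=> ht; have hlt : \forall s \near t, s < T (jump_index t).+1.
    by apply: lt_nbhsl; exact: jump_index_lt.
  case: ht => ht.
    by near=> s; apply/eqP; rewrite ht -leqn0 jump_index_le// -ht; near: s.
  near=> s; apply: jump_index_eq; apply/andP; split; last by near: s.
  by apply: ltW; near: s; exact: lt_nbhsr.
have cases t : (jump_index t = 0%N \/ T (jump_index t) < t) \/
    exists n, t = T n.+1 /\ jump_index t = n.+1.
  have [t0|t0] := ltP t 0.
    left; left; apply/eqP; rewrite -leqn0 jump_index_le//.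
    by rewrite (lt_trans t0)// -T0.
  have := le_jump_index t0; rewrite le_eqVlt => /predU1P[tE|]; last by left; right.
  by case E : (jump_index t) => [|n]; [left; left|right; exists n; rewrite -E].
have leftn n : \forall s \near (T n.+1 : R), s < T n.+1 -> jump_index s = n.
  near=> s => sn; apply: jump_index_eq; rewrite sn andbT; apply: ltW.
  by near: s; apply: lt_nbhsr.
have rightn n : \forall s \near (T n.+1 : R), T n.+1 <= s -> jump_index s = n.+1.
  near=> s => sn; apply: jump_index_eq; rewrite sn /=.
  by near: s; apply: lt_nbhsl.
split.
- have -> : alternating_path x0 0 = phi x0 0 0.
    by rewrite /alternating_path /alternating (@jump_index_eq 0 0)// T0 lexx -T0 T_lt.
  by rewrite /phi T0 subrr flow0.
- apply: continuous_subspaceT => t; have [ht|[n [tE jE]]] := cases t.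
    have := @phi_cvg x0 (jump_index t) t; apply: cvg_trans; apply: near_eq_cvg.
    by move: (inside t ht); apply: filterS => s sE; rewrite /alternating_path /alternating sE.
  have jump : phi x0 n t = phi x0 n.+1 t.
    by rewrite /phi tE subrr flow0.
  have xE : alternating_path x0 t = phi x0 n.+1 t by rewrite /alternating_path /alternating jE.
  rewrite /continuous_at xE => U nU; rewrite nbhs_simpl/=.
  have := @phi_cvg x0 n t; rewrite jump => /(_ U nU) Un.
  have {}Ul : \forall s \near t, U (phi x0 n.+1 s) by exact: (phi_cvg nU).
  near=> s; suff : U (alternating_path x0 s) by [].
  have [st|ts] := ltP s t.
    have -> : alternating_path x0 s = phi x0 n s.
      suff sE : jump_index s = n by rewrite /alternating_path /alternating sE.
      by move: st; rewrite tE; near: s; rewrite tE; exact: leftn.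
    by near: s; exact: Un.
  have -> : alternating_path x0 s = phi x0 n.+1 s.
    suff sE : jump_index s = n.+1 by rewrite /alternating_path /alternating sE.
    by move: ts; rewrite tE; near: s; rewrite tE; exact: rightn.
  by near: s; exact: Ul.
- move=> t t0 vt; have [ht|[n [tE jE]]] := cases t; last first.
    have hl : \forall s \near t^'-, jump_index s = n by rewrite tE; exact: leftn.
    have hv : \forall s \near t^'-, alternating s = alternating t.
      by move: vt; rewrite /at_left /within; apply: filterS => s + _.
    have [s [jn]] := filter_ex (filterI hl hv).
    by rewrite /alternating jn jE /=; case: (odd n).
  have := is_derive_flow A b (odd (jump_index t)) (T (jump_index t)) (jump_state x0 (jump_index t)) t.
  apply: near_eq_is_derive => //.
  by move: (inside t ht); apply: filterS => s sE; rewrite /alternating_path /alternating sE.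
Unshelve. all: by end_near. Qed.

End JumpTimes.

Section Blocks.
Context {R : realType}.

(* Replacing non-positive durations by the junk value 1 makes every word of
   durations admissible, so that bounds hold everywhere and not only almost
   surely. *)
Definition dur (t : R) : R := if 0 < t then t else 1.

Lemma dur_gt0 t : 0 < dur t.
Proof. by rewrite /dur; case: ifP. Qed.

Lemma durE t : 0 < t -> dur t = t.
Proof. by rewrite /dur => ->. Qed.

Section Maps.
Context {d : nat}.
Variables (A : bool -> 'M[R]_d) (b : bool -> 'cV[R]_d).

(* The first pair of a word acts last. *)
Definition bstep (e : R * R) (x : 'cV[R]_d) : 'cV[R]_d :=
  flow A b true (dur e.2) (flow A b false (dur e.1) x).
Definition bmat (e : R * R) : 'M[R]_d :=
  expmx (dur e.2 *: A true) *m expmx (dur e.1 *: A false).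
Definition bmap (s : seq (R * R)) (x : 'cV[R]_d) : 'cV[R]_d := foldr bstep x s.
Definition bprod (s : seq (R * R)) : 'M[R]_d :=
  foldr (fun e M => bmat e *m M) 1%:M s.

Lemma bstepB e x y : bstep e x - bstep e y = bmat e *m (x - y).
Proof. by rewrite /bstep /bmat !flowB mulmxA. Qed.

Lemma bmap_cat s1 s2 x : bmap (s1 ++ s2) x = bmap s1 (bmap s2 x).
Proof. exact: foldr_cat. Qed.

Lemma bmapB s x y : bmap s x - bmap s y = bprod s *m (x - y).
Proof. by elim: s => [|e s IHs] /=; rewrite ?mul1mx// bstepB IHs mulmxA. Qed.

Lemma bmapE s x : bmap s x = bprod s *m x + bmap s 0.
Proof. by rewrite -[x in RHS]subr0 -bmapB subrK. Qed.

Lemma bprod_cat s1 s2 : bprod (s1 ++ s2) = bprod s1 *m bprod s2.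
Proof. by elim: s1 => [|e s IHs] /=; rewrite ?mul1mx// IHs mulmxA. Qed.

Lemma bprod_unit s : bprod s \in unitmx.
Proof.
by elim: s => [|e s IHs] /=; rewrite ?unitmx1// !unitmx_mul !expmx_unit.
Qed.

(** Time runs from the right end of a word to its left end, hence [rev]. *)
Lemma trajectory_bmap (T : nat -> R) v x0 x : T 0%N = 0 ->
  (forall n, T n < T n.+1) -> (forall n t, T n <= t < T n.+1 -> v t = odd n) ->
  trajectory A b v x0 x -> forall n, x (T n.*2) =
    bmap (rev (mkseq (fun j => (T j.*2.+1 - T j.*2, T j.*2.+2 - T j.*2.+1)) n)) x0.
Proof.
move=> T0 T_lt vT xT.
have T_ge0 n : 0 <= T n by elim: n => [|n]; rewrite ?T0// => /le_trans; apply; exact/ltW.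
elim=> [|n IHn]; first by rewrite T0; case: xT.
rewrite mkseqS rev_rcons /= -IHn doubleS /bstep /= !durE ?subr_gt0//.
rewrite (trajectory_flow xT (T_ge0 n.*2.+1) (T_lt _) (vT _)).
rewrite (trajectory_flow xT (T_ge0 n.*2) (T_lt _) (vT _)).
by rewrite /= odd_double.
Qed.

End Maps.
End Blocks.

Section Boundedness.
Context {R : realType} {d : nat}.
Variables (A : bool -> 'M[R]_d) (b : bool -> 'cV[R]_d).

Let size_word (s : seq (R * R)) := nrm1 (bmap A b s 0) + nrm1 (bprod A s).

(* Since the matrices are invertible, a word with large image can be found that
   starts with any prescribed word. *)
Let extend : (forall C, exists s, C < size_word s) ->
  forall s0 C, exists s, C < size_word (s ++ s0).
Proof.
move=> unb s0 C; apply: contrapT => /forallNP nex.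
have bnd s : size_word (s ++ s0) <= C by rewrite leNgt; apply/negP.
set N := nrm1 (invmx (bprod A s0)); set c := nrm1 (bmap A b s0 0).
have [s] := unb (C * N * c + C + C * N); apply/negP; rewrite -leNgt.
have C0 : 0 <= C by rewrite (le_trans _ (bnd [::])) ?addr_ge0 ?nrm1_ge0.
have Ms : nrm1 (bprod A s) <= C * N.
  rewrite -[bprod A s]mulmx1 -(mulmxV (bprod_unit A s0)) mulmxA -bprod_cat.
  rewrite (le_trans (nrm1M _ _))// ler_wpM2r ?nrm1_ge0//.
  by rewrite (le_trans _ (bnd s))// lerDr nrm1_ge0.
apply: lerD => //.
have -> : bmap A b s 0 = bmap A b (s ++ s0) 0 - bprod A s *m bmap A b s0 0.
  by rewrite bmap_cat [X in X - _]bmapE addrAC subrr add0r.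
rewrite (le_trans (nrm1B _ _))// addrC lerD//; last first.
  by rewrite (le_trans _ (bnd s))// lerDl nrm1_ge0.
by rewrite (le_trans (nrm1M _ _))// ler_wpM2r ?nrm1_ge0.
Qed.

Lemma no_explosion_bounded :
  (forall v, control v -> ~ explodes A b v) ->
  exists C, forall s, nrm1 (bmap A b s 0) + nrm1 (bprod A s) <= C.
Proof.
move=> noexp; apply: contrapT => /forallNP nbnd.
have unb C : exists s, C < size_word s.
  by have /existsNP[s /negP] := nbnd C; rewrite -ltNge => ?; exists s.
have /choice[G GP] : forall p : seq (R * R) * nat, exists s, p.2%:R < size_word (s ++ p.1).
  by move=> p; exact: extend.
(* The words grow on the left, that is forwards in time, so each prolongs the previous one. [G]
   makes them large, and the extra block [(1, 1)] sends the total duration to infinity, so that the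
   switches do not accumulate. *)
pose W := fix W n := if n is n'.+1 then
  let s := (1, 1) :: W n' in G (s, n') ++ s else [::].
have W_size n : (n <= size (W n))%N.
  by elim: n => //= n IHn; rewrite size_cat /=; lia.
have W_suffix m n : (m <= n)%N -> exists s, W n = s ++ W m.
  elim: n => [|n IHn]; first by rewrite leqn0 => /eqP ->; exists [::].
  rewrite leq_eqVlt => /predU1P[->|]; first by exists [::].
  rewrite ltnS => /IHn[s Ws]; rewrite /= Ws.
  by exists (G ((1, 1) :: s ++ W m, n) ++ (1, 1) :: s); rewrite -catA.
(* The reversed words are initial segments of one infinite sequence [e]; its entry [j] can already
   be read in [W j.+1], which has more than [j] letters. *)
pose e j := nth (1, 1) (rev (W j.+1)) j.
have We n : rev (W n) = mkseq e (size (W n)).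
  apply: (@eq_from_nth _ (1, 1)); first by rewrite size_rev size_mkseq.
  move=> j; rewrite size_rev => jn; rewrite nth_mkseq// /e.
  have [jn'|nj] := leqP n j.+1.
    have [s ->] := W_suffix _ _ jn'.
    by rewrite rev_cat nth_cat size_rev jn.
  have [s ->] := W_suffix _ _ (ltnW nj).
  rewrite rev_cat nth_cat size_rev.
  by rewrite (leq_trans _ (W_size j.+1)).
pose D (n : nat) := if odd n then dur (e n./2).2 else dur (e n./2).1.
pose T (n : nat) : R := \sum_(i < n) D i.
have T0 : T 0%N = 0 by rewrite /T big_ord0.
have D_gt0 n : 0 < D n by rewrite /D; case: ifP => _; exact: dur_gt0.
have TS n : T n.+1 = T n + D n by rewrite /T big_ord_recr.
have T_lt n : T n < T n.+1 by rewrite TS ltrDl.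
pose len (s : seq (R * R)) := \sum_(p <- s) (dur p.1 + dur p.2).
have len_W n : n%:R <= len (W n).
  elim: n => [|n IHn]; first by rewrite /len big_nil.
  rewrite /len /= big_cat/= big_cons/= -/(len (W n)).
  have : 0 <= \sum_(p <- G ((1, 1) :: W n, n)) (dur p.1 + dur p.2).
    by apply: sumr_ge0 => p _; rewrite addr_ge0// ltW// dur_gt0.
  by rewrite -natr1 /dur ltr01; lra.
have T_len n : T n.*2 = len (mkseq e n).
  elim: n => [|n IHn]; first by rewrite T0 /len big_nil.
  rewrite doubleS !TS IHn mkseqS /len -cats1 big_cat big_seq1 /= addrA.
  by rewrite /D /= odd_double uphalf_double doubleK.
have T_unb c : exists n, c < T n.
  have [n cn] : exists n : nat, c < n%:R.
    by exists (Num.truncn `|c|).+1; rewrite (le_lt_trans (ler_norm c))// truncnS_gt.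
  exists (size (W n)).*2; rewrite T_len -We /len.
  rewrite (lt_le_trans cn)// (le_trans (len_W n))// /len.
  by rewrite (perm_big _ (permEl (perm_rev (W n)))).
have TD n : T n.+1 - T n = D n by rewrite TS addrAC subrr add0r.
have eval x0 n : alternating_path A b T_lt T_unb x0 (T n.*2) = bmap A b (rev (mkseq e n)) x0.
  rewrite (@trajectory_bmap _ _ A b T (alternating T_lt T_unb) x0)//; last first.
  - exact: alternating_trajectory.
  - by move=> k t kt; rewrite /alternating (jump_index_eq T_lt T_unb kt).
  have -> : mkseq (fun j => (T j.*2.+1 - T j.*2, T j.*2.+2 - T j.*2.+1)) n =
            [seq (dur p.1, dur p.2) | p <- mkseq e n].
    rewrite /mkseq -map_comp; apply: eq_map => j /=.
    by rewrite !TD /D /= odd_double uphalf_double doubleK.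
  rewrite -map_rev; elim: (rev _) => //= p s ->.
  by rewrite /bstep /= !(durE (dur_gt0 _)).
have bnd x0 : exists K, forall n, nrm1 (bmap A b (W n) x0) <= K.
  have := noexp (alternating T_lt T_unb) (alternating_control T0 T_lt T_unb).
  move=> /forallNP/(_ x0)/forallNP/(_ (alternating_path A b T_lt T_unb x0))/not_andP[|].
    by case; exact: alternating_trajectory.
  move=> /contrapT[K [_ /(_ (K + 1)) KP]].
  exists (d%:R * 1%:R * (K + 1)) => n.
  rewrite (le_trans (nrm1_le_norm _))// ler_wpM2l// KP ?ltrDl//=.
  exists (T (size (W n)).*2); last by rewrite eval -We revK.
  rewrite in_itv/= andbT -T0.
  have /nondecreasing_seqP T_nd k : T k <= T k.+1 by exact/ltW.
  exact: T_nd.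
have /choice[K KP] := bnd.
(* An affine map is determined by its values at 0 and at the basis vectors, so the bounds along
   these [d + 1] trajectories of a single control contradict the growth of the words. *)
have [n nK] : exists n : nat, K 0 + \sum_(j < d) (K (delta_mx j 0) + K 0) < n%:R.
  set c := (_ + _); exists (Num.truncn `|c|).+1.
  by rewrite (le_lt_trans (ler_norm c))// truncnS_gt.
have nW : n%:R < size_word (W n.+1) := GP ((1, 1) :: W n, n).
have := lt_trans nK nW.
apply/negP; rewrite -leNgt lerD//.
rewrite nrm1_col.
apply: ler_sum => j _; rewrite -[X in _ *m X]subr0 -(bmapB A b).
by apply: le_trans (nrm1B _ _) _; apply: lerD; exact: (KP _ n.+1).
Qed.

End Boundedness.

(** * Laws, measurability and the sequence space *)

Section Law.
Context {R : realType} {d1 d2 : measure_display}.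
Context {T1 : measurableType d1} {T2 : measurableType d2}.
Variables (P : probability T1 R) (f : T1 -> T2).
Hypothesis mf : measurable_fun setT f.

(** The measurability proof is an argument so that the measure and probability structures can be
    attached to the term itself. *)
Definition law (h : measurable_fun setT f) : set T2 -> \bar R := pushforward P f.

Let law0 : law mf set0 = 0%E.
Proof. by rewrite /law /pushforward preimage_set0 measure0. Qed.

Let law_ge0 U : (0 <= law mf U)%E.
Proof. exact: measure_ge0. Qed.

Let law_sigma_additive : semi_sigma_additive (law mf).
Proof. exact: (@measure_semi_sigma_additive _ _ _ (pushforward P f)). Qed.

HB.instance Definition _ :=
  isMeasure.Build _ _ _ (law mf) law0 law_ge0 law_sigma_additive.

Let law_setT : law mf setT = 1%E.
Proof. by rewrite /law /pushforward preimage_setT probability_setT. Qed.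

HB.instance Definition _ := Measure_isProbability.Build _ _ _ (law mf) law_setT.

Lemma lawE U : law mf U = P (f @^-1` U).
Proof. by []. Qed.

Lemma integral_law (g : T2 -> \bar R) : measurable_fun setT g ->
  (forall x, (0 <= g x)%E) -> (\int[law mf]_x g x = \int[P]_x g (f x))%E.
Proof. by move=> mg g0; rewrite ge0_integral_pushforward. Qed.

End Law.

Section MeasurableMatrix.
Context {R : realType} {dT : measure_display} {T : measurableType dT}.

Definition mx_measurable m n (f : T -> 'M[R]_(m, n)) :=
  forall i j, measurable_fun setT (fun x => f x i j).

Lemma mx_measurable_cst m n (M : 'M[R]_(m, n)) : mx_measurable (fun=> M).
Proof. by move=> i j; exact: measurable_cst. Qed.

Lemma mx_measurableD m n (f g : T -> 'M[R]_(m, n)) :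
  mx_measurable f -> mx_measurable g -> mx_measurable (fun x => f x + g x).
Proof.
by move=> mf mg i j; under eq_fun do rewrite mxE; exact: measurable_funD.
Qed.

Lemma mx_measurableB m n (f g : T -> 'M[R]_(m, n)) :
  mx_measurable f -> mx_measurable g -> mx_measurable (fun x => f x - g x).
Proof.
by move=> mf mg i j; under eq_fun do rewrite !mxE; exact: measurable_funB.
Qed.

Lemma mx_measurableM m n p (f : T -> 'M[R]_(m, n)) (g : T -> 'M[R]_(n, p)) :
  mx_measurable f -> mx_measurable g -> mx_measurable (fun x => f x *m g x).
Proof.
move=> mf mg i j; under eq_fun do rewrite mxE.
by apply: measurable_sum => k; exact: measurable_funM.
Qed.

Lemma mx_measurable_expmx d (A : 'M[R]_d) (t : T -> R) :
  measurable_fun setT t -> mx_measurable (fun x => expmx (t x *: A)).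
Proof.
move=> mt i j; apply: (@measurableT_comp _ _ _ _ _ _ (fun s : R => expmx (s *: A) i j)) => //.
by apply: continuous_measurable_fun; exact: continuous_expmx.
Qed.

Lemma measurable_nrm1 m n (f : T -> 'M[R]_(m, n)) :
  mx_measurable f -> measurable_fun setT (fun x => nrm1 (f x)).
Proof.
move=> mf; apply: measurable_sum => i; apply: measurable_sum => j.
by apply: measurableT_comp => //; exact: mf.
Qed.

Lemma measurable_enorm m n (f : T -> 'M[R]_(m, n)) :
  mx_measurable f -> measurable_fun setT (fun x => enorm (f x)).
Proof.
move=> mf; apply: (@measurableT_comp _ _ _ _ _ _ (@Num.sqrt R)).
  by apply: continuous_measurable_fun; exact: sqrt_continuous.
apply: measurable_sum => i; apply: measurable_sum => j.
by apply: measurable_funX; exact: mf.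
Qed.

(* Open sets are countable unions of boxes with rational centre. *)
Lemma measurable_borelM m n (f : T -> borelM R m n) :
  mx_measurable f -> measurable_fun setT f.
Proof.
move=> mf; refine (@measurability _ _ T (borelM R m n) setT f (@open 'M[R]_(m, n)) erefl _).
move=> _ [U oU <-]; rewrite setTI.
pose box (qk : 'M[rat]_(m, n) * nat) : set 'M[R]_(m, n) :=
  [set M | forall i j, `|M i j - ratr (qk.1 i j)| < qk.2.+1%:R^-1].
have -> : f @^-1` U = \bigcup_qk
    (if `[< box qk `<=` U >] then f @^-1` box qk else set0).
  apply/seteqP; split=> x /=; last first.
    by move=> [qk _]; case: ifPn => // /asboolP + xq; apply.
  move=> Ux; have := oU; rewrite openE => /(_ _ Ux)/nbhs_ballP[e /= e0 eU].
  pose k := Num.truncn (2 / e).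
  have ke : k.+1%:R^-1 < e / 2.
    rewrite -[ltRHS]invrK ltf_pV2 ?posrE ?invr_gt0 ?divr_gt0//.
    by rewrite invf_div truncnS_gt.
  have exq (ij : 'I_m * 'I_n) : exists q : rat, `|f x ij.1 ij.2 - ratr q| < k.+1%:R^-1.
    have [q] := @rat_in_itvoo R (f x ij.1 ij.2 - k.+1%:R^-1) (f x ij.1 ij.2 + k.+1%:R^-1)
      ltac:(by rewrite ltrD2l gtrN// invr_gt0).
    by rewrite in_itv/= => ?; exists q; rewrite distrC ltr_distl.
  have [q qP] := choice exq; pose Q : 'M[rat]_(m, n) := \matrix_(i, j) q (i, j).
  have xQ : box (Q, k) (f x) by move=> i j /=; rewrite mxE; exact: (qP (i, j)).
  exists (Q, k) => //; case: asboolP => [//|[]] y yQ; apply: eU.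
  split=> // i j; rewrite /ball/= -(subrKA (ratr (Q i j))).
  rewrite (le_lt_trans (ler_normD _ _))// (splitr e) ltrD//.
    by rewrite (lt_trans (xQ i j)).
  by rewrite distrC (lt_trans (yQ i j)).
apply: countable_bigcupT_measurable => [|qk]; first exact: countableP.
case: ifP => // _.
have -> : f @^-1` box qk = \bigcap_(ij in [set: 'I_m * 'I_n])
    [set x | `|f x ij.1 ij.2 - ratr (qk.1 ij.1 ij.2)| < qk.2.+1%:R^-1].
  by apply/seteqP; split=> x /= fx => [ij _|i j]; [exact: fx|exact: (fx (i, j))].
apply: fin_bigcap_measurable => [|ij _]; first exact: finite_finset.
rewrite -[X in measurable X]setTI.
apply: (@measurable_fun_ltr _ _ _ _ (fun x => `|f x ij.1 ij.2 - ratr (qk.1 ij.1 ij.2)|) (fun=> qk.2.+1%:R^-1)) => //.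
  by apply: measurableT_comp => //; apply: measurable_funB => //; exact: mf.
Qed.

End MeasurableMatrix.

Lemma mx_measurable_id (R : realType) m n : mx_measurable (@id (borelM R m n)).
Proof.
move=> i j; apply: (measurability _ (RGenOpens.measurableE R)).
move=> _ [_ [a [b ->]] <-]; rewrite setTI; apply: sub_sigma_algebra.
apply: (@open_comp _ _ (fun M : 'M[R]_(m, n) => M i j)) => [M _|]; first exact: coord_continuous.
exact: interval_open.
Qed.

Lemma mx_measurable_comp (R : realType) dT (T : measurableType dT) m n
    (f : T -> borelM R m n) :
  measurable_fun setT f -> mx_measurable f.
Proof.
by move=> mf i j; apply: (measurableT_comp (@mx_measurable_id R m n i j) mf).
Qed.

(** * The space of sequences of durations and its product law *)

Section SequenceSpace.
Context {R : realType}.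

Definition cylinder (N : nat) (U : nat -> set R) : set (nat -> R) :=
  [set w | forall i, (i < N)%N -> U i (w i)].

Definition cylinders : set (set (nat -> R)) :=
  [set C | exists N U, (forall i, measurable (U i)) /\ C = cylinder N U].

Definition seqspace := g_sigma_algebraType cylinders.

Definition pad (N : nat) (U : nat -> set R) i := if (i < N)%N then U i else setT.

Lemma measurable_pad N U : (forall i, measurable (U i)) ->
  forall i, measurable (pad N U i).
Proof. by move=> mU i; rewrite /pad; case: ifP. Qed.

Lemma cylinder_pad N M U : (N <= M)%N -> cylinder N U = cylinder M (pad N U).
Proof.
move=> NM; apply/seteqP; split=> w Uw i; rewrite /pad.
  by case: ifP => // iN _; exact: Uw.
by move=> iN; have := Uw i (leq_trans iN NM); rewrite /pad iN.
Qed.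

Lemma cylinders_setI : setI_closed cylinders.
Proof.
move=> _ _ [N [U [mU ->]]] [M [V [mV ->]]].
exists (maxn N M), (fun i => pad N U i `&` pad M V i); split.
  by move=> i; apply: measurableI; exact: measurable_pad.
rewrite (cylinder_pad U (leq_maxl N M)) (cylinder_pad V (leq_maxr N M)).
apply/seteqP; split=> w => [[Uw Vw] i iN|UV].
  by split; [exact: Uw|exact: Vw].
by split=> i iN; have [] := UV i iN.
Qed.

Lemma measurable_cylinder N U : (forall i, measurable (U i)) ->
  measurable (cylinder N U : set seqspace).
Proof. by move=> mU; apply: sub_sigma_algebra; exists N, U. Qed.

Lemma measurable_coord i : measurable_fun setT (fun w : seqspace => w i).
Proof.
move=> _ U mU; rewrite setTI.
pose V j := if j == i then U else setT.
have -> : (fun w : seqspace => w i) @^-1` U = cylinder i.+1 V.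
  apply/seteqP; split=> w /= => [Uw j _|/(_ i (ltnSn i))]; rewrite /V.
    by case: eqP => // ->.
  by rewrite eqxx.
by apply: measurable_cylinder => j; rewrite /V; case: ifP.
Qed.

Lemma measurable_seqspace dT (T : measurableType dT) (f : T -> seqspace) :
  (forall i, measurable_fun setT (fun x => f x i)) -> measurable_fun setT f.
Proof.
move=> mf; refine (@measurability _ _ T seqspace setT f cylinders erefl _).
move=> _ [_ [N [U [mU ->]]] <-]; rewrite setTI.
have -> : f @^-1` cylinder N U = \bigcap_(i in `I_N) ((fun x => f x i) @^-1` U i).
  by apply/seteqP; split=> x fx i; exact: fx.
apply: fin_bigcap_measurable => [|i _]; first exact: finite_II.
by rewrite -[X in measurable X]setTI; exact: mf.
Qed.

Lemma seqspace_measure_unique (m1 m2 : {measure set seqspace -> \bar R}) :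
  (m1 setT < +oo)%E ->
  (forall N U, (forall i, measurable (U i)) ->
     m1 (cylinder N U) = m2 (cylinder N U)) ->
  forall C, measurable C -> m1 C = m2 C.
Proof.
move=> m1T m12; have cyl0 : cylinder 0 (fun=> setT) = setT by apply/seteqP; split.
apply: (@measure_unique _ _ seqspace cylinders (fun=> setT)) => //.
- exact: cylinders_setI.
- by move=> _; exists 0%N, (fun=> setT); rewrite cyl0.
- by apply/seteqP; split=> // w _; exists 0%N.
- by move=> _ [N [U [mU ->]]]; exact: m12.
Qed.

(** The cut falls after [n] whole blocks: a shift by the even number [n.*2] keeps the parity of the
    indices, hence the law of each coordinate. *)
Definition splice (n : nat) (w w' : nat -> R) : nat -> R :=
  fun i => if (i < n.*2)%N then w i else w' (i - n.*2)%N.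

Definition words (n : nat) (w : nat -> R) : seq (R * R) :=
  mkseq (fun j => (w j.*2, w j.*2.+1)) n.

Lemma words_splice n m w w' : words (n + m) (splice n w w') = words n w ++ words m w'.
Proof.
rewrite /words /mkseq iotaD map_cat; congr cat.
  apply/eq_in_map => j; rewrite mem_iota /= /splice => jn.
  by rewrite !ifT//; lia.
rewrite -[X in iota X m]addn0 iotaDl -map_comp; apply: eq_map => j /=.
rewrite /splice ifF; last by lia.
by rewrite ifF; [congr (w' _, w' _); lia|lia].
Qed.

Lemma measurable_splice n :
  measurable_fun setT (fun z : seqspace * seqspace => splice n z.1 z.2 : seqspace).
Proof.
apply: measurable_seqspace => i; rewrite /splice; case: (i < n.*2)%N.
  by apply: (measurableT_comp (measurable_coord i)); exact: measurable_fst.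
by apply: (measurableT_comp (measurable_coord _)); exact: measurable_snd.
Qed.

Section ProductLaw.
Variables (Q : probability seqspace R) (m : bool -> set R -> \bar R).
Hypothesis Q_cylinder : forall N U, (forall i, measurable (U i)) ->
  Q (cylinder N U) = (\prod_(0 <= i < N) m (odd i) (U i))%E.

(** The renewal property: the sequence after [n] blocks is independent of these blocks and has law
    [Q] again. On cylinders it is the splitting of a product. *)
Lemma law_splice n C : measurable C ->
  Q C = (Q \x Q)%E [set z | C (splice n z.1 z.2)].
Proof.
move=> mC; rewrite -(lawE (Q \x Q)%E (measurable_splice n)).
apply: seqspace_measure_unique C mC => [|N U mU].
  by rewrite [X in (X < _)%E](_ : _ = 1%E) ?ltry//; exact: probability_setT.
have NnN : (N <= n.*2 + N)%N by rewrite leq_addl.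
rewrite (cylinder_pad U NnN) [RHS](lawE (Q \x Q)%E (measurable_splice n)).
set V := pad N U; have mV : forall i, measurable (V i) := measurable_pad N mU.
have -> : (fun z : seqspace * seqspace => splice n z.1 z.2 : seqspace) @^-1`
      cylinder (n.*2 + N) V =
    cylinder n.*2 V `*` cylinder N (fun i => V (i + n.*2)%N).
  apply/seteqP; split=> [[w w']|[w w']] /=.
    move=> Vw; split=> i iN /=.
      by have := Vw i; rewrite /splice iN; apply; rewrite (leq_trans iN)// leq_addr.
    have := Vw (i + n.*2)%N; rewrite /splice addnK ifF; last by lia.
    by apply; rewrite addnC ltn_add2l.
  move=> [/= Vw Vw'] i iN; rewrite /splice; case: ltnP => ni; first exact: Vw.
  by have := Vw' (i - n.*2)%N; rewrite subnK//; apply; lia.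
have mV' i : measurable (V (i + n.*2)%N) by exact: mV.
rewrite [RHS](product_measure1E Q Q (measurable_cylinder n.*2 mV) (measurable_cylinder N mV')).
rewrite [LHS]Q_cylinder// [X in (X * _)%E]Q_cylinder// [X in (_ * X)%E]Q_cylinder//.
rewrite (@big_cat_nat _ _ _ n.*2)//= ?leq_addr//; congr (_ * _)%E.
rewrite -{1}[n.*2]add0n big_addn addnC addnK; apply: eq_bigr => i _.
by rewrite oddD odd_double addbF.
Qed.

Lemma integral_splice n (F : seqspace -> \bar R) : measurable_fun setT F ->
  (forall w, (0 <= F w)%E) ->
  (\int[Q]_w F w = \int[Q]_w \int[Q]_w' F (splice n w w'))%E.
Proof.
move=> mF F0; have mFs := measurableT_comp mF (measurable_splice n).
transitivity (\int[law (Q \x Q)%E (measurable_splice n)]_w F w)%E.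
  by apply: eq_measure_integral => C mC _; rewrite [RHS]lawE; exact: law_splice.
rewrite integral_law//.
exact: (@fubini_tonelli1 _ _ _ _ R Q Q _ mFs (fun z => F0 _)).
Qed.

(* An involution of the indices that lists the first [n] blocks of two
   coordinates backwards and keeps each coordinate's parity, hence preserves
   laws of the form [Q_cylinder]. *)
Definition reversal (n i : nat) : nat :=
  if (i < n.*2)%N then ((n - i./2.+1).*2 + odd i)%N else i.

Lemma reversalK n : involutive (reversal n).
Proof.
move=> i; rewrite {2}/reversal; case: (ltnP i n.*2) => ni; last first.
  by rewrite /reversal ltnNge ni.
by rewrite /reversal ifT; lia.
Qed.

Lemma odd_reversal n i : odd (reversal n i) = odd i.
Proof.
by rewrite /reversal; case: ifP => // _; rewrite oddD odd_double oddb.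
Qed.

Lemma words_reversal n w : words n (w \o reversal n) = rev (words n w).
Proof.
apply: (@eq_from_nth _ (0, 0)); first by rewrite size_rev !size_mkseq.
move=> j; rewrite size_mkseq => jn.
rewrite nth_rev ?size_mkseq// !nth_mkseq ?ltn_subrL//=; last by lia.
by congr (w _, w _); rewrite /reversal ifT; lia.
Qed.

Lemma measurable_reversal n :
  measurable_fun setT (fun w : seqspace => (w \o reversal n) : seqspace).
Proof. by apply: measurable_seqspace => i; exact: measurable_coord. Qed.

Lemma law_reversal n C : measurable C -> Q [set w : seqspace | C (w \o reversal n : seqspace)] = Q C.
Proof.
move=> mC; rewrite -(lawE Q (measurable_reversal n)).
apply: seqspace_measure_unique C mC => [|N U mU]; first
  by rewrite [X in (X < _)%E](_ : _ = 1%E) ?ltry//; exact: probability_setT.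
have NnN : (N <= n.*2 + N)%N by rewrite leq_addl.
rewrite (cylinder_pad U NnN) [LHS](lawE Q (measurable_reversal n)).
set V := pad N U; have mV : forall i, measurable (V i) := measurable_pad N mU.
set M := (n.*2 + N)%N.
have rM i : (i < M)%N -> (reversal n i < M)%N.
  by rewrite /reversal /M; case: ifP; lia.
have -> : (fun w : seqspace => (w \o reversal n) : seqspace) @^-1` cylinder M V =
    cylinder M (V \o reversal n).
  apply/seteqP; split=> w Vw i iM /=.
    by have := Vw _ (rM _ iM); rewrite /= reversalK.
  by have := Vw _ (rM _ iM); rewrite /= reversalK.
rewrite [RHS]Q_cylinder// [LHS]Q_cylinder; last by move=> i; exact: mV.
pose r (i : 'I_M) := Ordinal (rM i (ltn_ord i)).
rewrite !big_mkord [RHS](reindex_inj (h := r)).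
  by apply: eq_bigr => i _; rewrite /= odd_reversal.
by move=> i j [/(can_inj (reversalK n)) ij]; apply: val_inj.
Qed.

Lemma integral_reversal n (F : seqspace -> \bar R) : measurable_fun setT F ->
  (forall w, (0 <= F w)%E) ->
  (\int[Q]_w F ((w : nat -> R) \o reversal n) = \int[Q]_w F w)%E.
Proof.
move=> mF F0; transitivity (\int[law Q (measurable_reversal n)]_w F w)%E.
  by rewrite integral_law.
by apply: eq_measure_integral => C mC _; rewrite [LHS]lawE; exact: law_reversal.
Qed.

End ProductLaw.
End SequenceSpace.

Arguments seqspace R : clear implicits.

Section InterjumpLaw.
Context {R : realType} {dO : measure_display} {Omega : measurableType dO}.
Variables (P : probability Omega R) (X : nat -> Omega -> R) (m : bool -> set R -> \bar R).
Hypothesis X_law : forall n, has_law P (X n) (m (odd n)).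
Hypothesis X_indep : independent P X.

Lemma measurable_sample : measurable_fun setT (fun w => X^~ w : seqspace R).
Proof. by apply: measurable_seqspace => i; have [] := X_law i. Qed.

Lemma sample_cylinder N U : (forall i, measurable (U i)) ->
  law P measurable_sample (cylinder N U) = (\prod_(0 <= i < N) m (odd i) (U i))%E.
Proof.
move=> mU; rewrite lawE.
have -> : (fun w => X^~ w : seqspace R) @^-1` cylinder N U =
    \bigcap_(i in [set` iota 0 N]) (X i @^-1` U i).
  by apply/seteqP; split=> w Uw i; have := Uw i; rewrite /= mem_iota.
rewrite X_indep ?iota_uniq// /index_iota subn0; apply: eq_bigr => i _.
by have [_ ->] := X_law i.
Qed.

End InterjumpLaw.

Section BlockBounds.
Context {R : realType} {d : nat}.
Variables (A : bool -> 'M[R]_d) (b : bool -> 'cV[R]_d).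
Hypothesis hA : forall i, hurwitz (A i).

Lemma expmx_bounded : exists2 C, 0 < C & forall i t, 0 <= t -> nrm1 (expmx (t *: A i)) <= C.
Proof.
have bnd i : exists2 C, 0 <= C & forall t, 0 <= t -> nrm1 (expmx (t *: A i)) <= C.
  have [K [e [K0 e0 KP]]] := hurwitz_decay (@hA i).
  exists K => // t t0; rewrite (le_trans (KP t t0))// ler_piMr//.
  by rewrite -expR0 ler_expR mulNr oppr_le0 mulr_ge0// ltW.
have [C0 C00 C0P] := bnd false; have [C1 C10 C1P] := bnd true.
exists (C0 + C1 + 1); first by lra.
by move=> [] t t0; [rewrite (le_trans (C1P t t0))|rewrite (le_trans (C0P t t0))]; lra.
Qed.

Lemma expmx_small e : 0 < e ->
  exists2 T, 0 < T & forall i t, T <= t -> nrm1 (expmx (t *: A i)) <= e.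
Proof.
move=> e0.
have sm i : exists2 T, 0 < T & forall t, T <= t -> nrm1 (expmx (t *: A i)) <= e.
  have [K [c [K0 c0 KP]]] := hurwitz_decay (@hA i).
  exists ((K / e) / c + 1); first by rewrite ltr_wpDl// !divr_ge0// ltW.
  move=> t Tt; have t0 : 0 <= t.
    by apply: le_trans Tt; rewrite addr_ge0// !divr_ge0// ltW.
  rewrite (le_trans (KP t t0))// mulNr expRN ler_pdivrMr ?expR_gt0// mulrC -ler_pdivrMr//.
  rewrite (le_trans _ (expR_ge1Dx _))//.
  have : K / e <= c * t.
    have : K / e / c <= t by rewrite (le_trans _ Tt)// lerDl.
    by rewrite ler_pdivrMr// [t * c]mulrC.
  by lra.
have [T0 T00 T0P] := sm false; have [T1 T10 T1P] := sm true.
exists (T0 + T1); first exact: addr_gt0.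
by move=> [] t tT; [apply: T1P|apply: T0P]; lra.
Qed.

Lemma bmat_bounded : exists2 C, 0 < C & forall e, nrm1 (bmat A e) <= C.
Proof.
have [C C0 CP] := expmx_bounded; exists (C * C) => [|e]; first exact: mulr_gt0.
by rewrite (le_trans (nrm1M _ _))// ler_pM ?nrm1_ge0// CP// ltW// dur_gt0.
Qed.

Lemma bmat_small e : 0 < e ->
  exists2 T, 0 < T & forall p, T <= dur p.1 -> nrm1 (bmat A p) <= e.
Proof.
move=> e0; have [C C0 CP] := expmx_bounded.
have [|T T0 TP] := @expmx_small (e / C); first exact: divr_gt0.
exists T => // p Tp; rewrite (le_trans (nrm1M _ _))//.
rewrite (@le_trans _ _ (C * (e / C)))//; last by rewrite mulrC divfK ?gt_eqF.
by rewrite ler_pM ?nrm1_ge0 ?TP// CP// ltW// dur_gt0.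
Qed.

Lemma bstep0_bounded : exists2 v, 0 < v & forall e, nrm1 (bstep A b e 0) <= v.
Proof.
have [C C0 CP] := expmx_bounded.
have flow_le i t x : 0 <= t ->
    nrm1 (flow A b i t x) <= C * (nrm1 x + nrm1 (b i)) + nrm1 (b i).
  move=> t0; rewrite (le_trans (nrm1D _ _))// lerD2r (le_trans (nrm1M _ _))//.
  by rewrite ler_pM ?nrm1_ge0 ?CP ?nrm1B.
exists (C * ((C * nrm1 (b false) + nrm1 (b false)) + nrm1 (b true)) + nrm1 (b true) + 1).
  by rewrite ltr_wpDl// !(addr_ge0, mulr_ge0) ?nrm1_ge0// ltW.
move=> e; rewrite (le_trans (flow_le _ _ _ (ltW (dur_gt0 _))))//.
rewrite (@le_trans _ _ (C * (C * nrm1 (b false) + nrm1 (b false) + nrm1 (b true)) + nrm1 (b true)))//; last by rewrite lerDl.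
rewrite lerD2r ler_wpM2l ?(ltW C0)// lerD2r.
by rewrite (le_trans (flow_le _ _ _ (ltW (dur_gt0 _))))// nrm1_0 add0r.
Qed.

Lemma nrm1_bprod C s : 0 <= C -> (forall e, nrm1 (bmat A e) <= C) ->
  nrm1 (bprod A s) <= nrm1 (1%:M : 'M[R]_d) * C ^+ size s.
Proof.
move=> C0 CP; elim: s => [|e s IHs] /=; first by rewrite expr0 mulr1.
rewrite (le_trans (nrm1M _ _))// exprS mulrCA.
by rewrite ler_pM ?nrm1_ge0 ?CP.
Qed.

End BlockBounds.

Section BlockMeasurability.
Context {R : realType} {d : nat}.
Variables (A : bool -> 'M[R]_d) (b : bool -> 'cV[R]_d).

Lemma measurable_dur : measurable_fun setT (@dur R).
Proof.
apply: measurable_fun_ifT => //.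
by apply: (@measurable_fun_ltr _ _ _ _ (fun=> 0) id).
Qed.

Let measurable_dur_coord dT (T : measurableType dT) (f : T -> seqspace R) i :
  measurable_fun setT f -> measurable_fun setT (fun x => dur (f x i)).
Proof.
move=> mf; apply: (measurableT_comp measurable_dur).
by apply: (measurableT_comp (measurable_coord i)).
Qed.

Lemma mx_measurable_bprod dT (T : measurableType dT) (f : T -> seqspace R) n :
  measurable_fun setT f -> mx_measurable (fun x => bprod A (words n (f x))).
Proof.
move=> mf; rewrite /words /mkseq; elim: (iota 0 n) => [|j l IHl] /=.
  exact: mx_measurable_cst.
apply: mx_measurableM => //.
by apply: mx_measurableM; apply: mx_measurable_expmx; exact: measurable_dur_coord.
Qed.

Lemma mx_measurable_flow dT (T : measurableType dT) i (t : T -> R) (x : T -> 'cV[R]_d) :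
  measurable_fun setT t -> mx_measurable x ->
  mx_measurable (fun z => flow A b i (t z) (x z)).
Proof.
move=> mt mx; apply: mx_measurableD; last exact: mx_measurable_cst.
apply: mx_measurableM; first exact: mx_measurable_expmx.
by apply: mx_measurableB => //; exact: mx_measurable_cst.
Qed.

Lemma mx_measurable_bmap dT (T : measurableType dT) (f : T -> seqspace R)
    (x : T -> 'cV[R]_d) n : measurable_fun setT f -> mx_measurable x ->
  mx_measurable (fun z => bmap A b (words n (f z)) (x z)).
Proof.
move=> mf mx; rewrite /words /mkseq; elim: (iota 0 n) => [|j l IHl] //=.
by do 2 (apply: mx_measurable_flow; first exact: measurable_dur_coord).
Qed.

Lemma mx_measurable_bprod_rev n :
  mx_measurable (fun w : seqspace R => bprod A (rev (words n w))).
Proof.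
have -> : (fun w : seqspace R => bprod A (rev (words n w))) =
    (fun w : seqspace R => bprod A (words n (w \o reversal n))).
  by apply/funext => w; rewrite words_reversal.
by apply: mx_measurable_bprod; exact: measurable_reversal.
Qed.

End BlockMeasurability.

Section Invariance.
Context {R : realType} {d : nat}.
Variables (A : bool -> 'M[R]_d) (b : bool -> 'cV[R]_d).
Variables (Q : probability (seqspace R) R) (m : bool -> set R -> \bar R).
Hypothesis Q_cylinder : forall N U, (forall i, measurable (U i)) ->
  Q (cylinder N U) = (\prod_(0 <= i < N) m (odd i) (U i))%E.

(** Invariance under the transition kernel written on the sequence space, freed from the given
    probability space and process; [invariant_block] relates the two. *)
Definition block_invariant (nu : probability (borelM R d 1) R) : Prop :=
  forall U : set (borelM R d 1), measurable U ->
    (\int[nu]_x Q [set w | U (bmap A b (words 1 w) x)] = nu U)%E.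

Let step (n : nat) (z : borelM R d 1 * seqspace R) : borelM R d 1 :=
  bmap A b (words n z.2) z.1.

Lemma measurable_step n : measurable_fun setT (step n).
Proof.
apply: measurable_borelM; apply: mx_measurable_bmap; first exact: measurable_snd.
by apply: mx_measurable_comp; exact: measurable_fst.
Qed.

Lemma measurable_step_swap n : measurable_fun setT
  (fun z : seqspace R * borelM R d 1 => bmap A b (words n z.1) z.2 : borelM R d 1).
Proof.
apply: measurable_borelM; apply: mx_measurable_bmap; first exact: measurable_fst.
by apply: mx_measurable_comp; exact: measurable_snd.
Qed.

Lemma measurable_word_map n (x : 'cV[R]_d) : measurable_fun setT
  (fun w : seqspace R => bmap A b (words n w) x : borelM R d 1).
Proof.
apply: measurable_borelM; apply: mx_measurable_bmap; first exact: measurable_id.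
exact: mx_measurable_cst.
Qed.

Variable nu : probability (borelM R d 1) R.
Hypothesis nu_inv : block_invariant nu.

Let integral_step1 (phi : borelM R d 1 -> \bar R) : measurable_fun setT phi ->
  (forall x, (0 <= phi x)%E) ->
  (\int[nu]_x \int[Q]_w phi (bmap A b (words 1 w) x) = \int[nu]_x phi x)%E.
Proof.
move=> mphi phi0; have mst := measurableT_comp mphi (measurable_step 1).
have := @fubini_tonelli1 _ _ _ _ R nu Q _ mst (fun z => phi0 _).
rewrite /fubini_F /step /= => <-.
transitivity (\int[law (nu \x Q)%E (measurable_step 1)]_x phi x)%E.
  by rewrite integral_law.
apply: eq_measure_integral => U mU _.
rewrite [LHS](lawE (nu \x Q)%E (measurable_step 1)); apply: etrans (nu_inv mU).
transitivity (\int[nu]_x Q (xsection (step 1 @^-1` U) x))%E; first by [].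
apply: eq_integral => x _; congr (Q _).
by apply/seteqP; split=> w /=; rewrite /xsection/= ?inE.
Qed.

Lemma integral_step n (phi : borelM R d 1 -> \bar R) : measurable_fun setT phi ->
  (forall x, (0 <= phi x)%E) ->
  (\int[nu]_x \int[Q]_w phi (bmap A b (words n w) x) = \int[nu]_x phi x)%E.
Proof.
elim: n phi => [|n IHn] phi mphi phi0.
  apply: eq_integral => x _; rewrite /= integral_cst// [X in (_ * X)%E]probability_setT.
  by rewrite mule1.
pose psi (y : borelM R d 1) : \bar R := (\int[Q]_w phi (bmap A b (words 1 w) y))%E.
have mpsi : measurable_fun setT psi.
  have mst := measurableT_comp mphi (measurable_step 1).
  exact: (@measurable_fun_fubini_tonelli_F _ _ _ _ R Q _ mst (fun z => phi0 _)).
have psi0 y : (0 <= psi y)%E by apply: integral_ge0.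
refine (etrans _ (integral_step1 mphi phi0)); refine (etrans _ (IHn psi mpsi psi0)).
apply: eq_integral => x _; rewrite /psi.
have mphin : measurable_fun setT (fun w : seqspace R => phi (bmap A b (words n.+1 w) x)).
  exact: (measurableT_comp mphi (measurable_word_map n.+1 x)).
refine (etrans (integral_splice Q_cylinder 1 mphin (fun w => phi0 _)) _).
have catE w w' : bmap A b (words n.+1 (splice 1 w w')) x =
    bmap A b (words 1 w) (bmap A b (words n w') x).
  by rewrite -[n.+1]add1n words_splice bmap_cat.
pose F (z : seqspace R * seqspace R) := phi (bmap A b (words 1 z.1) (bmap A b (words n z.2) x)).
transitivity (\int[Q]_w \int[Q]_w' F (w, w'))%E.
  by apply: eq_integral => w _; apply: eq_integral => w' _; congr (phi _); exact: catE.
(* The first block of a word acts last, but the induction integrates it first, the state reached by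
   the other [n] blocks being fixed; Tonelli exchanges the two. *)
refine (@fubini_tonelli _ _ _ _ R Q Q F _ (fun z => phi0 _)).
apply: (measurableT_comp mphi); apply: measurable_borelM.
apply: mx_measurable_bmap; first exact: measurable_fst.
apply: mx_measurable_bmap; first exact: measurable_snd.
exact: mx_measurable_cst.
Qed.

End Invariance.

(** * Moments of products and the stationary law *)

Section PowR.
Context {R : realType}.

(** For the shares u = z / (x + y) in [0, 1] and p <= 1 one has u <= u^p, and the shares of [x] and
    [y] add up to 1. *)
Lemma powR_subadditive (p x y : R) : 0 < p <= 1 -> 0 <= x -> 0 <= y ->
  (x + y) `^ p <= x `^ p + y `^ p.
Proof.
move=> /andP[p0 p1] x0 y0.
have [s0|s0] := eqVneq (x + y) 0.
  by rewrite s0 powR0 ?gt_eqF// addr_ge0 ?powR_ge0.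
have {s0}s0 : 0 < x + y by rewrite lt0r s0 addr_ge0.
have key z : 0 <= z -> z <= x + y -> z / (x + y) * (x + y) `^ p <= z `^ p.
  move=> z0 zs; have [->|zn0] := eqVneq z 0; first by rewrite !mul0r powR_ge0.
  have zs0 : 0 < z / (x + y) by rewrite divr_gt0// lt0r zn0.
  rewrite -{2}(divfK (lt0r_neq0 s0) z) powRM ?(ltW zs0) ?(ltW s0)//.
  rewrite ler_wpM2r ?powR_ge0// -{1}[z / _]powRr1 ?(ltW zs0)//.
  by apply: ger_powR => //; rewrite zs0 ler_pdivrMr// mul1r.
rewrite (le_trans _ (lerD (key x x0 _) (key y y0 _))) ?lerDl ?lerDr//.
by rewrite -mulrDl -mulrDl divff ?gt_eqF// mul1r.
Qed.

Lemma powR_sum_subadditive (p : R) (x : nat -> R) n : 0 < p <= 1 ->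
  (forall k, 0 <= x k) ->
  (\sum_(0 <= k < n) x k) `^ p <= \sum_(0 <= k < n) x k `^ p.
Proof.
move=> p01 x0; elim: n => [|n IHn].
  by rewrite !big_geq// powR0// gt_eqF//; case/andP: p01.
rewrite !big_nat_recr//= (le_trans (powR_subadditive p01 _ _))//.
  by rewrite sumr_ge0.
by rewrite lerD2r.
Qed.

Lemma le_powR (p x y : R) : 0 <= p -> 0 <= x -> x <= y -> x `^ p <= y `^ p.
Proof. by move=> p0 x0 xy; rewrite ge0_ler_powR// nnegrE// (le_trans x0). Qed.

End PowR.

Section ProbabilityIntegral.
Context {R : realType} {dT : measure_display} {T : measurableType dT}.
Variable P : probability T R.

Lemma ge0_integral_le (f g : T -> \bar R) : (forall x, (0 <= f x)%E) ->
  measurable_fun setT f -> measurable_fun setT g -> (forall x, (f x <= g x)%E) ->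
  (\int[P]_x f x <= \int[P]_x g x)%E.
Proof.
move=> f0 mf mg fg; apply: ge0_le_integral => // x _.
Qed.

Lemma integral_le_cst (f : T -> \bar R) c : (forall x, (0 <= f x)%E) ->
  measurable_fun setT f -> (forall x, (f x <= c)%E) -> (\int[P]_x f x <= c)%E.
Proof.
move=> f0 mf fc; rewrite (le_trans (ge0_integral_le f0 mf _ fc))//.
rewrite integral_cst// [X in (_ * X)%E]probability_setT mule1//.
Qed.

Lemma integral_lt_pinfty_ae (f : T -> \bar R) : measurable_fun setT f ->
  (forall x, (0 <= f x)%E) -> (\int[P]_x f x < +oo)%E ->
  P [set x | f x = +oo%E] = 0%E.
Proof.
move=> mf f0 fi; have fint : P.-integrable setT f.
  apply/integrableP; split => //.
  by under eq_integral do rewrite gee0_abs//.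
have [N [mN PN NP]] := integrable_ae measurableT fint.
apply: (@subset_measure0 _ _ _ P _ N) => //.
- have -> : [set x | f x = +oo%E] = ~` [set x | (f x < +oo)%E].
    by apply/seteqP; split=> x /=; rewrite ltey; [move=> ->; rewrite eqxx|move=> /negP; rewrite negbK => /eqP].
  apply: measurableC; rewrite -[X in measurable X]setTI.
  exact: emeasurable_fun_infty_o.
- by move=> x /= fx; apply: NP => /=; rewrite fx => /(_ I).
Qed.

End ProbabilityIntegral.

Lemma product_measureC (R : realType) (d1 d2 : measure_display) (T1 : measurableType d1)
    (T2 : measurableType d2) (P1 : probability T1 R) (P2 : probability T2 R) E :
  measurable E -> (P1 \x P2)%E E = (P1 \x^ P2)%E E.
Proof.
move=> mE; apply: (@product_measure_unique _ _ _ _ R P1 P2 (P1 \x^ P2)%E) mE => U V mU mV.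
exact: product_measure2E.
Qed.

Section Contraction.
Context {R : realType} {d : nat}.
Variable A : bool -> 'M[R]_d.
Hypothesis hA : forall i, hurwitz (A i).
Variables (Q : probability (seqspace R) R) (m : bool -> set R -> \bar R).
Hypothesis Q_cylinder : forall N U, (forall i, measurable (U i)) ->
  Q (cylinder N U) = (\prod_(0 <= i < N) m (odd i) (U i))%E.

Definition moment (p : R) (n : nat) : \bar R :=
  (\int[Q]_w (nrm1 (bprod A (words n w)) `^ p)%:E)%E.

Lemma measurable_nrm1_bprod p n : measurable_fun setT
  (fun w : seqspace R => (nrm1 (bprod A (words n w)) `^ p)%:E).
Proof.
apply/measurable_EFinP; apply: (measurableT_comp (measurable_powR p)).
by apply: measurable_nrm1; apply: mx_measurable_bprod; exact: measurable_id.
Qed.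

Lemma moment_ge0 p n : (0 <= moment p n)%E.
Proof. by apply: integral_ge0 => w _; rewrite lee_fin powR_ge0. Qed.

Lemma moment_fin p n : 0 <= p -> moment p n \is a fin_num.
Proof.
move=> p0; rewrite ge0_fin_numE ?moment_ge0//; have [C C0 CP] := bmat_bounded hA.
apply: (@le_lt_trans _ _ ((nrm1 (1%:M : 'M[R]_d) * C ^+ n) `^ p)%:E); last exact: ltry.
apply: integral_le_cst => [w||w]; rewrite ?lee_fin ?powR_ge0//.
  exact: measurable_nrm1_bprod.
rewrite le_powR ?nrm1_ge0//.
by have := nrm1_bprod (words n w) (ltW C0) CP; rewrite size_mkseq.
Qed.

Lemma moment_submul p n k : 0 <= p -> (moment p (n + k) <= moment p n * moment p k)%E.
Proof.
move=> p0; rewrite /moment (integral_splice Q_cylinder n (measurable_nrm1_bprod p (n + k))).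
  2: by move=> w; rewrite lee_fin powR_ge0.
rewrite -ge0_integralZr ?moment_ge0//; last 2 first.
- exact: measurable_nrm1_bprod.
- by move=> w _; rewrite lee_fin powR_ge0.
have ms := measurableT_comp (measurable_nrm1_bprod p (n + k)) (measurable_splice n).
apply: ge0_integral_le => [w||| w].
- by apply: integral_ge0 => w' _; rewrite lee_fin powR_ge0.
- apply: (@measurable_fun_fubini_tonelli_F _ _ _ _ R Q _ ms) => z.
  by rewrite lee_fin powR_ge0.
- by apply: emeasurable_funM => //; exact: measurable_nrm1_bprod.
rewrite -ge0_integralZl ?lee_fin ?powR_ge0//; last 2 first.
- exact: measurable_nrm1_bprod.
- by move=> w' _; rewrite lee_fin powR_ge0.
apply: ge0_integral_le => [w'||| w'].
- by rewrite lee_fin powR_ge0.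
- apply/measurable_EFinP; apply: (measurableT_comp (measurable_powR p)).
  apply: measurable_nrm1; apply: mx_measurable_bprod.
  apply: measurable_seqspace => i; rewrite /splice; case: (i < n.*2)%N.
    exact: measurable_cst.
  exact: measurable_coord.
- by apply: emeasurable_funM => //; exact: measurable_nrm1_bprod.
rewrite -EFinM lee_fin words_splice bprod_cat -powRM ?nrm1_ge0//.
by rewrite le_powR ?nrm1_ge0// nrm1M.
Qed.

Lemma moment_summable p n0 : 0 <= p -> (moment p n0 < 1)%E ->
  (\sum_(0 <= n <oo) moment p n < +oo)%E.
Proof.
move=> p0 lt1; pose a n := fine (moment p n).
have aE n : moment p n = (a n)%:E by rewrite fineK// moment_fin.
have a0 n : 0 <= a n by rewrite fine_ge0// moment_ge0.
have a1 : a n0 < 1 by rewrite -lte_fin -aE.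
have aS n : a (n0 + n)%N <= a n0 * a n.
  by rewrite -lee_fin EFinM -!aE moment_submul.
pose s N := \sum_(0 <= n < N) a n.
(* Shifting the sum by [n0] gives [s N <= s n0 + a n0 * s N], which is solved for [s N]. *)
have sle N : s N <= s n0 / (1 - a n0).
  rewrite ler_pdivlMr ?subr_gt0// mulrBr mulr1 lerBlDr.
  apply: (@le_trans _ _ (s (n0 + N)%N)).
    by rewrite /s addnC [leRHS](@big_cat_nat _ _ _ N)//= ?leq_addr// lerDl sumr_ge0.
  rewrite {1}/s (@big_cat_nat _ _ _ n0)//= ?leq_addr// lerD2l.
  rewrite -{1}[n0]add0n big_addn addKn /s mulr_suml; apply: ler_sum => k _.
  by rewrite addnC mulrC.
apply: (@le_lt_trans _ _ (s n0 / (1 - a n0))%:E); last exact: ltry.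
apply: lime_le; first by apply: is_cvg_nneseries => n _ _; exact: moment_ge0.
apply: nearW => N; under eq_bigr do rewrite aE.
by rewrite sumEFin lee_fin; exact: sle.
Qed.

End Contraction.

(** * Convergence of the backward iterates and the stationary law *)

Section Stationary.
Context {R : realType} {d : nat}.
Variables (A : bool -> 'M[R]_d) (b : bool -> 'cV[R]_d).
Hypothesis hA : forall i, hurwitz (A i).
Variables (Q : probability (seqspace R) R) (m : bool -> set R -> \bar R).
Hypothesis Q_cylinder : forall N U, (forall i, measurable (U i)) ->
  Q (cylinder N U) = (\prod_(0 <= i < N) m (odd i) (U i))%E.
Variable p : R.
Hypothesis p01 : 0 < p <= 1.
Hypothesis moments_finite : (\sum_(0 <= n <oo) moment A Q p n < +oo)%E.

Let p0 : 0 < p. Proof. by case/andP: p01. Qed.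

Let Z n (w : seqspace R) : 'cV[R]_d := bmap A b (words n w) 0.
Let B n (w : seqspace R) : R := nrm1 (bprod A (words n w)).

(** Only [p]-th moments are controlled, so it is the series of [p]-th powers whose mean is finite;
    subadditivity then recovers convergence of the series of norms, bounded by [D w] to the power
    [1 / p]. *)
Let D (w : seqspace R) : \bar R := (\sum_(0 <= n <oo) (B n w `^ p)%:E)%E.

Let D_ge0 w : (0 <= D w)%E.
Proof. by apply: nneseries_ge0 => n _ _; rewrite lee_fin powR_ge0. Qed.

Let measurable_D : measurable_fun setT D.
Proof.
apply: ge0_emeasurable_sum => [k x _ _|k _]; first by rewrite lee_fin powR_ge0.
exact: measurable_nrm1_bprod.
Qed.

Let integral_D : (\int[Q]_w D w < +oo)%E.
Proof.
rewrite /D integral_nneseries// => n; first exact: measurable_nrm1_bprod.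
by move=> w _; rewrite lee_fin powR_ge0.
Qed.

Definition summable_paths : set (seqspace R) := [set w | (D w < +oo)%E].

Lemma measurable_summable_paths : measurable summable_paths.
Proof. by rewrite -[X in measurable X]setTI; exact: emeasurable_fun_infty_o. Qed.

Lemma summable_paths_ae : Q (~` summable_paths) = 0%E.
Proof.
rewrite -(integral_lt_pinfty_ae measurable_D D_ge0 integral_D); congr (Q _).
apply/seteqP; split=> w /=; rewrite /summable_paths /= ltey.
  by move=> /negP; rewrite negbK => /eqP.
by move=> ->; rewrite eqxx.
Qed.

Let sum_B_le w n : (((\sum_(0 <= k < n) B k w) `^ p)%:E <= D w)%E.
Proof.
apply: (@le_trans _ _ (\sum_(0 <= k < n) (B k w `^ p)%:E)%E).
  by rewrite sumEFin lee_fin powR_sum_subadditive// => k; exact: nrm1_ge0.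
by apply: nneseries_lim_ge => k _ _; rewrite lee_fin powR_ge0.
Qed.

Let cvg_sum_B w : summable_paths w -> cvgn (series (fun k => B k w)).
Proof.
move=> Dw; apply: nondecreasing_is_cvgn.
  apply/nondecreasing_seqP => n; rewrite /series/= big_nat_recr//= lerDl.
  exact: nrm1_ge0.
have Dfin : D w \is a fin_num by rewrite ge0_fin_numE.
exists (fine (D w) `^ p^-1) => _ [n _ <-].
have s0 : 0 <= series (fun k => B k w) n by apply: sumr_ge0 => k _; exact: nrm1_ge0.
rewrite -[leLHS]powRr1// -[X in _ `^ X](mulfV (lt0r_neq0 p0)) powRrM.
rewrite le_powR ?powR_ge0 ?invr_ge0 ?(ltW p0)//.
by rewrite -lee_fin fineK//; exact: sum_B_le.
Qed.

Lemma bprod_cvg0 w : summable_paths w -> nrm1 (bprod A (words n w)) @[n --> \oo] --> 0.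
Proof. by move=> /cvg_sum_B /cvg_series_cvg_0. Qed.

Let words_rcons n (w : seqspace R) : words n.+1 w = words n w ++ [:: (w n.*2, w n.*2.+1)].
Proof. by rewrite /words mkseqS cats1. Qed.

(** The new block sits at the right end and acts first, so the two iterates differ by a matrix
    product applied to the bounded vector [bstep A b e 0]. *)
Let ZS v n w : (forall e, nrm1 (bstep A b e 0) <= v) ->
  nrm1 (Z n.+1 w - Z n w) <= v * B n w.
Proof.
move=> vP; rewrite /Z words_rcons bmap_cat bmapB subr0.
by rewrite (le_trans (nrm1M _ _))// mulrC ler_wpM2r ?nrm1_ge0//; exact: vP.
Qed.

Let Z_le v n w : (forall e, nrm1 (bstep A b e 0) <= v) ->
  nrm1 (Z n w) <= v * \sum_(0 <= k < n) B k w.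
Proof.
move=> vP; elim: n => [|n IHn]; first by rewrite big_geq// mulr0 /Z /= nrm1_0.
rewrite big_nat_recr//= mulrDr (le_trans (nrm1_trig _ (Z n w)))//.
by rewrite lerD// ZS.
Qed.

Let Z0 w : Z 0 w = 0. Proof. by []. Qed.

Let Z_cvg w i j : summable_paths w -> cvgn (fun n => Z n w i j).
Proof.
move=> Dw; have [v v0 vP] := bstep0_bounded b hA.
have -> : (fun n => Z n w i j) = series (fun n => (Z n.+1 w - Z n w) i j).
  apply/funext => n; rewrite /series/=.
  rewrite (eq_bigr (fun k => Z k.+1 w i j - Z k w i j)); last by move=> k _; rewrite !mxE.
  by rewrite (telescope_sumr (fun k => Z k w i j))// Z0 mxE subr0.
apply: normed_cvg; apply: (@series_le_cvg _ _ (fun k => v * B k w)).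
- by move=> n; exact: normr_ge0.
- by move=> n; rewrite mulr_ge0 ?nrm1_ge0// ltW.
- by move=> n; rewrite (le_trans (normr_le_nrm1 _ i j))// ZS.
- by apply: is_cvg_seriesZ; exact: cvg_sum_B.
Qed.

(* On [summable_paths] this is the limit of the backward iterates; [limn_esup]
   and [fine] only serve to make it total and measurable. *)
Definition limit_state (w : seqspace R) : borelM R d 1 :=
  \matrix_(i, j) fine (limn_esup (fun n => (bmap A b (words n w) 0 i j)%:E)).

Lemma measurable_limit_state : measurable_fun setT limit_state.
Proof.
apply: measurable_borelM => i j.
have -> : (fun w => limit_state w i j) =
    (fun w => fine (limn_esup (fun n => (bmap A b (words n w) 0 i j)%:E))).
  by apply/funext => w; rewrite mxE.
apply: (measurableT_comp (@fine_measurable R setT measurableT)).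
apply: measurable_fun_limn_esup => n; apply/measurable_EFinP.
apply: mx_measurable_bmap; first exact: measurable_id.
exact: mx_measurable_cst.
Qed.

Let limit_stateE w (z : 'cV[R]_d) :
  (forall i j, Z n w i j @[n --> \oo] --> z i j) -> limit_state w = z.
Proof.
move=> Zz; apply/matrixP => i j; rewrite mxE.
have Zz' : (Z n w i j)%:E @[n --> \oo] --> (z i j)%:E.
  by apply/fine_cvgP; split; [exact: nearW|exact: Zz].
by rewrite (cvg_limn_einf_sup Zz').2.
Qed.

Lemma limit_state_cvg w i j : summable_paths w ->
  bmap A b (words n w) 0 i j @[n --> \oo] --> limit_state w i j.
Proof.
move=> Dw; pose z : 'cV[R]_d := \matrix_(i, j) limn (fun n => Z n w i j).
have Zz k l : Z n w k l @[n --> \oo] --> z k l by rewrite mxE; exact: Z_cvg.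
by rewrite (limit_stateE Zz).
Qed.

Lemma bmap_cvg w x i j : summable_paths w ->
  bmap A b (words n w) x i j @[n --> \oo] --> limit_state w i j.
Proof.
move=> Dw; apply/cvgrPdist_lt => e e0.
have /cvgrPdist_lt/(_ (e / 2)) Zz := @limit_state_cvg w i j Dw.
have : nrm1 (bprod A (words n w)) * nrm1 x @[n --> \oo] --> 0.
  by rewrite -[X in _ --> X](mul0r (nrm1 x)); apply: cvgMr_tmp; exact: bprod_cvg0.
move=> /cvgrPdist_lt/(_ (e / 2)) Bz.
near=> n.
have -> : bmap A b (words n w) x i j =
    bmap A b (words n w) 0 i j + (bprod A (words n w) *m x) i j.
  by rewrite bmapE mxE addrC.
rewrite opprD addrA (le_lt_trans (ler_normB _ _))// (splitr e) ltrD//.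
  by near: n; apply: Zz; rewrite divr_gt0.
rewrite (le_lt_trans (normr_le_nrm1 _ _ _))// (le_lt_trans (nrm1M _ _))//.
have : `|0 - nrm1 (bprod A (words n w)) * nrm1 x| < e / 2.
  by near: n; apply: Bz; rewrite divr_gt0.
by rewrite sub0r normrN ger0_norm// mulr_ge0 ?nrm1_ge0.
Unshelve. all: by end_near. Qed.

(** The fixed-point equation of the limit: splitting off the first block leaves the limit along the
    shifted path. With [law_splice] this yields invariance. *)
Lemma limit_state_splice (w w' : seqspace R) : summable_paths w' ->
  limit_state (splice 1 w w') = bmap A b (words 1 w) (limit_state w').
Proof.
move=> Dw'; apply: limit_stateE => i j; rewrite -cvg_shiftS.
have -> : (fun n => Z n.+1 (splice 1 w w') i j) =
    (fun n => \sum_k bprod A (words 1 w) i k * Z n w' k j + bmap A b (words 1 w) 0 i j).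
  apply/funext => n; rewrite /Z -[n.+1]add1n words_splice bmap_cat bmapE mxE.
  by congr (_ + _); rewrite mxE.
have -> : bmap A b (words 1 w) (limit_state w') i j =
    \sum_k bprod A (words 1 w) i k * limit_state w' k j + bmap A b (words 1 w) 0 i j.
  by rewrite bmapE mxE; congr (_ + _); rewrite mxE.
apply: cvgD; last exact: cvg_cst.
by apply: cvg_sumr => k; apply: cvgMl_tmp; exact: limit_state_cvg.
Qed.

Definition stationary : probability (borelM R d 1) R := law Q measurable_limit_state.

Lemma stationaryE U : stationary U = Q (limit_state @^-1` U).
Proof. by []. Qed.

Lemma stationary_moment : (\int[stationary]_y (enorm y `^ p)%:E < +oo)%E.
Proof.
have [v v0 vP] := bstep0_bounded b hA.
have menorm : measurable_fun setT (fun y : borelM R d 1 => (enorm y `^ p)%:E).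
  apply/measurable_EFinP; apply: (measurableT_comp (measurable_powR p)).
  by apply: measurable_enorm; exact: mx_measurable_id.
rewrite /stationary integral_law//; last by move=> y; rewrite lee_fin powR_ge0.
apply: (@le_lt_trans _ _ (\int[Q]_w ((v `^ p)%:E * D w))%E); last first.
  rewrite ge0_integralZl_EFin ?powR_ge0//.
  by rewrite lte_mul_pinfty ?lee_fin ?powR_ge0.
apply: ge0_integral_le => [w|||w]; first by rewrite lee_fin powR_ge0.
- by apply: (measurableT_comp menorm); exact: measurable_limit_state.
- exact: emeasurable_funM.
have [Dw|] := ltP (D w) +oo%E; last first.
  by rewrite leye_eq => /eqP ->; rewrite gt0_muley ?leey// lte_fin powR_gt0.
have Dfin : D w \is a fin_num by rewrite ge0_fin_numE.
have Zle n : nrm1 (Z n w) <= v * fine (D w) `^ p^-1.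
  rewrite (le_trans (Z_le n w vP))// ler_wpM2l ?(ltW v0)//.
  rewrite -[leLHS]powRr1 ?sumr_ge0//; last by move=> k _; exact: nrm1_ge0.
  rewrite -[X in _ `^ X](mulfV (lt0r_neq0 p0)) powRrM.
  by rewrite le_powR ?powR_ge0 ?invr_ge0 ?(ltW p0)// -lee_fin fineK// sum_B_le.
have ncvg : nrm1 (Z n w) @[n --> \oo] --> nrm1 (limit_state w).
  apply: cvg_sumr => i; apply: cvg_sumr => j; apply: cvg_norm.
  exact: limit_state_cvg.
have nle : nrm1 (limit_state w) <= v * fine (D w) `^ p^-1.
  rewrite -(cvg_lim _ ncvg)//; apply: limr_le; first exact: cvgP ncvg.
  exact: nearW.
apply: (@le_trans _ _ (((v * fine (D w) `^ p^-1) `^ p)%:E)).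
  by rewrite lee_fin le_powR ?enorm_ge0 ?(ltW p0)// (le_trans (enorm_le_nrm1 _)).
rewrite powRM ?powR_ge0 ?(ltW v0)// -powRrM mulVf ?gt_eqF// powRr1 ?fine_ge0//.
by rewrite EFinM fineK.
Qed.

Lemma stationary_support C : (forall n w, nrm1 (bmap A b (words n w) 0) <= C) ->
  stationary [set y | (C < nrm1 y)%R] = 0%E.
Proof.
move=> ZC; rewrite stationaryE.
apply: (@subset_measure0 _ _ _ Q _ (~` summable_paths)) summable_paths_ae => //.
- have := measurable_nrm1 (mx_measurable_comp measurable_limit_state).
  move=> mn; rewrite -[X in measurable X]setTI.
  exact: (@measurable_fun_ltr _ _ _ _ (fun=> C) _ _ mn measurableT [set true]).
- by apply: measurableC; exact: measurable_summable_paths.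
- move=> w /= Cw Dw; move: Cw; apply/negP; rewrite -leNgt.
  have ncvg : nrm1 (Z n w) @[n --> \oo] --> nrm1 (limit_state w).
    apply: cvg_sumr => i; apply: cvg_sumr => j; apply: cvg_norm.
    exact: limit_state_cvg.
  rewrite -(cvg_lim _ ncvg)//; apply: limr_le; first exact: cvgP ncvg.
  by apply: nearW => n; exact: ZC.
Qed.

Lemma stationary_invariant : block_invariant A b Q stationary.
Proof.
move=> U mU; pose S (z : seqspace R * borelM R d 1) : borelM R d 1 :=
  bmap A b (words 1 z.1) z.2.
have mS : measurable_fun setT S := measurable_step_swap A b 1.
have mSU : measurable (S @^-1` U) by rewrite -[X in measurable X]setTI; exact: mS.
pose h (x : borelM R d 1) : \bar R := Q [set w | U (bmap A b (words 1 w) x)].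
have mh : measurable_fun setT h.
  have := @measurable_fun_ysection _ _ _ _ R Q _ mSU.
  by apply: eq_measurable_fun => x _; congr (Q _); apply/seteqP; split=> w; rewrite /ysection/= inE.
refine (etrans (integral_law Q measurable_limit_state mh (fun x => measure_ge0 _ _)) _).
rewrite stationaryE.
have mZU : measurable (limit_state @^-1` U).
  by rewrite -[X in measurable X]setTI; exact: measurable_limit_state.
rewrite (law_splice Q_cylinder 1 mZU).
set E := [set z | _]; have mE : measurable (E : set (seqspace R * seqspace R)).
  rewrite /E -[X in measurable X]setTI; exact: (measurable_splice 1).
refine (esym (etrans (product_measureC Q Q mE) _)).
transitivity (\int[Q]_w' Q (ysection E w'))%E; first by [].
apply/esym.
(* The fixed-point equation holds on [summable_paths] only, so the integrands agree just almost
   everywhere. *)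
apply: ge0_ae_eq_integral => //.
- exact: (measurableT_comp mh measurable_limit_state).
- exact: (@measurable_fun_ysection _ _ _ _ R Q _ mE).
exists (~` summable_paths); split.
- by apply: measurableC; exact: measurable_summable_paths.
- exact: summable_paths_ae.
- move=> w' /= + Dw'; apply => _; congr (Q _).
  apply/seteqP; split=> w; rewrite /ysection/= inE /E /= => Uw.
    by rewrite limit_state_splice.
  by move: Uw; rewrite limit_state_splice.
Qed.

End Stationary.

(** For probabilities, complements turn the inequality on open sets into the opposite one on closed
    sets. An open [V] is the increasing union of the closed sets of points at distance at least 1 /
    (k + 1) from its complement, so equality holds on open sets, which form a generating
    pi-system. *)
Lemma probability_unique_open (R : realType) m n (mu nu : probability (borelM R m n) R) :
  (forall V : set 'M[R]_(m, n), open V -> (mu V <= nu V)%E) ->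
  forall U : set (borelM R m n), measurable U -> nu U = mu U.
Proof.
move=> mu_le.
have mopen (V : set 'M[R]_(m, n)) : open V -> measurable (V : set (borelM R m n)).
  by move=> oV; exact: sub_sigma_algebra.
have nu_le (V : set 'M[R]_(m, n)) : open V -> (nu (~` V) <= mu (~` V))%E.
  move=> oV; rewrite !probability_setC; [|exact: mopen..].
  by rewrite leeB// mu_le.
have eq_open (V : set 'M[R]_(m, n)) : open V -> nu V = mu V.
  move=> oV; apply/eqP; rewrite eq_le mu_le// andbT.
  pose O (k : nat) : set 'M[R]_(m, n) := \bigcup_(z in ~` V) ball z k.+1%:R^-1.
  have oO k : open (O k) by apply: bigcup_open => z _; exact: ball_open.
  have mO k : measurable (~` O k : set (borelM R m n)).
    by apply: measurableC; exact: mopen.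
  have VE : V = \bigcup_k ~` O k.
    apply/seteqP; split=> [y Vy|y [k _ nO]]; last first.
      apply: contrapT => nVy; apply: nO; exists y => //.
      by apply: ballxx; rewrite invr_gt0.
    move: oV; rewrite openE => /(_ _ Vy)/nbhs_ballP[e /= e0 eV].
    exists (Num.truncn e^-1) => // -[z nVz /ball_sym zy]; apply: nVz; apply: eV.
    apply: le_ball zy; rewrite -[leRHS]invrK lef_pV2 ?posrE ?invr_gt0//.
    by rewrite ltW// truncnS_gt.
  have mV : measurable (\bigcup_k ~` O k : set (borelM R m n)) by rewrite -VE; exact: mopen.
  have nd : {homo (fun k => ~` O k) : k l / (k <= l)%N >-> (k <= l)%O}.
    move=> k l kl; apply/subsetPset; apply: subsetC => y [z nVz zy]; exists z => //.
    by apply: le_ball zy; rewrite lef_pV2 ?posrE// ler_nat.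
  have cv := @nondecreasing_cvg_mu _ (borelM R m n) R nu _ mO mV nd.
  rewrite [in leLHS]VE -(cvg_lim _ cv)//; apply: lime_le; first exact: cvgP cv.
  apply: nearW => k /=; rewrite (le_trans (nu_le _ (oO k)))// le_measure ?inE//.
    exact: mopen.
  by move=> y ny; rewrite VE; exists k.
apply: (@measure_unique _ R (borelM R m n) (@open 'M[R]_(m, n)) (fun=> setT)) => //.
- by move=> U V oU oV; exact: openI.
- by move=> _; exact: openT.
- by apply/seteqP; split=> // x _; exists 0%N.
- by move=> _; rewrite [X in (X < _)%E](_ : _ = 1%E) ?ltry//; exact: probability_setT.
Qed.

(** * Uniqueness of the invariant law *)

Section Uniqueness.
Context {R : realType} {d : nat}.
Variables (A : bool -> 'M[R]_d) (b : bool -> 'cV[R]_d).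
Hypothesis hA : forall i, hurwitz (A i).
Variables (Q : probability (seqspace R) R) (m : bool -> set R -> \bar R).
Hypothesis Q_cylinder : forall N U, (forall i, measurable (U i)) ->
  Q (cylinder N U) = (\prod_(0 <= i < N) m (odd i) (U i))%E.
Variable p : R.
Hypothesis p01 : 0 < p <= 1.
Hypothesis moments_finite : (\sum_(0 <= n <oo) moment A Q p n < +oo)%E.
Variable nu : probability (borelM R d 1) R.
Hypothesis nu_inv : block_invariant A b Q nu.

Let E (V : set 'cV[R]_d) n : set (seqspace R * borelM R d 1) :=
  [set z | V (bmap A b (words n z.1) z.2)].

Let measurable_E V n : open V -> measurable (E V n).
Proof.
move=> oV; rewrite -[X in measurable X]setTI.
by apply: (measurable_step_swap A b n) => //; exact: sub_sigma_algebra.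
Qed.

Let measure_E V n : open V -> (Q \x nu)%E (E V n) = nu V.
Proof.
move=> oV; have mV : measurable (V : set (borelM R d 1)) by exact: sub_sigma_algebra.
refine (etrans (product_measureC Q nu (measurable_E n oV)) _).
transitivity (\int[nu]_x Q (ysection (E V n) x))%E; first by [].
have mind : measurable_fun setT (fun y : borelM R d 1 => (\1_V y : R)%:E).
  by apply/measurable_EFinP; exact: measurable_indic.
have ind0 (y : borelM R d 1) : (0 <= (\1_V y : R)%:E)%E by rewrite lee_fin.
transitivity (\int[nu]_x (\1_V x : R)%:E)%E; last by rewrite integral_indic// setIT.
refine (etrans _ (integral_step Q_cylinder nu_inv n mind ind0)).
apply: eq_integral => x _.
have mEx : measurable (ysection (E V n) x) by apply: measurable_ysection; exact: measurable_E.
transitivity (\int[Q]_w (\1_(ysection (E V n) x) w : R)%:E)%E.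
  by refine (esym (etrans (integral_indic _ measurableT mEx) _)); rewrite setIT.
apply: eq_integral => w _; rewrite !indicE; congr ((nat_of_bool _)%:R)%:E.
by rewrite mem_ysection; apply/idP/idP; rewrite !inE.
Qed.

(* Backward iterates converge to [limit_state] from every initial state, so for an
   open set [V], Fatou's lemma bounds the law of the limit by [nu V]; see
   [probability_unique_open]. *)
Lemma stationary_unique (U : set (borelM R d 1)) : measurable U ->
  nu U = stationary A b Q U.
Proof.
apply: probability_unique_open => V oV.
have mV : measurable (V : set (borelM R d 1)) by exact: sub_sigma_algebra.
have mS : measurable (summable_paths A p) by exact: measurable_summable_paths.
have mLV : measurable (limit_state A b @^-1` V).
  by rewrite -[X in measurable X]setTI; exact: measurable_limit_state.
pose G := (limit_state A b @^-1` V) `&` summable_paths A p.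
have mG : measurable G by exact: measurableI.
have QG : Q (limit_state A b @^-1` V) = Q G.
  rewrite /G (measureDI Q mLV mS) [X in (X + _)%E](_ : _ = 0%E) ?add0e//.
  apply: (@subset_measure0 _ _ _ Q _ (~` summable_paths A p)).
  - exact: measurableD.
  - exact: measurableC.
  - by move=> w [].
  - exact: summable_paths_ae.
have -> : stationary A b Q V = Q (limit_state A b @^-1` V) by [].
rewrite QG.
(* Fatou's lemma for sets: the union of the [F N] is the lower limit of the events [E V n], each of
   measure [nu V] by invariance, and it contains every path whose limit lies in [V]. *)
pose F N := \bigcap_(n in [set n | (N <= n)%N]) E V n.
have mF N : measurable (F N) by apply: bigcap_measurableType => n _; exact: measurable_E.
have mUF : measurable (\bigcup_N F N) by exact: bigcupT_measurable.
have nd : {homo F : k l / (k <= l)%N >-> (k <= l)%O}.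
  by move=> k l kl; apply/subsetPset => z Fz n /= ln; apply: Fz; exact: leq_trans ln.
have cv := @nondecreasing_cvg_mu _ _ R (Q \x nu)%E _ mF mUF nd.
have GF : G `*` setT `<=` \bigcup_N F N.
  move=> [w x] [[/= Vw Sw] _].
  have : bmap A b (words n w) x @[n --> \oo] --> (limit_state A b w : 'cV[R]_d).
    by apply/cvg_mxP => i j; apply: (bmap_cvg hA p01).
  move=> /(_ V); case; first by apply: open_nbhs_nbhs; split.
  by move=> N _ NP; exists N => // n Nn; exact: NP.
apply: (@le_trans _ _ ((Q \x nu)%E (G `*` setT))).
  by rewrite product_measure1E// [X in (_ * X)%E]probability_setT mule1.
apply: (@le_trans _ _ ((Q \x nu)%E (\bigcup_N F N))).
  by rewrite le_measure ?inE//; exact: measurableX.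
rewrite -(cvg_lim _ cv)//; apply: lime_le; first exact: cvgP cv.
apply: nearW => N /=; rewrite -(measure_E N oV) le_measure ?inE//; first exact: measurable_E.
by move=> z; apply => /=.
Qed.

End Uniqueness.

Lemma lee_expe (R : realDomainType) (x y : \bar R) n :
  (0 <= x)%E -> (x <= y)%E -> (x ^+ n <= y ^+ n)%E.
Proof.
move=> x0 xy; elim: n => [|n IHn]; first by rewrite !expe0.
by rewrite !expeS lee_pmul ?expe_ge0.
Qed.

(** * Contraction of small moments *)

Section SmallMoments.
Context {R : realType} {d : nat}.
Variable A : bool -> 'M[R]_d.
Hypothesis hA : forall i, hurwitz (A i).
Variables (Q : probability (seqspace R) R) (m : bool -> set R -> \bar R).
Hypothesis Q_cylinder : forall N U, (forall i, measurable (U i)) ->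
  Q (cylinder N U) = (\prod_(0 <= i < N) m (odd i) (U i))%E.
Hypothesis m_itv_gt0 : forall i (s t : R), 0 <= s -> s < t ->
  (0 < m i `]s, t[%classic)%E.

Let measurable_prod_words (phi : R -> R) n : measurable_fun setT phi ->
  measurable_fun setT (fun w : seqspace R => (\prod_(e <- words n w) phi e.1)%:E).
Proof.
move=> mphi; apply/measurable_EFinP; rewrite /words /mkseq.
elim: (iota 0 n) => [|j l IHl].
  rewrite (_ : (fun _ => _) = cst 1); first exact: measurable_cst.
  by apply/funext => w; rewrite /= big_nil.
rewrite (_ : (fun _ => _) = (fun w : seqspace R => phi (w j.*2) *
    \prod_(e <- [seq (w j.*2, w j.*2.+1) | j <- l]) phi e.1)).
  apply: measurable_funM IHl.
  by apply: (measurableT_comp mphi); exact: measurable_coord.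
by apply/funext => w; rewrite /= big_cons.
Qed.

Lemma integral_prod_words (phi : R -> R) n : measurable_fun setT phi ->
  (forall u, 0 <= phi u) ->
  (\int[Q]_w (\prod_(e <- words n w) phi e.1)%:E = (\int[Q]_w (phi (w 0%N))%:E) ^+ n)%E.
Proof.
move=> mphi phi0; have prod0 s : 0 <= \prod_(e <- s) phi (e : R * R).1.
  by rewrite prodr_ge0.
have int0 : (0 <= \int[Q]_w (phi (w 0%N))%:E)%E.
  by apply: integral_ge0 => w _; rewrite lee_fin.
elim: n => [|n IHn].
  transitivity (\int[Q]_w (cst 1%E w))%E.
    by apply: eq_integral => w _; rewrite big_nil.
  by rewrite integral_cst// mul1e [LHS]probability_setT expe0.
have mprod := measurable_prod_words n.+1 mphi.
refine (etrans (integral_splice Q_cylinder 1 mprod _) _); first by move=> w; rewrite lee_fin.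
transitivity (\int[Q]_w \int[Q]_w' ((phi (w 0%N))%:E * (\prod_(e <- words n w') phi e.1)%:E))%E.
  apply: eq_integral => w _; apply: eq_integral => w' _.
  by rewrite -EFinM -[n.+1]add1n words_splice big_cat /= big_seq1.
transitivity (\int[Q]_w ((phi (w 0%N))%:E * (\int[Q]_w (phi (w 0%N))%:E) ^+ n))%E.
  apply: eq_integral => w _; rewrite ge0_integralZl_EFin ?IHn// => [w' _|].
    by rewrite lee_fin.
  exact: measurable_prod_words.
rewrite ge0_integralZr ?expeS//; last 2 first.
- by move=> w _; rewrite lee_fin.
- by rewrite expe_ge0.
by apply/measurable_EFinP; apply: (measurableT_comp mphi); exact: measurable_coord.
Qed.

Let measurable_coord0 (U : set R) : measurable U ->
  measurable [set w : seqspace R | U (w 0%N)].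
Proof. by move=> mU; rewrite -[X in measurable X]setTI; exact: measurable_coord. Qed.

Lemma Q_coord0 U : measurable U -> Q [set w | U (w 0%N)] = m false U.
Proof.
move=> mU; have := @Q_cylinder 1 (fun=> U) (fun=> mU).
rewrite big_nat1 /= => <-; congr (Q _); apply/seteqP; split=> w /=.
  by move=> Uw [].
exact.
Qed.

(** Integrating [phi + c 1_I <= 1] gives [1 - c m(I)] for a single block, and independence raises
    this to the power [n]. *)
Lemma integral_prod_words_le (phi : R -> R) (c s t : R) n : measurable_fun setT phi ->
  (forall u, 0 <= phi u <= 1) -> 0 <= c <= 1 -> 0 <= s -> s < t ->
  (forall u, s < u < t -> phi u <= 1 - c) ->
  (\int[Q]_w (\prod_(e <- words n w) phi e.1)%:E
     <= ((1 - c * fine (m false `]s, t[%classic)) ^+ n)%:E)%E.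
Proof.
move=> mphi phi01 /andP[c0 c1] s0 st phic; set I := `]s, t[%classic.
have phi0 u : 0 <= phi u by case/andP: (phi01 u).
rewrite integral_prod_words// EFin_expe.
have mI : measurable [set w : seqspace R | I (w 0%N)].
  by apply: measurable_coord0; exact: measurable_itv.
have mE : m false I = Q [set w | I (w 0%N)] by rewrite Q_coord0//; exact: measurable_itv.
have mfin : m false I \is a fin_num by rewrite mE fin_num_measure.
apply: lee_expe; first by apply: integral_ge0 => w _; rewrite lee_fin.
have mphi' : measurable_fun setT (fun w : seqspace R => (phi (w 0%N))%:E).
  by apply/measurable_EFinP; apply: (measurableT_comp mphi); exact: measurable_coord.
have mind : measurable_fun setT (fun w : seqspace R =>
    (\1_[set w : seqspace R | I (w 0%N)] w : R)%:E).
  by apply/measurable_EFinP; exact: measurable_indic.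
rewrite EFinB EFinM fineK// leeBrDr ?fin_numM// mE.
have -> : (c%:E * Q [set w | I (w 0%N)] =
    \int[Q]_w (c%:E * (\1_[set w : seqspace R | I (w 0%N)] w : R)%:E))%E.
  rewrite ge0_integralZl_EFin//; congr (_ * _)%E.
  by refine (esym (etrans (integral_indic _ measurableT mI) _)); rewrite setIT.
rewrite -ge0_integralD//; last 3 first.
- by move=> w _; rewrite lee_fin.
- by move=> w _; rewrite -EFinM lee_fin mulr_ge0.
- by apply: emeasurable_funM.
apply: integral_le_cst => [w||w].
- by rewrite -EFinM -EFinD lee_fin addr_ge0// mulr_ge0.
- by apply: emeasurable_funD => //; exact: emeasurable_funM.
rewrite -EFinM -EFinD lee_fin indicE; case: (boolP (w \in _)) => [|_].
  by rewrite inE /= /I/= in_itv/= => /phic; rewrite mulr1; lra.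
by rewrite mulr0 addr0; case/andP: (phi01 (w 0%N)).
Qed.

(* A single long stay in state 0 makes the whole product small, because the
   factors on both sides of it are bounded words. *)
Lemma moment1_lt1 C : (forall s, nrm1 (bprod A s) <= C) ->
  exists n, (moment A Q 1 n < 1)%E.
Proof.
move=> bndC; pose K := `|C| + 1.
have K0 : 0 < K by rewrite ltr_wpDl.
have bndK s : nrm1 (bprod A s) <= K.
  by rewrite (le_trans (bndC s))// (le_trans (ler_norm C))// lerDl.
(* The small block stands between two words of norm at most [K], so this threshold makes the whole
   product at most 1 / 4. *)
have [|T T0 TP] := @bmat_small R d A hA (4 * K * K)^-1; first by rewrite invr_gt0 !mulr_gt0.
(* The product of the [phi e.1] is the indicator that every stay in state 0 is shorter than [T]; its
   mean is at most [(1 - r) ^+ n]. *)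
pose phi (u : R) : R := if dur u < T then 1 else 0.
have mphi : measurable_fun setT phi.
  apply: measurable_fun_ifT => //.
  by apply: measurable_fun_ltr => //; exact: measurable_dur.
have phi01 u : 0 <= phi u <= 1 by rewrite /phi; case: ifP; rewrite ?lexx ler01.
have key s : nrm1 (bprod A s) <= 4^-1 + K * \prod_(e <- s) phi e.1.
  have [/hasP[e es Te]|/hasPn bad] := boolP (has (fun e => T <= dur e.1) s).
    have g0 : 0 <= K * \prod_(e <- s) phi e.1.
      by rewrite mulr_ge0 ?(ltW K0)// prodr_ge0// => e' _; case/andP: (phi01 e'.1).
    apply: (@le_trans _ _ 4^-1); last by rewrite lerDl.
    case/splitPr: es => s1 s2; rewrite bprod_cat /=.
    have -> : 4^-1 = K * ((4 * K * K)^-1 * K) by field; rewrite gt_eqF.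
    rewrite (le_trans (nrm1M _ _))// ler_pM ?nrm1_ge0// (le_trans (nrm1M _ _))//.
    by rewrite ler_pM ?nrm1_ge0// TP.
  rewrite big_seq big1 ?mulr1 => [|e /bad]; first by rewrite (le_trans (bndK s))// lerDr.
  by rewrite -ltNge /phi => ->.
pose r := fine (m false `]T, (T + 1)[%classic).
have TT : T < T + 1 by rewrite ltrDl.
have mint : m false `]T, (T + 1)[%classic = Q [set w | `]T, (T + 1)[%classic (w 0%N)].
  by rewrite Q_coord0.
have mI : measurable [set w : seqspace R | `]T, (T + 1)[%classic (w 0%N)].
  by apply: measurable_coord0; exact: measurable_itv.
have rE : m false `]T, (T + 1)[%classic = r%:E by rewrite /r fineK// mint fin_num_measure.
have r0 : 0 < r by rewrite -lte_fin -rE; apply: m_itv_gt0 => //; exact: ltW.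
have r1 : r <= 1 by rewrite -lee_fin -rE mint probability_le1.
have [n nK] : exists n, K * (1 - r) ^+ n < 2^-1.
  have /cvgrPdist_lt/(_ (2^-1 / K)) : (1 - r) ^+ n @[n --> \oo] --> 0.
    by apply: cvg_expr; rewrite ger0_norm ?subr_ge0// ltrBlDr ltrDl.
  case; first by rewrite divr_gt0.
  move=> n _ /(_ n (leqnn n)) /=; rewrite sub0r normrN ger0_norm ?exprn_ge0 ?subr_ge0//.
  by rewrite ltr_pdivlMr// mulrC => ?; exists n.
exists n; apply: (@le_lt_trans _ _ (4^-1 + K * (1 - r) ^+ n)%:E); last first.
  by rewrite lte_fin; lra.
have prod0 (w : seqspace R) : 0 <= \prod_(e <- words n w) phi e.1.
  by rewrite prodr_ge0// => e _; case/andP: (phi01 e.1).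
have mprod := measurable_prod_words n mphi.
apply: (@le_trans _ _ (\int[Q]_w (4^-1%:E + K%:E * (\prod_(e <- words n w) phi e.1)%:E))%E).
  apply: ge0_integral_le => [w|||w].
  - by rewrite lee_fin powR_ge0.
  - exact: measurable_nrm1_bprod.
  - by apply: emeasurable_funD => //; exact: emeasurable_funM.
  by rewrite -EFinM -EFinD lee_fin powRr1 ?nrm1_ge0.
rewrite ge0_integralD//; last 2 first.
- by move=> w _; rewrite -EFinM lee_fin mulr_ge0// ltW.
- exact: emeasurable_funM.
rewrite integral_cst// [X in (_ * X + _)%E]probability_setT mule1 [leRHS]EFinD.
apply: leeD2l; rewrite ge0_integralZl_EFin//; last 2 first.
- by move=> w _; rewrite lee_fin.
- exact: ltW.
rewrite [leRHS]EFinM.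
apply: lee_wpmul2l; first by rewrite lee_fin ltW.
rewrite -[in leRHS](mul1r r).
apply: integral_prod_words_le => //; [by rewrite ler01 lexx|exact: ltW|].
move=> u /andP[Tu _]; have u0 : 0 < u by exact: lt_trans Tu.
by rewrite subrr /phi durE// ltNge (ltW Tu).
Qed.

Definition duration (s : seq (R * R)) : R := \sum_(e <- s) (dur e.1 + dur e.2).

(** The event that [n] blocks have not yet contracted at rate [delta] per unit of time. The order is
    chronological, hence [rev], because the Lyapunov exponent speaks of trajectories;
    [integral_reversal] returns to words in [moment_lt1]. *)
Definition late_contraction (delta : R) n : set (seqspace R) :=
  [set w | expR (- delta * duration (words n w)) < nrm1 (bprod A (rev (words n w)))].

Lemma measurable_late_contraction delta n : measurable (late_contraction delta n).
Proof.
have mdur : measurable_fun setT (fun w : seqspace R => duration (words n w)).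
  rewrite /duration /words /mkseq; elim: (iota 0 n) => [|j l IHl].
    rewrite (_ : (fun _ => _) = cst 0); first exact: measurable_cst.
    by apply/funext => w; rewrite /= big_nil.
  rewrite (_ : (fun _ => _) = (fun w : seqspace R => (dur (w j.*2) + dur (w j.*2.+1)) +
      \sum_(e <- [seq (w j.*2, w j.*2.+1) | j <- l]) (dur e.1 + dur e.2))).
    apply: measurable_funD IHl; apply: measurable_funD;
      by apply: (measurableT_comp measurable_dur); exact: measurable_coord.
  by apply/funext => w; rewrite /= big_cons.
rewrite -[X in measurable X]setTI.
apply: (@measurable_fun_ltr _ _ _ _ _ _ _ (measurable_nrm1 (mx_measurable_bprod_rev A n))
  measurableT [set true]) => //.
apply: (measurableT_comp (@measurable_expR R)).
by apply: measurable_funM.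
Qed.

(* The exponent [p = 1 / n] is small enough that the [p]-th power of the norm of
   [n] blocks is bounded uniformly in [n], and large enough that
   [exp (- delta p duration)] has mean at most some [q < 1] uniformly in [n]. *)
Lemma moment_lt1 delta : 0 < delta ->
  Q (late_contraction delta n) @[n --> \oo] --> 0%E ->
  exists n, (0 < n)%N /\ (moment A Q n%:R^-1 n < 1)%E.
Proof.
move=> delta0 badc.
have [C C0 CP] := bmat_bounded hA.
(* Bounds the power 1 / n of [nrm1 1%:M * C ^+ n] for every [n]: the second factor becomes [C], and
   adding 1 to the first makes its base at least 1, so that a power at most 1 does not increase
   it. *)
pose K := (nrm1 (1%:M : 'M[R]_d) + 1) * C.
have K0 : 0 < K by rewrite mulr_gt0// ltr_wpDl// nrm1_ge0.
pose r := fine (m false `]1, 2[%classic).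
have mint : m false `]1, 2[%classic = Q [set w | `]1, 2[%classic (w 0%N)].
  by rewrite Q_coord0.
have mI : measurable [set w : seqspace R | `]1, 2[%classic (w 0%N)].
  by apply: measurable_coord0; exact: measurable_itv.
have rE : m false `]1, 2[%classic = r%:E by rewrite /r fineK// mint fin_num_measure.
have r0 : 0 < r by rewrite -lte_fin -rE; apply: m_itv_gt0 => //; lra.
have r1 : r <= 1 by rewrite -lee_fin -rE mint probability_le1.
(* With a = delta / n one has n (1 - exp(- a)) >= n a / (1 + a) >= delta / (1 + delta), so (1 - (1 -
   exp(- a)) r)^n is at most [q] whatever [n >= 1]. *)
pose q := expR (- (r * (delta / (1 + delta)))).
have q1 : q < 1 by rewrite /q -expR0 ltr_expR oppr_lt0 !mulr_gt0// invr_gt0 ltr_wpDl.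
have [n [n0 badn]] : exists n, (0 < n)%N /\ (K%:E * Q (late_contraction delta n) < (1 - q)%:E)%E.
  have fc : fine (Q (late_contraction delta n)) @[n --> \oo] --> (0 : R) by exact: fine_cvg badc.
  have /cvgrPdist_lt/(_ ((1 - q) / K)) := fc; case; first by rewrite divr_gt0// subr_gt0.
  move=> N _ NP; exists N.+1; split=> //; have := NP N.+1 (leqnSn N).
  rewrite /= sub0r normrN ger0_norm ?fine_ge0// ltr_pdivlMr// mulrC => lt.
  rewrite -(fineK (fin_num_measure Q _ (measurable_late_contraction delta N.+1))).
  by rewrite -EFinM lte_fin.
exists n; split=> //; set p := n%:R^-1.
have p0 : 0 < p by rewrite invr_gt0 ltr0n.
have p1 : p <= 1 by rewrite invf_le1 ?ltr0n// ler1n.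
set a := delta * p; have a0 : 0 < a by rewrite mulr_gt0.
pose phi u := expR (- a * dur u).
have mphi : measurable_fun setT phi.
  apply: (measurableT_comp (@measurable_expR R)); apply: measurable_funM => //.
  exact: measurable_dur.
have phi01 u : 0 <= phi u <= 1.
  rewrite expR_ge0/= -expR0 ler_expR mulNr oppr_le0 mulr_ge0 ?(ltW a0)//.
  by rewrite ltW// dur_gt0.
have mbad := measurable_late_contraction delta n.
have powC s : size s = n -> nrm1 (bprod A s) `^ p <= K.
  move=> sn; have H := nrm1_bprod s (ltW C0) CP.
  rewrite (le_trans (le_powR (ltW p0) (nrm1_ge0 _) H))//.
  rewrite powRM ?nrm1_ge0 ?exprn_ge0 ?(ltW C0)// ler_pM ?powR_ge0//.
    set x := nrm1 _; have x0 : 0 <= x by exact: nrm1_ge0.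
    rewrite (@le_trans _ _ ((x + 1) `^ p))// ?le_powR ?(ltW p0)// ?lerDl//.
    rewrite -[leRHS]powRr1 ?addr_ge0//; apply: ler_powR => //.
    by rewrite lerDr.
  by rewrite sn -powR_mulrn ?(ltW C0)// -powRrM mulfV ?powRr1 ?(ltW C0)// pnatr_eq0 -lt0n.
(* Only the stays in state 0 are kept: this weakens the bound but leaves a product of identically
   distributed factors, one per block. *)
have dursub s : expR (- delta * duration s) `^ p <= \prod_(e <- s) phi e.1.
  rewrite -expRM -expR_sum ler_expR /duration.
  rewrite -mulrA [_ * p]mulrC mulrA mulNr -/a mulr_sumr.
  apply: ler_sum => e _; rewrite !mulNr lerN2 ler_wpM2l ?(ltW a0)// lerDl.
  by rewrite ltW// dur_gt0.
have mprod := measurable_prod_words n mphi.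
have prod0 (w : seqspace R) : 0 <= \prod_(e <- words n w) phi e.1.
  by rewrite prodr_ge0// => e _; case/andP: (phi01 e.1).
have mind : measurable_fun setT (fun w : seqspace R => (\1_(late_contraction delta n) w : R)%:E).
  by apply/measurable_EFinP; exact: measurable_indic.
have mpow := measurable_nrm1_bprod A p n.
have pow0 (w : seqspace R) : (0 <= (nrm1 (bprod A (words n w)) `^ p)%:E)%E.
  by rewrite lee_fin powR_ge0.
rewrite /moment -(integral_reversal Q_cylinder n mpow pow0).
apply: (@le_lt_trans _ _ (\int[Q]_w ((\prod_(e <- words n w) phi e.1)%:E +
    K%:E * (\1_(late_contraction delta n) w : R)%:E))%E).
  apply: ge0_integral_le => [w|||w]; first exact: pow0.
  - exact: (measurableT_comp mpow (measurable_reversal n)).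
  - by apply: emeasurable_funD => //; exact: emeasurable_funM.
  rewrite words_reversal -EFinM -EFinD lee_fin indicE.
  case: (boolP (w \in _)) => [_|].
    rewrite mulr1 (le_trans (powC _ _)) ?size_rev ?size_mkseq// lerDr.
    exact: prod0.
  rewrite notin_setE /late_contraction /= => /negP; rewrite -leNgt mulr0 addr0 => le.
  by rewrite (le_trans _ (dursub _))// le_powR ?nrm1_ge0// ltW.
rewrite ge0_integralD//; last 3 first.
- by move=> w _; rewrite lee_fin.
- by move=> w _; rewrite -EFinM lee_fin mulr_ge0// ltW.
- exact: emeasurable_funM.
rewrite ge0_integralZl_EFin ?(ltW K0)//.
have -> : (\int[Q]_w (\1_(late_contraction delta n) w : R)%:E =
    Q (late_contraction delta n))%E.
  by refine (etrans (integral_indic _ measurableT mbad) _); rewrite setIT.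
suff prodq : (\int[Q]_w (\prod_(e <- words n w) phi e.1)%:E <= q%:E)%E.
  have -> : 1%E = (q%:E + (1 - q)%:E)%E :> \bar R by rewrite -EFinD addrC subrK.
  apply: lee_ltD => //; rewrite ge0_fin_numE ?(le_lt_trans prodq (ltry q))//.
  by apply: integral_ge0 => w _; rewrite lee_fin.
have c01 : 0 <= 1 - expR (- a) <= 1.
  rewrite subr_ge0 lerBlDr lerDl expR_ge0 andbT -expR0 ler_expR.
  by rewrite oppr_le0 ltW.
apply: (@le_trans _ _ ((1 - (1 - expR (- a)) * r) ^+ n)%:E).
  apply: integral_prod_words_le => //; first by rewrite ltr1n.
  move=> u /andP[u1 _]; rewrite subKr /phi ler_expR mulNr lerN2 ler_peMr ?(ltW a0)//.
  by rewrite durE ?(ltW u1)// (lt_trans _ u1).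
rewrite lee_fin.
apply: (@le_trans _ _ (expR (- ((1 - expR (- a)) * r)) ^+ n)).
  rewrite lerXn2r ?nnegrE ?expR_ge0//; last by rewrite expR_ge1Dx.
  by rewrite subr_ge0 mulr_ile1 ?(ltW r0)//; case/andP: c01.
rewrite -expRM_natl /q ler_expR mulrN lerN2.
have aE : a * n%:R = delta by rewrite /a /p mulfVK ?pnatr_eq0 -?lt0n.
have ea : a / (1 + a) <= 1 - expR (- a).
  have -> : a / (1 + a) = 1 - (1 + a)^-1 by field; rewrite gt_eqF// addr_gt0.
  by rewrite lerD2l lerN2 expRN lef_pV2 ?posrE ?expR_gt0 ?addr_gt0// expR_ge1Dx.
have da : delta / (1 + delta) <= n%:R * (a / (1 + a)).
  rewrite mulrA [_ * a]mulrC aE ler_wpM2l ?(ltW delta0)// lef_pV2 ?posrE ?addr_gt0//.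
  by rewrite lerD2l -aE ler_peMr ?(ltW a0)// ler1n.
rewrite [leRHS](_ : _ = r * (n%:R * (1 - expR (- a)))); last by ring.
rewrite ler_wpM2l ?(ltW r0)// (le_trans da)//.
by rewrite ler_wpM2l.
Qed.

End SmallMoments.

(** * Infinite moments *)

Section BlockContinuity.
Context {R : realType} {d : nat}.
Variables (A : bool -> 'M[R]_d) (b : bool -> 'cV[R]_d).
Hypothesis hA : forall i, hurwitz (A i).

Lemma expmx_dur_continuous i s (y : 'cV[R]_d) e : 0 < s -> 0 < e ->
  exists2 r, 0 < r & forall s' y', `|s' - s| < r -> nrm1 (y' - y) < r ->
    nrm1 (expmx (dur s' *: A i) *m y' - expmx (dur s *: A i) *m y) < e.
Proof.
move=> s0 e0; have [C C0 CP] := expmx_bounded hA.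
pose c := d%:R * d%:R * (nrm1 y + 1) + 1.
have c0 : 0 < c by rewrite ltr_wpDl// !mulr_ge0// addr_ge0// nrm1_ge0.
have /cvgrPdist_lt/(_ (e / (2 * c))) : expmx (u *: A i) @[u --> s] --> expmx (s *: A i).
  exact: is_derive_continuous (is_derive_expmx (A i) s).
case=> [|r /= r0 rP]; first by rewrite divr_gt0// mulr_gt0.
(* The bound [s] keeps [s'] positive, where [dur] is the identity. *)
exists (Num.min (Num.min r s) (e / (2 * C))).
  by rewrite !lt_min r0 s0 divr_gt0// mulr_gt0.
move=> s' y'; rewrite !lt_min => /andP[/andP[rs' ss'] _] /andP[_ yy'].
have s'0 : 0 < s' by move: ss'; rewrite ltr_norml => /andP[]; lra.
rewrite !durE//.
have -> : expmx (s' *: A i) *m y' - expmx (s *: A i) *m y =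
    expmx (s' *: A i) *m (y' - y) + (expmx (s' *: A i) - expmx (s *: A i)) *m y.
  by rewrite mulmxBr mulmxBl addrA subrK.
rewrite (le_lt_trans (nrm1D _ _))// (splitr e); apply: ltrD.
  rewrite (le_lt_trans (nrm1M _ _))// (@le_lt_trans _ _ (C * nrm1 (y' - y)))//.
    by rewrite ler_wpM2r ?nrm1_ge0// CP// ltW.
  by rewrite mulrC -ltr_pdivlMr// -mulrA -invfM.
have Ess' : `|expmx (s' *: A i) - expmx (s *: A i)| < e / (2 * c).
  by rewrite distrC; apply: rP; rewrite /ball_/= distrC.
rewrite (le_lt_trans (nrm1M _ _))//.
rewrite (@le_lt_trans _ _ (d%:R * d%:R * `|expmx (s' *: A i) - expmx (s *: A i)| * (nrm1 y + 1)))//.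
  by rewrite ler_pM ?nrm1_ge0 ?nrm1_le_norm// lerDl.
rewrite (@le_lt_trans _ _ (c * `|expmx (s' *: A i) - expmx (s *: A i)|))//.
  rewrite /c mulrDl mul1r; set N := `|_|; have N0 : 0 <= N by exact: normr_ge0.
  lra.
by rewrite mulrC -ltr_pdivlMr// -mulrA -invfM.
Qed.

Lemma bprod_rev_words_continuous n (t : nat -> R) (x : 'cV[R]_d) e :
  (forall j, (j < n.*2)%N -> 0 < t j) -> 0 < e ->
  exists2 r, 0 < r & forall w x', (forall j, (j < n.*2)%N -> `|w j - t j| < r) ->
    nrm1 (x' - x) < r ->
    nrm1 (bprod A (rev (words n w)) *m x' - bprod A (rev (words n t)) *m x) < e.
Proof.
elim: n e => [|n IHn] e tpos e0.
  by exists e => // w x' _ xx'; rewrite /= !mul1mx.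
have revS w : bprod A (rev (words n.+1 w)) =
    bmat A (w n.*2, w n.*2.+1) *m bprod A (rev (words n w)).
  by rewrite /words mkseqS rev_rcons.
have lt2S j : (j < n.*2)%N -> (j < n.+1.*2)%N.
  by move=> jn; apply: (leq_trans jn); rewrite leq_double.
have t0 : 0 < t n.*2 by apply: tpos; rewrite doubleS.
have t1 : 0 < t n.*2.+1 by apply: tpos; rewrite doubleS.
pose y := bprod A (rev (words n t)) *m x.
have [r1 r10 r1P] := expmx_dur_continuous true (expmx (dur (t n.*2) *: A false) *m y) t1 e0.
have [r2 r20 r2P] := expmx_dur_continuous false y t0 r10.
have [|r3 r30 r3P] := IHn r2 _ r20.
  by move=> j jn; apply: tpos; exact: lt2S.
exists (Num.min r1 (Num.min r2 r3)); first by rewrite !lt_min r10 r20 r30.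
move=> w x' wt; rewrite !lt_min => /and3P[_ _ xx'].
rewrite !revS /bmat /= -!mulmxA; apply: r1P.
  by have := wt n.*2.+1; rewrite doubleS ltnS leqnn => /(_ isT); rewrite lt_min => /andP[].
apply: r2P.
  by have := wt n.*2; rewrite doubleS !ltnS leqnSn => /(_ isT); rewrite !lt_min => /and3P[].
apply: r3P => // j jn; have := wt j (lt2S j jn).
by rewrite !lt_min => /and3P[].
Qed.

Lemma bstep_continuous s u x e : 0 < s -> 0 < u -> 0 < e ->
  exists2 r, 0 < r & forall s' u', `|s' - s| < r -> `|u' - u| < r ->
    nrm1 (bstep A b (s', u') x - bstep A b (s, u) x) < e.
Proof.
move=> s0 u0 e0; pose y := flow A b false (dur s) x.
have [r1 r10 r1P] := expmx_dur_continuous true (y - b true) u0 e0.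
have [r2 r20 r2P] := expmx_dur_continuous false (x - b false) s0 r10.
exists (Num.min r1 r2); first by rewrite lt_min r10.
move=> s' u'; rewrite !lt_min => /andP[_ ss'] /andP[uu' _].
have DB (v w z : 'cV[R]_d) : v + z - (w + z) = v - w.
  by rewrite opprD addrACA subrr addr0.
rewrite /bstep /= [flow A b true _ _]/flow [flow A b true _ _ in X in _ - X]/flow DB.
apply: r1P => //; rewrite /y /flow !DB.
by apply: r2P => //; rewrite subrr nrm1_0.
Qed.

(** Decay excludes a state fixed by all blocks: a long second stay forces [x = b true]; then every
    first stay must lead to [b true], and a long one forces [b true = b false]. *)
Lemma bstep_moves x : b false != b true ->
  exists s u, [/\ 0 < s, 0 < u & bstep A b (s, u) x != x].
Proof.
move=> bb; apply: contrapT => /forallNP nex.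
have fixd s u : 0 < s -> 0 < u -> bstep A b (s, u) x = x.
  move=> s0 u0; apply/eqP; apply/negPn/negP => H.
  by apply: (nex s); exists u.
have vanish (y z : 'cV[R]_d) i :
    (forall t, 0 < t -> expmx (t *: A i) *m y = z) -> z = 0.
  move=> Hy; apply: nrm1_eq0; apply/eqP; rewrite eq_le nrm1_ge0 andbT.
  apply/ler_addgt0Pr => e e0; rewrite add0r.
  have [|T T0 TP] := expmx_small hA (e := e / (nrm1 y + 1)).
    by rewrite divr_gt0// ltr_wpDl// nrm1_ge0.
  rewrite -(Hy T T0) (le_trans (nrm1M _ _))//.
  rewrite (@le_trans _ _ (e / (nrm1 y + 1) * nrm1 y))//.
    by rewrite ler_wpM2r ?nrm1_ge0// TP.
  rewrite mulrAC ler_pdivrMr ?ltr_wpDl ?nrm1_ge0// ler_wpM2l ?(ltW e0)//.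
  by rewrite lerDl.
have xb1 : x - b true = 0.
  apply: (vanish (flow A b false 1 x - b true) _ true) => t t0.
  have /(congr1 (fun z => z - b true)) := fixd 1 t ltr01 t0.
  by rewrite /bstep /= !durE// [flow A b true _ _]/flow addrK.
have b10 : b true - b false = 0.
  apply: (vanish (x - b false) _ false) => t t0.
  have /(congr1 (fun z => z - b true)) := fixd t 1 t0 ltr01.
  rewrite /bstep /= !durE// [flow A b true _ _]/flow addrK xb1 => /(congr1 (mulmx (invmx (expmx (1 *: A true))))).
  rewrite mulmx0 mulmxA mulVmx ?expmx_unit// mul1mx.
  by move=> /eqP; rewrite subr_eq0 => /eqP <-; rewrite /flow addrK.
by move: bb; rewrite eq_sym -subr_eq0 b10 eqxx.
Qed.

End BlockContinuity.

Lemma norm_le_enorm (R : realType) m n (M : 'M[R]_(m, n)) : `|M| <= enorm M.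
Proof.
rewrite [leLHS]/Num.norm/= mx_normrE; apply/bigmax_leP.
by split=> [|[i j] _]; [exact: enorm_ge0|exact: normr_le_enorm].
Qed.

Lemma enorm_tr (R : realType) m n (M : 'M[R]_(m, n)) : enorm M^T = enorm M.
Proof.
rewrite /enorm exchange_big; congr Num.sqrt.
by apply: eq_bigr => i _; apply: eq_bigr => j _; rewrite mxE.
Qed.

Section Sphere.
Context {R : realType} {d : nat}.

Lemma enorm_continuous m n : continuous (@enorm R m n).
Proof.
move=> M; apply: (@continuous_comp _ _ _ (fun N : 'M[R]_(m, n) => \sum_i \sum_j N i j ^+ 2) Num.sqrt).
  apply: (@cvg_sumr _ _ _ (nbhs M)) => i; apply: (@cvg_sumr _ _ _ (nbhs M)) => j.
  exact: (cvgM (@coord_continuous _ _ _ i j M) (@coord_continuous _ _ _ i j M)).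
exact: sqrt_continuous.
Qed.

Lemma sphere_compact : compact (@sphere R d).
Proof.
pose tr (v : 'rV[R]_d) : 'cV[R]_d := v^T.
have trc : continuous tr.
  move=> v; apply/(@cvg_mxP R _ (nbhs v) (nbhs_filter v)) => i j; rewrite /tr.
  under eq_fun do rewrite mxE; rewrite mxE; exact: coord_continuous.
have -> : sphere = tr @` (tr @^-1` sphere).
  apply/seteqP; split=> [x xS|x [v vS <-]//]; exists x^T; rewrite /tr /= trmxK//.
apply: continuous_compact; first exact: continuous_subspaceT.
apply: bounded_closed_compact.
  exists 1; split=> // M M1 v vS.
  rewrite /= (le_trans (norm_le_enorm v))// -enorm_tr; move: vS.
  by rewrite /sphere/= => ->; exact: ltW.
rewrite -[X in closed X]/((fun v => enorm (tr v)) @^-1` [set 1]).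
apply: preimage_closed; last exact: closed_eq.
move=> v _; apply: continuous_comp; first exact: trc.
exact: enorm_continuous.
Qed.

End Sphere.

Section Positivity.
Context {R : realType}.
Variables (Q : probability (seqspace R) R) (m : bool -> set R -> \bar R).
Hypothesis Q_cylinder : forall N U, (forall i, measurable (U i)) ->
  Q (cylinder N U) = (\prod_(0 <= i < N) m (odd i) (U i))%E.
Hypothesis m_itv_gt0 : forall i (s t : R), 0 <= s -> s < t ->
  (0 < m i `]s, t[%classic)%E.

Lemma box_gt0 N (t : nat -> R) r : (forall j, (j < N)%N -> 0 < t j) -> 0 < r ->
  exists U : nat -> set R, [/\ forall i, measurable (U i), (0 < Q (cylinder N U))%E &
    forall w, cylinder N U w -> forall j, (j < N)%N -> `|w j - t j| < r].
Proof.
move=> t0 r0; pose U j : set R := `]Num.max 0 (t j - r), (t j + r)[%classic.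
have mU i : measurable (U i) by exact: measurable_itv.
exists U; split=> // [|w Uw j jN]; last first.
  have := Uw j jN; rewrite /U /= in_itv/= gt_max => /andP[/andP[_ l] u].
  by rewrite ltr_distl l.
rewrite Q_cylinder//; elim: N t0 => [|N IHN] t0; first by rewrite big_geq// lte01.
rewrite big_nat_recr//= mule_gt0 ?IHN// => [j jN|].
  by apply: t0; exact: ltnW.
apply: m_itv_gt0; first by rewrite le_max lexx.
rewrite gt_max; apply/andP; split; last by rewrite ltrD2l gtrN.
by rewrite addr_gt0// t0.
Qed.

Lemma integral_box_ge (F : seqspace R -> \bar R) N U c : measurable_fun setT F ->
  (forall w, (0 <= F w)%E) -> (forall i, measurable (U i)) -> 0 <= c ->
  (forall w, cylinder N U w -> (c%:E <= F w)%E) ->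
  (c%:E * Q (cylinder N U) <= \int[Q]_w F w)%E.
Proof.
move=> mF F0 mU c0 Fc; have mC := measurable_cylinder N mU.
have -> : (c%:E * Q (cylinder N U) =
    \int[Q]_w (c%:E * (\1_(cylinder N U : set (seqspace R)) w : R)%:E))%E.
  rewrite ge0_integralZl_EFin//; last first.
    by apply/measurable_EFinP; exact: measurable_indic.
  congr (_ * _)%E.
  by refine (esym (etrans (integral_indic _ measurableT mC) _)); rewrite setIT.
apply: ge0_integral_le => // [w||w].
- by rewrite -EFinM lee_fin mulr_ge0.
- by apply: emeasurable_funM => //; apply/measurable_EFinP; exact: measurable_indic.
rewrite indicE; case: (boolP (w \in _)) => [|_]; last by rewrite mule0.
by rewrite inE mule1; exact: Fc.
Qed.

End Positivity.

Section HeavyTail.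
Context {R : realType} {d : nat}.
Variable A : bool -> 'M[R]_d.
Hypothesis hA : forall i, hurwitz (A i).
Variables (Q : probability (seqspace R) R) (m : bool -> set R -> \bar R).
Hypothesis Q_cylinder : forall N U, (forall i, measurable (U i)) ->
  Q (cylinder N U) = (\prod_(0 <= i < N) m (odd i) (U i))%E.
Hypothesis m_itv_gt0 : forall i (s t : R), 0 <= s -> s < t ->
  (0 < m i `]s, t[%classic)%E.

(** The index [k = n.*2.+1] means [k + 1] exponentials, that is [n.+1] whole blocks. This is where
    the oddness of [k] enters, and the origin of [k./2.+1] below. *)
Lemma switchprod_bprod n (t : nat -> R) : (forall j, (j < n.+1.*2)%N -> 0 < t j) ->
  switchprod A n.*2.+1 t = bprod A (rev (words n.+1 t)).
Proof.
elim: n => [|n IHn] tpos.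
  by rewrite /switchprod /= /bmat /= !durE ?mulmx1//; apply: tpos.
rewrite /words mkseqS rev_rcons /= -/(words n.+1 t) -IHn.
  by rewrite /bmat /= !durE ?tpos// /switchprod doubleS /= odd_double mulmxA.
by move=> j jn; apply: tpos; apply: (leq_trans jn); rewrite leq_double.
Qed.

Definition vector_moment p n (x : 'cV[R]_d) : \bar R :=
  (\int[Q]_w (enorm (bprod A (words n w) *m x) `^ p)%:E)%E.

Lemma measurable_vector_moment p n (x : 'cV[R]_d) : measurable_fun setT
  (fun w : seqspace R => (enorm (bprod A (words n w) *m x) `^ p)%:E).
Proof.
apply/measurable_EFinP; apply: (measurableT_comp (measurable_powR p)).
apply: measurable_enorm; apply: mx_measurableM; last exact: mx_measurable_cst.
by apply: mx_measurable_bprod; exact: measurable_id.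
Qed.

Lemma vector_moment_reversal p n x :
  vector_moment p n x = (\int[Q]_w (enorm (bprod A (rev (words n w)) *m x) `^ p)%:E)%E.
Proof.
rewrite /vector_moment -(integral_reversal Q_cylinder n (measurable_vector_moment p n x)); last first.
  by move=> w; rewrite lee_fin powR_ge0.
by apply: eq_integral => w _; rewrite words_reversal.
Qed.

(** Expansion by more than [1 + e] persists for durations and vectors close to the given ones, hence
    occurs with some probability [q > 0]; a large exponent makes this event alone contribute (1 +
    e)^p q >= 2. Homogeneity extends the bound from the sphere. *)
Lemma expanding_doubling k : odd k -> expanding_products A k ->
  exists p, 0 < p /\ forall x, ((2 * enorm x `^ p)%:E <= vector_moment p k./2.+1 x)%E.
Proof.
move=> kodd exp; set n := k./2.+1.
have kE : k = (k./2).*2.+1 by rewrite -[LHS]odd_double_half kodd.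
(* Stated jointly for [x'] near [x] and [p] near infinity, the form from which compactness extracts
   a common exponent. *)
have local x : sphere x -> \forall x' \near x & p \near +oo,
    sphere x' -> (2%:E <= vector_moment p n x')%E.
  move=> xS; have [t [tpos]] := exp x xS; rewrite xS kE switchprod_bprod; last first.
    by move=> j jn; apply: tpos; move: jn; rewrite kE -/n /n doubleS; lia.
  rewrite -/n; set y := bprod A _ *m x => y1.
  have tpos' j : (j < n.*2)%N -> 0 < t j.
    by move=> jn; apply: tpos; move: jn; rewrite /n doubleS {2}kE; lia.
  (* Half of the gain is kept as margin for the perturbation of durations and vector. *)
  have e0 : 0 < (enorm y - 1) / 2 by rewrite divr_gt0// subr_gt0.
  set e := (enorm y - 1) / 2 in e0.
  have [eta /= eta0 etaP] : exists2 eta, 0 < eta & forall z : 'cV[R]_d,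
      nrm1 (z - y) < eta -> 1 + e < enorm z.
    have /cvgrPdist_lt/(_ e e0)/nbhs_ballP[eta /= eta0 etaP] := @enorm_continuous R d 1 y.
    exists eta => // z zy; have := etaP z; rewrite -ball_normE /= distrC.
    move=> /(_ (le_lt_trans (norm_le_nrm1 _) zy)); rewrite ltr_distlC => /andP[+ _].
    by rewrite /e; lra.
  have [r r0 rP] := bprod_rev_words_continuous hA x tpos' eta0.
  have [U [mU QU Ur]] := box_gt0 Q_cylinder m_itv_gt0 tpos' r0.
  set q := fine (Q (cylinder n.*2 U)).
  have qE : Q (cylinder n.*2 U) = q%:E.
    by rewrite /q fineK// fin_num_measure//; exact: measurable_cylinder.
  have q0 : 0 < q by rewrite -lte_fin -qE.
  have [P [P0 Pq]] : exists P : R, 0 < P /\ forall p, P < p -> 2 <= (1 + e) `^ p * q.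
    have l0 : 0 < ln (1 + e) by rewrite ln_gt0// ltrDl.
    (* The threshold comes from [expR u >= 1 + u] with [u = p * ln (1 + e)]. *)
    exists (Num.max 1 (2 / q / ln (1 + e))); split; first by rewrite lt_max ltr01.
    move=> p; rewrite gt_max => /andP[_ pP].
    have pl : 2 / q < p * ln (1 + e) by rewrite -ltr_pdivrMr.
    rewrite -ler_pdivrMr// /powR gt_eqF ?addr_gt0//.
    rewrite (le_trans _ (expR_ge1Dx _))// ltW// (lt_trans pl)// ltrDr.
    exact: ltr01.
  exists (ball x (r / (d%:R + 1)), [set p | P < p]); first split.
  - by apply: nbhsx_ballx; rewrite divr_gt0// ltr_wpDl.
  - by exists P; split => //; exact: num_real.
  move=> [x' p] /= [xx' Pp] x'S; have p0 : 0 < p by exact: lt_trans Pp.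
  have xx'r : nrm1 (x' - x) < r.
    rewrite (le_lt_trans (nrm1_le_norm _))// mulr1.
    move: xx'; rewrite -ball_normE /= distrC ltr_pdivlMr ?ltr_wpDl// mulrC.
    by apply: le_lt_trans; rewrite ler_wpM2r// lerDl.
  rewrite vector_moment_reversal; apply: (@le_trans _ _ (((1 + e) `^ p)%:E * Q (cylinder n.*2 U))%E).
    by rewrite qE -EFinM lee_fin Pq.
  apply: integral_box_ge => //.
  - apply/measurable_EFinP; apply: (measurableT_comp (measurable_powR p)).
    apply: measurable_enorm; apply: mx_measurableM; last exact: mx_measurable_cst.
    exact: mx_measurable_bprod_rev.
  - by move=> w; rewrite lee_fin powR_ge0.
  - exact: powR_ge0.
  - move=> w Uw; rewrite lee_fin le_powR ?(ltW p0)// ?addr_ge0 ?(ltW e0)// ltW//.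
    by apply: etaP; apply: rP => //; exact: Ur.
have /compact_near_coveringP near := @sphere_compact R d.
have {near}/near[P [_ Pp]] := local.
exists (`|P| + 1); split; first by rewrite ltr_wpDl.
set p := _ + 1; have p0 : 0 < p by rewrite ltr_wpDl.
have HS : forall x, sphere x -> (2%:E <= vector_moment p n x)%E.
  move=> x xS; apply: (Pp p) => //.
  by rewrite (le_lt_trans (ler_norm P))// ltrDl.
move=> x; have [->|x0] := eqVneq x 0.
  have -> : enorm (0 : 'cV[R]_d) = 0.
    by apply/eqP; rewrite eq_le enorm_ge0 (le_trans (enorm_le_nrm1 _))// nrm1_0.
  rewrite powR0 ?gt_eqF// mulr0; apply: integral_ge0 => w _.
  by rewrite lee_fin powR_ge0.
have ex0 := enorm_gt0 x0; set u := (enorm x)^-1 *: x.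
have uS : sphere u.
  by rewrite /sphere /= /u enormZ ger0_norm ?invr_ge0 ?enorm_ge0// mulVf ?gt_eqF.
have xE : x = enorm x *: u by rewrite /u scalerA divff ?scale1r ?gt_eqF.
have -> : vector_moment p n x = ((enorm x `^ p)%:E * vector_moment p n u)%E.
  rewrite /vector_moment -ge0_integralZl_EFin ?powR_ge0//; last 2 first.
  - by move=> w _; rewrite lee_fin powR_ge0.
  - exact: measurable_vector_moment.
  apply: eq_integral => w _; rewrite -EFinM; congr (_%:E).
  rewrite [in LHS]xE -scalemxAr enormZ ger0_norm ?enorm_ge0//.
  by rewrite powRM ?enorm_ge0.
rewrite mulrC EFinM; apply: lee_wpmul2l; first by rewrite lee_fin powR_ge0.
exact: HS.
Qed.

End HeavyTail.

(** * No invariant law has all moments finite *)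

Section InfiniteMoment.
Context {R : realType} {d : nat}.
Variables (A : bool -> 'M[R]_d) (b : bool -> 'cV[R]_d).
Hypothesis hA : forall i, hurwitz (A i).
Hypothesis bb : b false != b true.
Variables (Q : probability (seqspace R) R) (m : bool -> set R -> \bar R).
Hypothesis Q_cylinder : forall N U, (forall i, measurable (U i)) ->
  Q (cylinder N U) = (\prod_(0 <= i < N) m (odd i) (U i))%E.
Hypothesis m_itv_gt0 : forall i (s t : R), 0 <= s -> s < t ->
  (0 < m i `]s, t[%classic)%E.

Lemma vector_moment_growth p n : 0 < p ->
  (forall x, ((2 * enorm x `^ p)%:E <= vector_moment A Q p n x)%E) ->
  forall j x, ((2 ^+ j * enorm x `^ p)%:E <= vector_moment A Q p (j * n)%N x)%E.
Proof.
move=> p0 doubling; elim=> [|j IHj] x.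
  rewrite expr0 mul1r mul0n /vector_moment /=.
  rewrite (_ : (\int[Q]_w _)%E = (\int[Q]_w (cst (enorm x `^ p)%:E w))%E).
    by rewrite integral_cst// [X in (_ * X)%E]probability_setT mule1.
  by apply: eq_integral => w _; rewrite mul1mx.
rewrite mulSn /vector_moment.
have mF := measurable_vector_moment A p (n + j * n) x.
have pw0 (z : 'cV[R]_d) : (0 <= (enorm z `^ p)%:E)%E by rewrite lee_fin powR_ge0.
have int_splice : (\int[Q]_w (enorm (bprod A (words (n + j * n) w) *m x) `^ p)%:E =
    \int[Q]_w \int[Q]_w'
    (enorm (bprod A (words n w) *m (bprod A (words (j * n) w') *m x)) `^ p)%:E)%E.
  refine (etrans (integral_splice Q_cylinder n mF (fun w => pw0 _)) _).
  apply: eq_integral => w _; apply: eq_integral => w' _.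
  by rewrite words_splice bprod_cat mulmxA.
rewrite [leRHS]int_splice.
pose F (z : seqspace R * seqspace R) : \bar R :=
  (enorm (bprod A (words n z.1) *m (bprod A (words (j * n) z.2) *m x)) `^ p)%:E.
have mFz : measurable_fun setT F.
  apply/measurable_EFinP; apply: (measurableT_comp (measurable_powR p)).
  apply: measurable_enorm; apply: mx_measurableM.
    by apply: mx_measurable_bprod; exact: measurable_fst.
  apply: mx_measurableM; last exact: mx_measurable_cst.
  by apply: mx_measurable_bprod; exact: measurable_snd.
have := @fubini_tonelli _ _ _ _ R Q Q F mFz (fun z => pw0 _).
rewrite /F /= => ->.
apply: (@le_trans _ _ (2%:E * vector_moment A Q p (j * n) x)%E).
  by rewrite exprS -mulrA EFinM; apply: lee_wpmul2l (IHj x); rewrite lee_fin.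
pose F2 (w : seqspace R) : \bar R := (enorm (bprod A (words (j * n) w) *m x) `^ p)%:E.
have mF2 : measurable_fun setT F2 := measurable_vector_moment A p (j * n) x.
have -> : (2%:E * vector_moment A Q p (j * n) x = \int[Q]_w (2%:E * F2 w))%E.
  exact: esym (ge0_integralZl_EFin Q measurableT (fun w _ => pw0 _) mF2 (ler0n R 2)).
apply: ge0_integral_le => [w'|||w'].
- by rewrite -EFinM lee_fin mulr_ge0// powR_ge0.
- by apply: emeasurable_funM; [exact: measurable_cst|exact: mF2].
- exact: (@measurable_fun_fubini_tonelli_G _ _ _ _ R Q _ mFz (fun z => pw0 _)).
- by rewrite -EFinM; exact: doubling.
Qed.

(** The exponent may exceed 1, where subadditivity fails; bounding the difference by a multiple of
    the larger norm replaces it at the price of a constant. *)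
Lemma powR_enormB p : 0 < p -> exists2 K, 0 <= K & forall x y : 'cV[R]_d,
  enorm (x - y) `^ p <= K * (enorm x `^ p + enorm y `^ p).
Proof.
move=> p0; pose D : R := 2 * (d%:R * 1%:R).
have D0 : 0 <= D by rewrite !mulr_ge0.
exists (D `^ p) => [|x y]; first exact: powR_ge0.
set M := Num.max (enorm x) (enorm y).
have M0 : 0 <= M by rewrite le_max enorm_ge0.
have le : enorm (x - y) <= D * M.
  rewrite (le_trans (enorm_le_nrm1 _))// (le_trans (nrm1B _ _))//.
  have -> : D * M = d%:R * 1%:R * M + d%:R * 1%:R * M by rewrite /D; ring.
  apply: lerD; [rewrite (le_trans (nrm1_le_enorm x))//|rewrite (le_trans (nrm1_le_enorm y))//].
    by rewrite ler_wpM2l ?mulr_ge0// le_max lexx.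
  by rewrite ler_wpM2l ?mulr_ge0// le_max lexx orbT.
rewrite (le_trans (le_powR (ltW p0) (enorm_ge0 _) le))// powRM// ler_wpM2l ?powR_ge0//.
rewrite /M /Num.max; case: ifP => _.
  by rewrite lerDr powR_ge0.
by rewrite lerDl powR_ge0.
Qed.

Lemma moves_gt0 p x : 0 < p ->
  (0 < \int[Q]_w (enorm (bmap A b (words 1 w) x - x) `^ p)%:E)%E.
Proof.
move=> p0; have [s [u [s0 u0]]] := bstep_moves hA x bb.
move=> ne; pose y := bstep A b (s, u) x - x.
have y0 : 0 < enorm y by apply: enorm_gt0; rewrite /y subr_eq0.
have d0 : 0 < d%:R + 1 :> R by rewrite ltr_wpDl.
(* The same quantity serves as tolerance and as lower bound: a vector [z] this close to [y]
   satisfies [enorm y <= (d + 1) enorm z + enorm y / 2]. *)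
have e0 : 0 < enorm y / (2 * (d%:R + 1)) by rewrite divr_gt0// mulr_gt0.
have [r r0 rP] := bstep_continuous b hA x s0 u0 e0.
pose t (j : nat) := if j is 0%N then s else u.
have t0 j : (j < 2)%N -> 0 < t j by case: j => [|j] _.
have [U [mU QU Ur]] := box_gt0 Q_cylinder m_itv_gt0 t0 r0.
have c0 : 0 < (enorm y / (2 * (d%:R + 1))) `^ p by rewrite powR_gt0.
apply: (@lt_le_trans _ _ (((enorm y / (2 * (d%:R + 1))) `^ p)%:E * Q (cylinder 2 U))%E).
  by rewrite mule_gt0.
apply: integral_box_ge => //.
- apply/measurable_EFinP; apply: (measurableT_comp (measurable_powR p)).
  apply: measurable_enorm; apply: mx_measurableB; last exact: mx_measurable_cst.
  by apply: mx_measurable_bmap; [exact: measurable_id|exact: mx_measurable_cst].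
- by move=> w; rewrite lee_fin powR_ge0.
- exact: powR_ge0.
move=> w Uw; rewrite lee_fin; apply: le_powR; [exact: ltW|exact: ltW|].
set z := bmap A b (words 1 w) x - x.
have zy : nrm1 (z - y) < enorm y / (2 * (d%:R + 1)).
  rewrite /z /y opprB addrA subrK; apply: rP; [exact: (Ur w Uw 0%N)|exact: (Ur w Uw 1%N)].
have ez : enorm y <= (d%:R + 1) * enorm z + enorm y / 2.
  rewrite (le_trans (enorm_le_nrm1 _))// (le_trans (nrm1_trig y z))// lerD//.
    rewrite (le_trans (nrm1_le_enorm z))// mulr1 ler_wpM2r ?enorm_ge0//.
    by rewrite lerDl.
  rewrite -nrm1N opprB (le_trans (ltW zy))// ler_wpM2l ?enorm_ge0//.
  by rewrite lef_pV2 ?posrE ?mulr_gt0// ler_peMr// lerDr.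
rewrite ler_pdivrMr; last by rewrite mulr_gt0.
have h : enorm y / 2 <= (d%:R + 1) * enorm z.
  by rewrite -(lerD2r (enorm y / 2)) -splitr.
rewrite [leRHS]mulrC -[leRHS]mulrA [leRHS]mulrC.
by rewrite -ler_pdivrMr.
Qed.

(* Coupling: if [x] has law [nu] then so does [f_w x], so the difference of the
   paths started at [f_w x] and [x] has bounded [p]-th moments, although they
   grow geometrically. *)
Lemma infinite_moment k : odd k -> expanding_products A k ->
  exists p, 0 < p /\ forall nu : probability (borelM R d 1) R,
    block_invariant A b Q nu -> (\int[nu]_y (enorm y `^ p)%:E = +oo)%E.
Proof.
move=> kodd kexp.
have [p [p0 doubling]] := expanding_doubling hA Q_cylinder m_itv_gt0 kodd kexp.
exists p; split=> // nu nu_inv; apply/eqP; rewrite -leye_eq leNgt; apply/negP.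
set M := (\int[nu]_y _)%E => Moo.
have [K K0 KP] := powR_enormB p0.
have growth := vector_moment_growth p0 doubling.
pose phi (y : borelM R d 1) : \bar R := (enorm y `^ p)%:E.
have phi0 y : (0 <= phi y)%E by rewrite lee_fin powR_ge0.
have mphi : measurable_fun setT phi.
  apply/measurable_EFinP; apply: (measurableT_comp (measurable_powR p)).
  by apply: measurable_enorm; exact: mx_measurable_id.
have M0 : (0 <= M)%E by apply: integral_ge0 => y _; exact: phi0.
have Mfin : M \is a fin_num by rewrite ge0_fin_numE.
pose G N (y : borelM R d 1) : \bar R := (\int[Q]_w phi (bmap A b (words N w) y))%E.
have G0 N y : (0 <= G N y)%E by apply: integral_ge0 => w _; exact: phi0.
have mG N : measurable_fun setT (G N).
  have mst := measurableT_comp mphi (measurable_step A b N).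
  exact: (@measurable_fun_fubini_tonelli_F _ _ _ _ R Q _ mst (fun z => phi0 _)).
pose f (w : seqspace R) (x : borelM R d 1) : borelM R d 1 := bmap A b (words 1 w) x.
have mf : measurable_fun setT (fun z : borelM R d 1 * seqspace R => f z.2 z.1).
  exact: measurable_step.
have mfx x : measurable_fun setT (f ^~ x) by exact: measurable_word_map.
pose D (x : borelM R d 1) : \bar R := (\int[Q]_w (enorm (f w x - x) `^ p)%:E)%E.
have D_gt0 x : (0 < D x)%E by exact: moves_gt0.
have mDz : measurable_fun setT (fun z : borelM R d 1 * seqspace R =>
    (enorm (f z.2 z.1 - z.1) `^ p)%:E).
  apply/measurable_EFinP; apply: (measurableT_comp (measurable_powR p)).
  apply: measurable_enorm; apply: mx_measurableB; first exact: mx_measurable_comp.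
  by apply: mx_measurable_comp; exact: measurable_fst.
have mD : measurable_fun setT D.
  apply: (@measurable_fun_fubini_tonelli_F _ _ _ _ R Q _ mDz) => z.
  by rewrite lee_fin powR_ge0.
have mDx x : measurable_fun setT (fun w : seqspace R => (enorm (f w x - x) `^ p)%:E).
  apply/measurable_EFinP; apply: (measurableT_comp (measurable_powR p)).
  apply: measurable_enorm; apply: mx_measurableB; first exact: mx_measurable_comp.
  exact: mx_measurable_cst.
have mGf N x : measurable_fun setT (fun w => G N (f w x)).
  exact: measurableT_comp (mG N) (mfx x).
have pow0 (z : 'cV[R]_d) : (0 <= (enorm z `^ p)%:E)%E by rewrite lee_fin powR_ge0.
have two0 j : 0 <= 2 ^+ j :> R by exact: exprn_ge0.
(* Paths driven by the same later blocks differ by a product applied to [f w x - x], so the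
   geometric growth bounds their difference from below and [KP] bounds it from above. *)
have pointwise j x w : ((2 ^+ j)%:E * (enorm (f w x - x) `^ p)%:E
    <= K%:E * (G (j * k./2.+1)%N (f w x) + G (j * k./2.+1)%N x))%E.
  rewrite -EFinM; apply: le_trans (growth j (f w x - x)) _; set N := (j * k./2.+1)%N.
  have mw y : measurable_fun setT (fun w : seqspace R => phi (bmap A b (words N w) y)).
    exact: (measurableT_comp mphi (measurable_word_map _ _ _ _)).
  pose g (w' : seqspace R) : \bar R := (phi (bmap A b (words N w') (f w x)) + phi (bmap A b (words N w') x))%E.
  have mg : measurable_fun setT g := emeasurable_funD (mw (f w x)) (mw x).
  have g0 w' : (0 <= g w')%E by exact: adde_ge0.
  have -> : (G N (f w x) + G N x = \int[Q]_w' g w')%E.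
    exact: esym (ge0_integralD Q measurableT (fun w _ => phi0 _) (mw (f w x))
      (fun w _ => phi0 _) (mw x)).
  have -> : (K%:E * \int[Q]_w' g w' = \int[Q]_w' (K%:E * g w'))%E.
    exact: esym (ge0_integralZl_EFin Q measurableT (fun w' _ => g0 w') mg K0).
  apply: ge0_integral_le => [w'|||w'].
  - exact: pow0.
  - exact: measurable_vector_moment.
  - exact: emeasurable_funM (measurable_cst _) mg.
  by rewrite /g /phi -EFinD -EFinM lee_fin -(bmapB A b); exact: KP.
have step1 j x : ((2 ^+ j)%:E * D x <= K%:E *
    (\int[Q]_w G (j * k./2.+1)%N (f w x) + G (j * k./2.+1)%N x))%E.
  set N := (j * k./2.+1)%N.
  pose g (w : seqspace R) : \bar R := (G N (f w x) + G N x)%E.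
  have mg : measurable_fun setT g := emeasurable_funD (mGf N x) (measurable_cst (G N x)).
  have g0 w : (0 <= g w)%E by exact: adde_ge0.
  have -> : (\int[Q]_w G N (f w x) + G N x = \int[Q]_w g w)%E.
    refine (etrans _ (esym (ge0_integralD Q measurableT (fun w _ => G0 N _) (mGf N x)
      (fun w _ => G0 N x) (measurable_cst (G N x))))).
    by congr (_ + _)%E; rewrite integral_cst// [X in (_ * X)%E]probability_setT mule1.
  have -> : (K%:E * \int[Q]_w g w = \int[Q]_w (K%:E * g w))%E.
    exact: esym (ge0_integralZl_EFin Q measurableT (fun w _ => g0 w) mg K0).
  have -> : ((2 ^+ j)%:E * D x = \int[Q]_w ((2 ^+ j)%:E * (enorm (f w x - x) `^ p)%:E))%E.
    exact: esym (ge0_integralZl_EFin Q measurableT (fun w _ => pow0 _) (mDx x) (two0 j)).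
  apply: ge0_integral_le => [w|||w].
  - by apply: mule_ge0; [rewrite lee_fin|exact: pow0].
  - exact: emeasurable_funM (measurable_cst _) (mDx x).
  - exact: emeasurable_funM (measurable_cst _) mg.
  exact: pointwise.
(* Averaged over [nu], both paths have [p]-th moment exactly [M]: one by [N] steps of invariance,
   the other by one more step; the right-hand side thus does not depend on [j]. *)
have step2 j : ((2 ^+ j)%:E * \int[nu]_x D x <= K%:E * (M + M))%E.
  set N := (j * k./2.+1)%N.
  have MG : M = (\int[nu]_x G N x)%E.
    exact/esym/(integral_step Q_cylinder nu_inv N mphi phi0).
  pose I (x : borelM R d 1) : \bar R := (\int[Q]_w G N (f w x))%E.
  have MI : M = (\int[nu]_x I x)%E.
    by rewrite [LHS]MG; exact/esym/(integral_step Q_cylinder nu_inv 1 (mG N) (G0 N)).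
  have mI : measurable_fun setT I.
    have mst := measurableT_comp (mG N) mf.
    exact: (@measurable_fun_fubini_tonelli_F _ _ _ _ R Q _ mst (fun z => G0 _ _)).
  have I0 x : (0 <= I x)%E by apply: integral_ge0 => w _; exact: G0.
  pose g (x : borelM R d 1) : \bar R := (I x + G N x)%E.
  have mg : measurable_fun setT g := emeasurable_funD mI (mG N).
  have g0 x : (0 <= g x)%E by exact: adde_ge0.
  have -> : (M + M = \int[nu]_x g x)%E.
    rewrite {1}MI {1}MG.
    exact: esym (ge0_integralD nu measurableT (fun x _ => I0 x) mI (fun x _ => G0 N x) (mG N)).
  have -> : (K%:E * \int[nu]_x g x = \int[nu]_x (K%:E * g x))%E.
    exact: esym (ge0_integralZl_EFin nu measurableT (fun x _ => g0 x) mg K0).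
  have -> : ((2 ^+ j)%:E * \int[nu]_x D x = \int[nu]_x ((2 ^+ j)%:E * D x))%E.
    exact: esym (ge0_integralZl_EFin nu measurableT (fun x _ => ltW (D_gt0 x)) mD (two0 j)).
  apply: ge0_integral_le => [x|||x].
  - by apply: mule_ge0; [rewrite lee_fin|exact: ltW].
  - exact: emeasurable_funM (measurable_cst _) mD.
  - exact: emeasurable_funM (measurable_cst _) mg.
  exact: step1.
have Dx0 x : (0 <= D x)%E by exact: ltW.
have cfin : (K%:E * (M + M))%E \is a fin_num by rewrite fin_numM// fin_numD Mfin.
have D0 : (\int[nu]_x D x = 0)%E.
  have Dfin : (\int[nu]_x D x)%E \is a fin_num.
    rewrite ge0_fin_numE; last by apply: integral_ge0 => x _; exact: Dx0.
    have := step2 0%N; rewrite expr0 mul1e => /le_lt_trans; apply.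
    by rewrite ltey_eq cfin.
  set r := fine (\int[nu]_x D x)%E; have rE : (\int[nu]_x D x = r%:E)%E by rewrite /r fineK.
  have r0 : 0 <= r by rewrite fine_ge0// integral_ge0// => x _; exact: Dx0.
  rewrite rE; congr (_%:E); apply/eqP; rewrite eq_le r0 andbT leNgt; apply/negP => rpos.
  set c := fine (K%:E * (M + M))%E.
  have rle j : 2 ^+ j * r <= c.
    by rewrite -lee_fin EFinM -rE /c fineK//; exact: step2.
  have c0 : 0 <= c by rewrite (le_trans _ (rle 0%N))// mulr_ge0 ?exprn_ge0.
  have := rle (Num.truncn (c / r)).+1; apply/negP; rewrite -ltNge -ltr_pdivrMr//.
  rewrite (lt_trans (truncnS_gt _))// -natrX ltr_nat.
  exact: ltn_expl.
have [N [mN N0 DN]] : ae_eq nu setT D (cst 0%E).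
  apply/(ae_eq_integral_abs nu measurableT mD).
  by under eq_integral do rewrite gee0_abs//.
have : nu setT = 0%E.
  apply: (@subset_measure0 _ _ _ nu _ N) => // x _; apply: DN => /= /(_ I) Dx.
  by have := D_gt0 x; rewrite Dx ltxx.
by rewrite probability_setT => /eqP; rewrite onee_eq0.
Qed.

End InfiniteMoment.

Lemma exponential_prob_itv_gt0 (R : realType) (r s t : R) : 0 < r -> 0 <= s -> s < t ->
  (0 < exponential_prob r `]s, t[%classic)%E.
Proof.
move=> r0 s0 st; pose c := r * expR (- r * t).
have c0 : 0 < c by rewrite mulr_gt0// expR_gt0.
apply: (@lt_le_trans _ _ (\int[lebesgue_measure]_(x in `]s, t[%classic) c%:E)%E).
  rewrite integral_cst//= lebesgue_measure_itv/= lte_fin st -EFinD -EFinM lte_fin.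
  by rewrite mulr_gt0// subr_gt0.
apply: ge0_le_integral => //.
- by move=> x _; rewrite lee_fin ltW.
- apply/measurable_EFinP; apply: measurable_funTS.
  exact: measurable_exponential_pdf.
move=> x /=; rewrite in_itv/= => /andP[sx xt].
rewrite lee_fin exponential_pdfE ?(le_trans s0 (ltW sx))// ler_wpM2l ?(ltW r0)//.
by rewrite ler_expR !mulNr lerN2 ler_wpM2l ?(ltW r0)// ltW.
Qed.

(** * The path space of the switching process *)

Section Paths.
Context {R : realType} {d : nat}.
Variables (A : bool -> 'M[R]_d) (b : bool -> 'cV[R]_d) (lam : bool -> R).
Context {dO : measure_display} {Omega : measurableType dO}.
Variables (P : probability Omega R) (T : nat -> Omega -> R) (I : R -> Omega -> bool).
Hypothesis hI : switching P lam T I.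
Variable X : 'cV[R]_d -> R -> Omega -> 'cV[R]_d.
Hypothesis hX : switched_process A b I X.

Let law_m (i : bool) : set R -> \bar R := exponential_prob (lam i).

Let X_law n : has_law P (interjump T n) (law_m (odd n)) := interjump_law hI n.

Definition path_law : probability (seqspace R) R := law P (measurable_sample X_law).

Lemma path_law_cylinder N U : (forall i, measurable (U i)) ->
  path_law (cylinder N U) = (\prod_(0 <= i < N) exponential_prob (lam (odd i)) (U i))%E.
Proof. exact: (sample_cylinder X_law (interjump_indep hI)). Qed.

Let sample w : seqspace R := fun n => interjump T n w.

Lemma path_chain x n w : X x (T n.*2 w) w = bmap A b (rev (words n (sample w))) x.
Proof.
exact: (trajectory_bmap (T := T ^~ w) (jump0 hI w) ((jump_lt hI)^~ w)
  (fun n t => @state_jump _ _ _ _ _ _ _ hI n w t) (hX x w)).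
Qed.

Lemma invariant_block (mu : probability (borelM R d 1) R) :
  invariant P (Ychain T X) mu <-> block_invariant A b path_law mu.
Proof.
have E (U : set (borelM R d 1)) (x : borelM R d 1) :
    P (Ychain T X x 1 @^-1` U) = path_law [set w | U (bmap A b (words 1 w) x)].
  rewrite [RHS](lawE P (measurable_sample X_law)); congr (P _); apply/seteqP.
  by split=> w; rewrite /= /Ychain path_chain.
split=> inv U mU; rewrite -[RHS]inv//; apply: eq_integral => x _; rewrite E//.
Qed.

Lemma duration_sample n w : duration (words n (sample w)) = T n.*2 w.
Proof.
elim: n => [|n IHn]; first by rewrite /duration big_nil (jump0 hI).
rewrite /words mkseqS -cats1 /duration big_cat big_seq1 -/(words n (sample w)).
rewrite -/(duration (words n (sample w))) IHn /= /sample /interjump !durE ?subr_gt0 ?(jump_lt hI)//.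
by rewrite doubleS; ring.
Qed.

(** The offsets cancel between two solutions with the same switching. This supplies the centered
    trajectory to which the Lyapunov exponent is applied. *)
Lemma centered_difference x w :
  trajectory A (fun=> 0) (fun t => I t w) x (fun t => X x t w - X 0 t w).
Proof.
have [x0 xc xd] := hX x w; have [z0 zc zd] := hX 0 w; split.
- by rewrite x0 z0 subr0.
- by move=> t; apply: cvgB; [exact: xc|exact: zc].
- move=> t t0 It; have := is_derive_mxB (xd t t0 It) (zd t t0 It).
  by rewrite -mulmxBr opprB addrA subrK subr0.
Qed.

Lemma late_contraction_cvg0 chi : lyapunov_exponent P A I chi -> chi < 0 ->
  path_law (late_contraction A (- chi / 4) n) @[n --> \oo] --> 0%E.
Proof.
move=> hchi chi0.
(* The limit gives an eventual rate [chi / 2]; half of it absorbs the factor [d * d] of the norm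
   comparisons, which leaves [chi / 4]. *)
have a0 : 0 < - chi / 4 by lra.
pose bad n : set Omega := sample @^-1` late_contraction A (- chi / 4) n.
have mbad n : measurable (bad n).
  rewrite -[X in measurable X]setTI; apply: (measurable_sample X_law) => //.
  exact: measurable_late_contraction.
have aeP : {ae P, forall w, forall j : 'I_d, forall z : R -> 'cV[R]_d,
    trajectory A (fun=> 0) (fun t => I t w) (delta_mx j 0) z ->
    t^-1 * ln (enorm (z t)) @[t --> +oo] --> chi}.
  apply: filter_forall => j; apply: hchi.
  apply/eqP => /matrixP/(_ j 0); rewrite !mxE !eqxx => /eqP.
  by rewrite oner_eq0.
have [N [mN PN NP]] := aeP.
have late w : ~ N w -> \forall n \near \oo, ~ bad n w.
  move=> Nw.
  have {}NP : forall (j : 'I_d) (z : R -> 'cV[R]_d),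
      trajectory A (fun=> 0) (fun t => I t w) (delta_mx j 0) z ->
      t^-1 * ln (enorm (z t)) @[t --> +oo] --> chi.
    by apply: contrapT => H; apply: Nw; exact: NP.
  pose S n := T n.*2 w.
  have Soo : S n @[n --> \oo] --> +oo.
    apply: (cvg_comp (fun n : nat => n.*2) (fun n => T n w) _ (jump_cvg hI w)).
    move=> V [k _ kV]; exists k => // n kn; apply: kV => /=.
    by apply: (leq_trans kn); rewrite -addnn leq_addr.
  pose z j t := X (delta_mx j 0) t w - X 0 t w.
  have zS j n : z j (S n) = bprod A (rev (words n (sample w))) *m delta_mx j 0.
    by rewrite /z /S !path_chain bmapB subr0.
  have lim j : (S n)^-1 * ln (enorm (z j (S n))) @[n --> \oo] --> chi.
    exact: (cvg_comp S (fun t => t^-1 * ln (enorm (z j t))) Soo (NP j _ (centered_difference _ _))).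
  have small : \forall n \near \oo, forall j : 'I_d,
      (S n)^-1 * ln (enorm (z j (S n))) < chi / 2.
    by apply: filter_forall => j; apply: (cvgr_lt chi (lim j)); lra.
  have big : \forall n \near \oo, 0 < S n /\ d%:R * d%:R < expR (- chi / 4 * S n).
    have : \forall t \near +oo, 0 < t /\ d%:R * d%:R < expR (- chi / 4 * t).
      apply: filterS2 (nbhs_pinfty_gt (num_real (0 : R)))
        (nbhs_pinfty_ge (num_real ((- chi / 4)^-1 * (d%:R * d%:R)))) => t t0 dt.
      split=> //; rewrite (lt_le_trans _ (expR_ge1Dx _))// ltr_pwDl//.
      by rewrite -ler_pdivrMl.
    exact: Soo.
  near=> n; rewrite /bad /preimage /late_contraction /=; apply/negP; rewrite -leNgt.
  have [S0 dS] : 0 < S n /\ d%:R * d%:R < expR (- chi / 4 * S n) by near: n.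
  have zn : forall j : 'I_d, (S n)^-1 * ln (enorm (z j (S n))) < chi / 2 by near: n.
  rewrite duration_sample -/(S n) nrm1_col.
  have col j : nrm1 (bprod A (rev (words n (sample w))) *m (delta_mx j 0 : 'cV[R]_d)) <=
      d%:R * expR (chi / 2 * S n).
    rewrite -zS (le_trans (nrm1_le_enorm _))// mulr1 ler_wpM2l//.
    have e0 : 0 < enorm (z j (S n)).
      apply: enorm_gt0; rewrite zS; apply/eqP => /(congr1 (mulmx (invmx (bprod A (rev (words n (sample w))))))).
      rewrite mulmx0 mulKmx ?bprod_unit// => /matrixP/(_ j 0); rewrite !mxE !eqxx => /eqP.
      by rewrite oner_eq0.
    rewrite -[leLHS]lnK// ler_expR ltW// [ltRHS]mulrC -ltr_pdivrMl//.
  rewrite (le_trans (ler_sum _ (fun j _ => col j)))// sumr_const card_ord -[leLHS]mulr_natl mulrA.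
  have -> : - (- chi / 4) * S n = - chi / 4 * S n + chi / 2 * S n by field.
  by rewrite expRD ler_wpM2r ?expR_ge0// ltW.
(* From almost sure to in probability: the tail unions decrease to a null set and dominate the bad
   events. *)
pose B n := \bigcup_(k in [set k | (n <= k)%N]) bad k.
have mB n : measurable (B n) by apply: bigcup_measurable => k _.
have BN : \bigcap_n B n `<=` N.
  move=> w Bw; apply: contrapT => /late[n _ nP].
  by have [k nk] := Bw n Logic.I; apply: nP.
have mIB : measurable (\bigcap_n B n) by apply: bigcapT_measurable.
have ni : {homo B : k l / (k <= l)%N >-> (l <= k)%O}.
  by move=> k l kl; apply/subsetPset => w [i li bi]; exists i => //=; exact: leq_trans li.
have Bfin : (P (B 0%N) < +oo)%E by rewrite (le_lt_trans (probability_le1 _ _)) ?ltry.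
have cvB := nonincreasing_cvg_mu Bfin mB mIB ni.
have IB0 : P (\bigcap_n B n) = 0%E by exact: (subset_measure0 _ _ BN).
apply: (@squeeze_cvge _ _ _ _ (cst 0%E) _ (P \o B)).
- apply: nearW => n /=; rewrite measure_ge0 /=.
  rewrite [X in (X <= _)%E](lawE P (measurable_sample X_law)).
  apply: le_measure; rewrite ?inE; [exact: mbad|exact: mB|].
  by move=> w bw; exists n => /=.
- exact: cvg_cst.
- by rewrite -IB0.
Unshelve. all: by end_near. Qed.

End Paths.

(** On a probability space y^q <= 1 + y^p for 0 <= q <= p, so the exponents with finite moment form
    an interval starting at 0; the threshold is its supremum, positive by [p0] and finite by
    [poo]. *)
Lemma moment_threshold (R : realType) (dT : measure_display) (T : measurableType dT)
    (P : probability T R) (f : T -> R) (p0 poo : R) :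
  measurable_fun setT f -> (forall x, 0 <= f x) -> 0 < p0 ->
  (\int[P]_x (f x `^ p0)%:E < +oo)%E -> 0 < poo ->
  (\int[P]_x (f x `^ poo)%:E = +oo)%E ->
  exists p1, [/\ 0 < p1,
    forall p, 0 <= p -> p < p1 -> (\int[P]_x (f x `^ p)%:E < +oo)%E &
    forall p, p1 < p -> (\int[P]_x (f x `^ p)%:E = +oo)%E].
Proof.
move=> mf f0 p0_gt0 fin_p0 poo_gt0 infin.
have mfp p : measurable_fun setT (fun x => (f x `^ p)%:E).
  by apply/measurable_EFinP; exact: (measurableT_comp (measurable_powR p)).
pose finite_exponents := [set p : R | 0 <= p /\ (\int[P]_x (f x `^ p)%:E < +oo)%E].
have smaller p q : 0 <= q -> q <= p -> (\int[P]_x (f x `^ p)%:E < +oo)%E ->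
    (\int[P]_x (f x `^ q)%:E < +oo)%E.
  move=> q0 qp fin_p.
  apply: (@le_lt_trans _ _ (\int[P]_x (1%:E + (f x `^ p)%:E))%E).
    apply: ge0_integral_le => [x|||x]; first by rewrite lee_fin powR_ge0.
    - exact: mfp.
    - by apply: emeasurable_funD.
    rewrite -EFinD lee_fin; have [f1|/ltW f1] := leP (f x) 1.
      by rewrite (le_trans (le_powR q0 (f0 x) f1))// powR1 lerDl powR_ge0.
    by rewrite (le_trans (ler_powR f1 qp))// lerDr.
  rewrite ge0_integralD//; last by move=> x _; rewrite lee_fin powR_ge0.
  rewrite integral_cst// [X in (_ * X)%E]probability_setT mule1.
  by rewrite lte_add_pinfty// ltry.
have ub_poo : ubound finite_exponents poo.
  move=> p [pge0 fin_p]; rewrite leNgt; apply/negP => /ltW poop.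
  by have := smaller p poo (ltW poo_gt0) poop fin_p; rewrite infin.
have sup_fin : has_sup finite_exponents.
  by split; [exists p0; split=> //; exact: ltW|exists poo].
exists (sup finite_exponents); split.
- apply: (lt_le_trans p0_gt0); apply: ub_le_sup; first by exists poo.
  by split=> //; exact: ltW.
- move=> p pge0 psup.
  have [q [_ fin_q] pq] := sup_gt sup_fin.1 psup.
  exact: (smaller q p pge0 (ltW pq)).
move=> p supp; apply/eqP; rewrite -leye_eq leNgt; apply/negP => fin_p.
suff : p <= sup finite_exponents by rewrite leNgt supp.
apply: ub_le_sup; first by exists poo.
split=> //; apply: le_trans (ltW supp); apply: (le_trans (ltW p0_gt0)).
by apply: ub_le_sup; [exists poo|split=> //; exact: ltW].
Qed.

Lemma msupport_bounded (R : realType) d (mu : probability (borelM R d 1) R) C :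
  mu [set y : 'cV[R]_d | C < nrm1 y] = 0%E -> bounded_set (msupport mu).
Proof.
move=> mu0; exists C; split; first exact: num_real.
move=> c Cc x x_supp; apply: le_trans (norm_le_nrm1 x) _; rewrite leNgt.
apply/negP => cx.
have : (0 < mu [set y : 'cV[R]_d | (C < nrm1 y)%R])%E.
  apply: x_supp; last exact: lt_trans cx.
  have cont : continuous (fun y : 'cV[R]_d => nrm1 y).
    move=> y; rewrite /nrm1; apply: (@cvg_sumr _ _ _ (nbhs y)) => i; apply: (@cvg_sumr _ _ _ (nbhs y)) => j.
    by apply: cvg_norm; exact: coord_continuous.
  exact: (open_comp (fun y _ => cont y) (@open_gt R C)).
by rewrite mu0 ltxx.
Qed.

Unset Implicit Arguments.

Theorem theorem1p2 (R : realType) (d : nat)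
    (A : bool -> 'M[R]_d) (b : bool -> 'cV[R]_d) (lam : bool -> R)
    (hA : forall i, hurwitz (A i)) (hb : b false != b true)
    (hlam : forall i, 0 < lam i)
    (dO : measure_display) (Omega : measurableType dO)
    (P : probability Omega R)
    (T : nat -> Omega -> R) (I : R -> Omega -> bool)
    (hI : switching P lam T I)
    (X : 'cV[R]_d -> R -> Omega -> 'cV[R]_d)
    (hX : switched_process A b I X) :
  ((forall v, control v -> ~ explodes A b v) ->
   exists mu : probability (borelM R d 1) R,
     invariant P (Ychain T X) mu /\ bounded_set (msupport mu))
  /\
  (forall chi : R, lyapunov_exponent P A I chi -> chi < 0 ->
   forall k : nat, odd k -> expanding_products A k ->
   forall (dO' : measure_display) (Omega' : measurableType dO')
     (P' : probability Omega' R)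
     (tau : nat -> Omega' -> R) (B : nat -> Omega' -> 'M[R]_d),
   exponential_times P' lam k tau -> iid_switchprod P' A k tau B ->
   directions_charged P' B -> density_component P' B ->
   exists mu : probability (borelM R d 1) R,
     [/\ invariant P (Ychain T X) mu,
         forall nu : probability (borelM R d 1) R,
           invariant P (Ychain T X) nu ->
           forall U : set (borelM R d 1), measurable U -> nu U = mu U &
         exists p1 : R, [/\ 0 < p1,
           forall p : R, 0 <= p -> p < p1 ->
             (\int[mu]_y (enorm y `^ p)%:E < +oo)%E &
           forall p : R, p1 < p ->
             (\int[mu]_y (enorm y `^ p)%:E = +oo)%E]]).
Proof.
pose Q := path_law hI.
pose m (i : bool) : set R -> \bar R := exponential_prob (lam i).
have Q_cyl N U : (forall i, measurable (U i)) ->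
    Q (cylinder N U) = (\prod_(0 <= i < N) m (odd i) (U i))%E.
  exact: path_law_cylinder.
have m_gt0 i (s t : R) : 0 <= s -> s < t -> (0 < m i `]s, t[%classic)%E.
  exact: exponential_prob_itv_gt0.
split.
- move=> /no_explosion_bounded[C bnd].
  have bprodC s : nrm1 (bprod A s) <= C.
    by apply: le_trans (bnd s); rewrite lerDr nrm1_ge0.
  have bmapC s : nrm1 (bmap A b s 0) <= C.
    by apply: le_trans (bnd s); rewrite lerDl nrm1_ge0.
  have p01 : 0 < (1 : R) <= 1 by rewrite ltr01 lexx.
  have [n mom1] := moment1_lt1 hA Q_cyl m_gt0 bprodC.
  have mom := moment_summable hA Q_cyl ler01 mom1.
  exists (stationary A b Q); split.
    by apply/(invariant_block hI hX); exact: (stationary_invariant b hA Q_cyl p01 mom).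
  apply: (@msupport_bounded _ _ _ C).
  by apply: (stationary_support hA p01 mom) => n' w; exact: bmapC.
move=> chi hchi chi0 k ko expk _ _ _ _ _ _ _ _ _.
have late := late_contraction_cvg0 hI hX hchi chi0.
have delta0 : 0 < - chi / 4 by lra.
have [n [n0 momn]] := moment_lt1 hA Q_cyl m_gt0 delta0 late.
have p01 : 0 < (n%:R^-1 : R) <= 1.
  by rewrite invr_gt0 ltr0n n0 invf_le1 ?ltr0n// ler1n.
have [p_gt0 _] := andP p01.
have mom := moment_summable hA Q_cyl (ltW p_gt0) momn.
exists (stationary A b Q).
have inv := stationary_invariant b hA Q_cyl p01 mom.
split.
- exact/(invariant_block hI hX).
- move=> nu /(invariant_block hI hX) nu_inv U mU.
  exact: (stationary_unique hA Q_cyl p01 mom nu_inv mU).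
have [poo [poo0 infin]] := infinite_moment hA hb Q_cyl m_gt0 ko expk.
apply: (moment_threshold _ _ p_gt0 _ poo0 (infin _ inv)).
- by apply: measurable_enorm; exact: mx_measurable_id.
- by move=> y; exact: enorm_ge0.
exact: (stationary_moment b hA p01 mom).
Qed.
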